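(* Let $\ell\ge 4$ and let $G_1,\dots,G_\ell$ be finitely generated residually finite groups such that, for each $1\le j\le\ell$, the centralizer in $G_j$ of every nonabelian subgroup of $G_j$ is trivial. Assume that at least four of the $G_j$ have a subgroup of index $2$. Let $d\ge2$. Then the genus of $\prod_{i=1}^d\left(\ast_{j=1}^{\ell}G_j\right)$ is infinite.
   Context: The genus $\mathcal G(G)$ of a finitely generated residually finite group $G$ is the set of isomorphism classes of finitely generated residually finite groups $H$ having the same set of isomorphism classes of finite quotients as $G$ (equivalently $\widehat H\cong\widehat G$). *)

(* Defs.v *)
From mathcomp Require Import all_boot.
From Stdlib Require Import List FunctionalExtensionality.
Set Implicit Arguments. Unset Strict Implicit. Unset Printing Implicit Defensive.

Record Grp : Type := Grp_ {
  carrier :> Type;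
  gmul : carrier -> carrier -> carrier;
  gone : carrier;
  ginv : carrier -> carrier;
  gmulA : forall x y z, gmul x (gmul y z) = gmul (gmul x y) z;
  gmul1 : forall x, gmul gone x = x;
  gmulV : forall x, gmul (ginv x) x = gone }.
Arguments gone {g}.

Definition is_hom (G H : Grp) (f : G -> H) : Prop :=
  forall x y, f (gmul x y) = gmul (f x) (f y).

Definition surjective_fun (A B : Type) (f : A -> B) : Prop :=
  forall b, exists a, f a = b.

Definition grp_iso (G H : Grp) : Prop :=
  exists (f : G -> H) (g : H -> G),
    is_hom f /\ (forall x, g (f x) = x) /\ (forall y, f (g y) = y).

Definition finite_grp (F : Grp) : Prop := exists s : list F, forall x, In x s.

Definition is_subgroup (G : Grp) (S : G -> Prop) : Prop :=
  S gone /\ (forall x y, S x -> S y -> S (gmul x y)) /\ (forall x, S x -> S (ginv x)).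

Definition finitely_generated (G : Grp) : Prop :=
  exists s : list G, forall S : G -> Prop, is_subgroup S ->
    (forall x, In x s -> S x) -> forall g, S g.

Definition residually_finite (G : Grp) : Prop :=
  forall g : G, g <> gone ->
    exists (F : Grp) (phi : G -> F), finite_grp F /\ is_hom phi /\ phi g <> gone.

Definition nonabelian_subgroup (G : Grp) (S : G -> Prop) : Prop :=
  is_subgroup S /\ exists x y, S x /\ S y /\ gmul x y <> gmul y x.

Definition CSA_trivial_centralizers (G : Grp) : Prop :=
  forall S : G -> Prop, nonabelian_subgroup S ->
    forall z : G, (forall s, S s -> gmul z s = gmul s z) -> z = gone.

(* G has a subgroup of index 2: H together with one other coset a H *)
Definition has_index2_subgroup (G : Grp) : Prop :=
  exists H : G -> Prop, is_subgroup H /\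
    exists a : G, ~ H a /\ forall x, H x \/ H (gmul (ginv a) x).

(* P with maps iota_j is a free product of the family G_j (j < l):
   the coproduct in the category of groups. *)
Definition is_free_product (l : nat) (G : 'I_l -> Grp) (P : Grp)
  (iota : forall j, G j -> P) : Prop :=
  (forall j, is_hom (iota j)) /\
  forall (K : Grp) (f : forall j, G j -> K), (forall j, is_hom (f j)) ->
    exists h : P -> K, is_hom h /\ (forall j x, h (iota j x) = f j x) /\
      forall h' : P -> K, is_hom h' -> (forall j x, h' (iota j x) = f j x) ->
        forall p, h' p = h p.

Arguments is_free_product : clear implicits.
Section Power.
Variables (P : Grp) (d : nat).
Definition pw_mul (x y : 'I_d -> P) : 'I_d -> P := fun i => gmul (x i) (y i).
Definition pw_one : 'I_d -> P := fun _ => gone.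
Definition pw_inv (x : 'I_d -> P) : 'I_d -> P := fun i => ginv (x i).
Lemma pw_mulA x y z : pw_mul x (pw_mul y z) = pw_mul (pw_mul x y) z.
Proof. apply: functional_extensionality => i; exact: gmulA. Qed.
Lemma pw_mul1 x : pw_mul pw_one x = x.
Proof. apply: functional_extensionality => i; exact: gmul1. Qed.
Lemma pw_mulV x : pw_mul (pw_inv x) x = pw_one.
Proof. apply: functional_extensionality => i; exact: gmulV. Qed.
Definition power_grp : Grp := Grp_ pw_mulA pw_mul1 pw_mulV.
End Power.

Definition same_finite_quotients (G H : Grp) : Prop :=
  forall F : Grp, finite_grp F ->
    ((exists f : G -> F, is_hom f /\ surjective_fun f) <->
     (exists f : H -> F, is_hom f /\ surjective_fun f)).

Definition in_genus (G H : Grp) : Prop :=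
  finitely_generated H /\ residually_finite H /\ same_finite_quotients G H.

(* The genus (set of isomorphism classes) is infinite: no finite list of
   groups represents all its isomorphism classes. *)
Definition genus_infinite (G : Grp) : Prop :=
  forall L : list Grp, exists H : Grp, in_genus G H /\
    forall K, In K L -> ~ grp_iso H K.

(* Main.v *)
(* For a normal subgroup N of P = G_1 * ... * G_l let H_N be the group of those x in P^d whose
   first two coordinates agree modulo N.  If N is normally finitely generated, P/N has no finite
   quotients and every central extension of P/N splits, then H_N is finitely generated and
   residually finite and has the finite quotients of P^d (Platonov-Tavgen, Bridson-Grunewald);
   and as two commuting normal subgroups of a free product of four nontrivial groups cannot
   both be nontrivial, H_N determines P/N.  So infinitely many quotients of this kind suffice.
   The four subgroups of index 2 make P surject onto the free product of four groups of order 2.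
   A simple group V of Thompson type, finitely presented modulo the centre, has powers V^n generated by four
   involutions tau_b, each of the form [[k1, k2], h] with relations ("doubled") that force it to
   remain an involution in central extensions.  Imposing on P the finitely many defining
   relations of V^n only up to centrality, together with tau_b = [[k1, k2], h], gives a perfect
   quotient X_n that is its own universal central extension, and n is recovered from X_n
   because X_n is V^n up to iterated central kernels. *)
Require Import Defs.
From Stdlib Require Import List Classical ClassicalEpsilon FunctionalExtensionality
  PropExtensionality ProofIrrelevance.
From mathcomp Require Import all_boot fingroup perm zify.
Set Implicit Arguments. Unset Strict Implicit. Unset Printing Implicit Defensive.

(* Neither an exact presentation nor the Schur multiplier of [V] is ever computed. A word in the
   swap generators is compared with its action on small cones only, so the swap relations determine
   [V] up to a central kernel; this is enough, since all relators are imposed up to centrality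
   anyway. Such weakened relations pass to every central extension because each generator is equated
   with a commutator word: a commutator word ignores central changes of its letters, and a bracket
   with central values is a homomorphism killing commutators. What this leaves open is that the
   lifted generators are involutions, without which the factors of the free product could not be
   mapped to them. The [doubled] shape closes the gap, at the price of doubling the number of
   transpositions twice: every generating involution consists of four or eight swaps. A reflection
   of 17 roots is one fixed root and eight transpositions; 17 being an odd prime, its reflections
   are all conjugate and every nontrivial rotation runs through all roots. *)
Declare Scope grp_scope.
Delimit Scope grp_scope with grp.
Infix "**" := gmul (at level 40, left associativity) : grp_scope.
Local Open Scope grp_scope.

(** * Groups *)

Section Basics.
Variable G : Grp.
Implicit Types x y z g h : G.

Lemma gmulVK x y : ginv x ** (x ** y) = y.
Proof. by rewrite gmulA gmulV gmul1. Qed.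

Lemma gmul_injl x y z : x ** y = x ** z -> y = z.
Proof. by move=> e; rewrite -(gmulVK x y) e gmulVK. Qed.

Lemma gmulr1 x : x ** gone = x.
Proof. by apply: (@gmul_injl (ginv x)); rewrite gmulA gmulV gmul1. Qed.

Lemma gmulrV x : x ** ginv x = gone.
Proof. by apply: (@gmul_injl (ginv x)); rewrite gmulVK gmulr1. Qed.

Lemma gmulKV x y : x ** (ginv x ** y) = y.
Proof. by rewrite gmulA gmulrV gmul1. Qed.

Lemma gmul_injr x y z : y ** x = z ** x -> y = z.
Proof. by move=> e; rewrite -(gmulr1 y) -(gmulrV x) gmulA e -gmulA gmulrV gmulr1. Qed.

Lemma ginv_eq x y : x ** y = gone -> y = ginv x.
Proof. by move=> e; apply: (@gmul_injl x); rewrite e gmulrV. Qed.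

Lemma ginvK x : ginv (ginv x) = x.
Proof. by rewrite -(@ginv_eq (ginv x) x) ?gmulV. Qed.

Lemma ginv1 : ginv (@gone G) = gone.
Proof. by rewrite -(@ginv_eq gone gone) ?gmul1. Qed.

Lemma ginvM x y : ginv (x ** y) = ginv y ** ginv x.
Proof. by symmetry; apply: ginv_eq; rewrite -gmulA gmulKV gmulrV. Qed.

Definition gE := (ginvM, ginvK, ginv1, gmul1, gmulr1, gmulV, gmulrV, gmulVK, gmulKV,
                  =^~ gmulA).

Definition cj g x := g ** x ** ginv g.
Definition comm x y := x ** y ** ginv x ** ginv y.
Definition central x := forall y, x ** y = y ** x.

Lemma cjM g x y : cj g (x ** y) = cj g x ** cj g y.
Proof. by rewrite /cj ?gE. Qed.

Lemma cjV g x : cj g (ginv x) = ginv (cj g x).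
Proof. by rewrite /cj ?gE. Qed.

Lemma cj1 g : cj g gone = gone.
Proof. by rewrite /cj ?gE. Qed.

Lemma cj_mul g h x : cj (g ** h) x = cj g (cj h x).
Proof. by rewrite /cj ?gE. Qed.

Lemma cj_cj g h x : cj g (cj h x) = cj (cj g h) (cj g x).
Proof. by rewrite /cj ?gE. Qed.

Lemma cjK g x : cj (ginv g) (cj g x) = x.
Proof. by rewrite /cj ?gE. Qed.

Lemma cjVK g x : cj g (cj (ginv g) x) = x.
Proof. by rewrite /cj ?gE. Qed.

Lemma cj_comm g x y : cj g (comm x y) = comm (cj g x) (cj g y).
Proof. by rewrite /comm !cjM !cjV. Qed.

Lemma commE x y : comm x y = x ** cj y (ginv x).
Proof. by rewrite /comm /cj ?gE. Qed.

Lemma cjE g x : cj g x = comm g x ** x.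
Proof. by rewrite /comm /cj ?gE. Qed.

Lemma comm1P x y : comm x y = gone <-> x ** y = y ** x.
Proof.
split=> e; last by rewrite /comm e ?gE.
by apply: (@gmul_injr (ginv (y ** x))); rewrite gmulrV -e /comm ?gE.
Qed.

Lemma cj_fixP g x : cj g x = x <-> g ** x = x ** g.
Proof.
split=> e; last by rewrite /cj e ?gE.
by rewrite -{2}e /cj ?gE.
Qed.

Lemma comm1_cj x y : comm x y = gone -> cj x y = y.
Proof. by rewrite comm1P cj_fixP. Qed.

Lemma central1 : central gone.
Proof. by move=> y; rewrite ?gE. Qed.

Lemma centralM x y : central x -> central y -> central (x ** y).
Proof. by move=> cx cy z; rewrite -gmulA cy gmulA cx -gmulA. Qed.

Lemma centralV x : central x -> central (ginv x).
Proof.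
by move=> cx y; apply: (@gmul_injl x); rewrite gmulKV gmulA cx -gmulA gmulrV gmulr1.
Qed.

Lemma commute_mul x y z : z ** x = x ** z -> z ** y = y ** z ->
  z ** (x ** y) = (x ** y) ** z.
Proof. by move=> ex ey; rewrite gmulA ex -gmulA ey gmulA. Qed.

Lemma commute_inv x z : z ** x = x ** z -> z ** ginv x = ginv x ** z.
Proof.
by move=> e; apply: (@gmul_injl x); rewrite gmulKV gmulA -e -gmulA gmulrV gmulr1.
Qed.

Lemma ginv_comm x y : ginv (comm x y) = comm y x.
Proof. by rewrite /comm ?gE. Qed.

Lemma cj_central z y : central z -> cj y z = z.
Proof. by move=> cz; rewrite cj_fixP cz. Qed.

Lemma central_cj z y : central z -> cj z y = y.
Proof. by move=> cz; rewrite cj_fixP cz. Qed.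

Lemma comm_centrall z x y : central z -> comm (z ** x) y = comm x y.
Proof.
move=> cz; rewrite !commE ginvM cjM (@cj_central (ginv z)); last exact: centralV.
by rewrite gmulA -(gmulA z); apply: central_cj.
Qed.

Lemma comm_centralr z x y : central z -> comm x (z ** y) = comm x y.
Proof. by move=> cz; rewrite -ginv_comm comm_centrall // ginv_comm. Qed.

Lemma comm_commutel w x y : w ** x = x ** w -> w ** y = y ** w -> comm (w ** x) y = comm x y.
Proof.
move=> wx wy; rewrite !commE ginvM cjM; have -> : cj y (ginv w) = ginv w.
  by apply/cj_fixP; rewrite commute_inv.
rewrite gmulA -(gmulA w); apply/cj_fixP; apply: commute_mul => //; rewrite /cj.
by do !apply: commute_mul => //; apply: commute_inv.
Qed.

Definition is_normal (N : G -> Prop) :=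
  is_subgroup N /\ forall g x, N x -> N (cj g x).

Lemma subgroup_cj (S : G -> Prop) g x : is_subgroup S -> S g -> S x -> S (cj g x).
Proof. by move=> [_ [SM SV]] Sg Sx; apply: (SM) (SV _ Sg); apply: SM. Qed.

Lemma subgroup_comm (S : G -> Prop) x y : is_subgroup S -> S x -> S y -> S (comm x y).
Proof. by move=> [_ [SM SV]] Sx Sy; apply: (SM) (SV _ Sy); apply: (SM) (SV _ Sx); apply: SM. Qed.

Lemma central_normal : is_normal central.
Proof.
split; first by split; [exact: central1 | split; [exact: centralM | exact: centralV]].
by move=> g x cx; rewrite /cj -(cx g) -gmulA gmulrV gmulr1.
Qed.

End Basics.

Section Hom.
Variables (G H : Grp) (f : G -> H).
Hypothesis fM : is_hom f.

Lemma hom1 : f gone = gone.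
Proof. by apply: (@gmul_injl _ (f gone)); rewrite -fM ?gE. Qed.

Lemma homV x : f (ginv x) = ginv (f x).
Proof. by apply: ginv_eq; rewrite -fM gmulrV hom1. Qed.

Lemma hom_cj g x : f (cj g x) = cj (f g) (f x).
Proof. by rewrite /cj !fM homV. Qed.

Lemma hom_comm x y : f (comm x y) = comm (f x) (f y).
Proof. by rewrite /comm !fM !homV. Qed.

Lemma image_subgroup (S : G -> Prop) : is_subgroup S ->
  is_subgroup (fun y => exists x, S x /\ f x = y).
Proof.
move=> [S1 [SM SV]]; split; first by exists gone; rewrite hom1.
split=> [_ _ [x [Sx <-]] [y [Sy <-]]|_ [x [Sx <-]]].
- by exists (x ** y); split; [apply: SM | rewrite fM].
- by exists (ginv x); split; [apply: SV | rewrite homV].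
Qed.

Lemma preimage_subgroup (S : H -> Prop) : is_subgroup S -> is_subgroup (fun x => S (f x)).
Proof.
move=> [S1 [SM SV]]; rewrite /is_subgroup hom1; split=> //.
by split=> [x y Sx Sy | x Sx]; rewrite ?fM ?homV; auto.
Qed.

Lemma preimage_normal (S : H -> Prop) : is_normal S -> is_normal (fun x => S (f x)).
Proof.
by move=> [SS SJ]; split=> [|g x Sx]; [apply: preimage_subgroup | rewrite hom_cj; apply: SJ].
Qed.

End Hom.

Lemma trivial_normal (G : Grp) : is_normal (fun x : G => x = gone).
Proof.
split; last by move=> g x ->; rewrite cj1.
by split=> //; split=> [x y -> ->|x ->]; rewrite ?gE.
Qed.

Lemma cj_hom (G : Grp) (g : G) : is_hom (cj g).
Proof. by move=> x y; rewrite cjM. Qed.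

Lemma hom_comp (G H K : Grp) (f : G -> H) (g : H -> K) :
  is_hom f -> is_hom g -> is_hom (fun x => g (f x)).
Proof. by move=> fM gM x y; rewrite fM gM. Qed.

Lemma hom_eq_subgroup (G H : Grp) (f g : G -> H) : is_hom f -> is_hom g ->
  is_subgroup (fun x => f x = g x).
Proof.
move=> fM gM; rewrite /is_subgroup (hom1 fM) (hom1 gM); split=> //; split.
- by move=> x y ex ey; rewrite fM gM ex ey.
- by move=> x e; rewrite (homV fM) (homV gM) e.
Qed.

(** * Subgroups and quotients as groups in their own right *)

Section SubGrp.
Variables (G : Grp) (S : G -> Prop).
Hypothesis SS : is_subgroup S.

Let sub_ex (x y : {x | S x}) : proj1_sig x = proj1_sig y -> x = y.
Proof. exact: eq_sig_hprop (fun _ => @proof_irrelevance _) x y. Qed.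

Definition sub_mul (x y : {x | S x}) : {x | S x} :=
  exist S _ (proj1 (proj2 SS) _ _ (proj2_sig x) (proj2_sig y)).
Definition sub_one : {x | S x} := exist S _ (proj1 SS).
Definition sub_inv (x : {x | S x}) : {x | S x} :=
  exist S _ (proj2 (proj2 SS) _ (proj2_sig x)).

Lemma sub_mulA x y z : sub_mul x (sub_mul y z) = sub_mul (sub_mul x y) z.
Proof. by apply: sub_ex; rewrite /= gmulA. Qed.
Lemma sub_mul1 x : sub_mul sub_one x = x.
Proof. by apply: sub_ex; rewrite /= gmul1. Qed.
Lemma sub_mulV x : sub_mul (sub_inv x) x = sub_one.
Proof. by apply: sub_ex; rewrite /= gmulV. Qed.

Definition sub_grp : Grp := Grp_ sub_mulA sub_mul1 sub_mulV.
Definition sval_grp (x : sub_grp) : G := proj1_sig x.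

Lemma sval_hom : is_hom sval_grp.
Proof. by []. Qed.

Lemma sval_grp_inj : injective sval_grp.
Proof. exact: sub_ex. Qed.

Lemma sval_grpP (x : sub_grp) : S (sval_grp x).
Proof. exact: proj2_sig. Qed.

Definition Sub_grp x (Sx : S x) : sub_grp := exist S x Sx.

Lemma corestrict_hom (H : Grp) (f : H -> G) (fS : forall x, S (f x)) :
  is_hom f -> is_hom (fun x => Sub_grp (fS x)).
Proof. by move=> fM x y; apply: sval_grp_inj; rewrite /= fM. Qed.

End SubGrp.

Section Quotient.
Variables (G : Grp) (N : G -> Prop).
Hypothesis nN : is_normal N.

(** Cosets are predicates, so that extensionality turns congruence modulo [N] into equality. *)
Let cls (g : G) : G -> Prop := fun x => N (ginv g ** x).
Let Q := {A : G -> Prop | exists g, A = cls g}.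

Let clsP g h : cls g = cls h <-> N (ginv g ** h).
Proof.
case: nN => [[N1 [NM NV]] _]; split=> [e|Ngh].
  by rewrite -/(cls g h) e /cls gmulV.
apply: functional_extensionality => x; apply: propositional_extensionality; rewrite /cls.
split=> [Ngx|Nhx].
- have -> : ginv h ** x = ginv (ginv g ** h) ** (ginv g ** x) by rewrite ?gE.
  by apply: NM => //; apply: NV.
- have -> : ginv g ** x = (ginv g ** h) ** (ginv h ** x) by rewrite ?gE.
  exact: NM.
Qed.

Let pr (g : G) : Q := exist _ (cls g) (ex_intro _ g erefl).
Let rep (A : Q) : G := proj1_sig (constructive_indefinite_description _ (proj2_sig A)).

Let prP g h : pr g = pr h <-> N (ginv g ** h).
Proof.
rewrite -clsP; split=> [e|e]; first by case: e.
exact: (@eq_sig_hprop _ _ (fun _ => @proof_irrelevance _) (pr g) (pr h)).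
Qed.

Let repK A : pr (rep A) = A.
Proof.
rewrite /rep; case: constructive_indefinite_description => g e /=.
exact: (@eq_sig_hprop _ _ (fun _ => @proof_irrelevance _) (pr g) A (esym e)).
Qed.

Let qmul (A B : Q) : Q := pr (rep A ** rep B).
Let qinv (A : Q) : Q := pr (ginv (rep A)).

Let prM g h : pr (g ** h) = qmul (pr g) (pr h).
Proof.
case: nN => [[N1 [NM NV]] NJ]; apply/prP.
set g' := rep (pr g); set h' := rep (pr h).
have Ng : N (ginv g ** g') by apply/prP; rewrite repK.
have Nh : N (ginv h ** h') by apply/prP; rewrite repK.
have -> : ginv (g ** h) ** (g' ** h') = cj (ginv h) (ginv g ** g') ** (ginv h ** h').
  by rewrite /cj ?gE.
by apply: NM Nh; apply: NJ.
Qed.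

Let prV g : pr (ginv g) = qinv (pr g).
Proof.
case: nN => [[N1 [NM NV]] NJ]; apply/prP.
have Ng : N (ginv g ** rep (pr g)) by apply/prP; rewrite repK.
have -> : ginv (ginv g) ** ginv (rep (pr g)) = cj g (ginv (ginv g ** rep (pr g))).
  by rewrite /cj ?gE.
by apply: NJ; apply: NV.
Qed.

Lemma quotient_exists : exists (X : Grp) (q : G -> X),
  is_hom q /\ surjective_fun q /\ forall g, q g = gone <-> N g.
Proof.
have mA A B C : qmul A (qmul B C) = qmul (qmul A B) C.
  by rewrite -(repK A) -(repK B) -(repK C) -!prM gmulA.
have m1 A : qmul (pr gone) A = A by rewrite -(repK A) -prM gmul1.
have mV A : qmul (qinv A) A = pr gone by rewrite -(repK A) -prV -prM gmulV.
exists (Grp_ mA m1 mV), pr; split; first exact: prM.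
split=> [A|g]; first by exists (rep A); apply: repK.
split=> [/prP|Ng]; last apply/prP.
- by rewrite gmulr1 => /(proj2 (proj2 (proj1 nN))); rewrite ginvK.
- by rewrite gmulr1; apply: (proj2 (proj2 (proj1 nN))).
Qed.

End Quotient.

Lemma hom_factor (G X Y : Grp) (q : G -> X) (f : G -> Y) :
  is_hom q -> surjective_fun q -> is_hom f -> (forall g, q g = gone -> f g = gone) ->
  exists f' : X -> Y, is_hom f' /\ forall g, f' (q g) = f g.
Proof.
move=> qM qS fM qf.
have fq g h : q g = q h -> f g = f h.
  move=> e; apply: (@gmul_injl _ (ginv (f h))).
  by rewrite gmulV -(homV fM) -fM; apply: qf; rewrite qM (homV qM) e gmulV.
pose s x := proj1_sig (constructive_indefinite_description _ (qS x)).
have sK x : q (s x) = x by rewrite /s; case: constructive_indefinite_description.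
exists (fun x => f (s x)); split=> [x y|g]; last exact/fq/sK.
by rewrite -fM; apply: fq; rewrite qM !sK.
Qed.

(** * Permutation groups and finiteness *)

Section SymGrp.
Variable T : Type.
(** The inverse is a field, so inverting needs no choice; [symP] shows that it adds no
    information. *)
Record sym := MkSym { sfun :> T -> T; sfinv : T -> T;
  sfunK : forall x, sfinv (sfun x) = x; sfinvK : forall x, sfun (sfinv x) = x }.

Lemma symP (s t : sym) : (forall x, s x = t x) -> s = t.
Proof.
case: s t => f f' fK f'K [g g' gK g'K] /= /functional_extensionality e; subst g.
have e : f' = g' by apply: functional_extensionality => x; rewrite -{1}(g'K x) fK.
by subst g'; congr MkSym; apply: proof_irrelevance.
Qed.

Definition sym_mul (s t : sym) : sym.
Proof.
exists (fun x => s (t x)) (fun x => sfinv t (sfinv s x)) => x; first by rewrite !sfunK.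
by rewrite !sfinvK.
Defined.
Definition sym_one : sym := @MkSym id id (fun _ => erefl) (fun _ => erefl).
Definition sym_inv (s : sym) : sym := MkSym (@sfinvK s) (@sfunK s).

Lemma sym_mulA x y z : sym_mul x (sym_mul y z) = sym_mul (sym_mul x y) z.
Proof. exact: symP. Qed.
Lemma sym_mul1 x : sym_mul sym_one x = x.
Proof. exact: symP. Qed.
Lemma sym_mulV x : sym_mul (sym_inv x) x = sym_one.
Proof. by apply: symP => t /=; rewrite sfunK. Qed.
Definition sym_grp : Grp := Grp_ sym_mulA sym_mul1 sym_mulV.
End SymGrp.

Definition fin (T : Type) := exists s : list T, forall x, In x s.

Lemma fin_inj (A B : Type) (f : A -> B) (s : list B) :
  injective f -> (forall x, In (f x) s) -> fin A.
Proof.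
move=> fI fs; suff [r rP] : exists r : list A, forall x, In (f x) s -> In x r.
  by exists r => x; apply: rP.
elim: s {fs} => [|b s [r rP]]; first by exists nil.
have [[a e]|ne] := classic (exists a, f a = b).
  exists (a :: r) => x /= [ex|/rP]; last by right.
  by left; apply: fI; rewrite e.
exists r => x /= [ex|/rP //]; by case: ne; exists x.
Qed.

Lemma fin_lists (T : Type) (s : list T) n :
  exists r : list (list T), forall l : list T,
    (forall x, In x l -> In x s) -> (length l <= n)%N -> In l r.
Proof.
elim: n => [|n [r rP]]; first by exists (nil :: nil)%list; case=> //=; left.
exists (nil :: flat_map (fun l => List.map (fun a => a :: l) s) r)%list => -[|a l] ls ln; first by left.
right; apply/in_flat_map; exists l; split; last by apply/in_map_iff; exists a; split=> //; apply: ls; left.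
by apply: rP => // x xl; apply: ls; right.
Qed.

Lemma fin_sym (T : Type) : fin T -> fin (sym T).
Proof.
move=> [s sP]; have [r rP] := fin_lists s (length s).
apply: (@fin_inj _ _ (fun f : sym T => List.map f s) r) => [f g e|f]; last first.
  by apply: rP => //; rewrite length_map.
apply: symP => x; have := sP x; elim: s e {sP rP} => //= a s IH [ea es].
by case=> [<- //|]; apply: IH.
Qed.

Lemma fin_surj (A B : Type) (f : A -> B) : surjective_fun f -> fin A -> fin B.
Proof.
move=> fS [s sP]; exists (List.map f s) => b; have [a <-] := fS b; exact: in_map.
Qed.

Lemma fin_sub (A : Type) (S : A -> Prop) : fin A -> fin {x | S x}.
Proof.
move=> [s sP]; apply: (@fin_inj _ _ (fun x => proj1_sig x) s) => [x y|x]; last exact: sP.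
exact: eq_sig_hprop (fun _ => @proof_irrelevance _) x y.
Qed.

Section ProdGrp.
Variables G H : Grp.
Definition prod_mul (x y : G * H) : G * H := (x.1 ** y.1, x.2 ** y.2).
Definition prod_inv (x : G * H) : G * H := (ginv x.1, ginv x.2).
Lemma prod_mulA x y z : prod_mul x (prod_mul y z) = prod_mul (prod_mul x y) z.
Proof. by rewrite /prod_mul /= !gmulA. Qed.
Lemma prod_mul1 x : prod_mul (gone, gone) x = x.
Proof. by case: x => a b; rewrite /prod_mul /= !gmul1. Qed.
Lemma prod_mulV x : prod_mul (prod_inv x) x = (gone, gone).
Proof. by rewrite /prod_mul /= !gmulV. Qed.
Definition prod_grp : Grp := Grp_ prod_mulA prod_mul1 prod_mulV.

Lemma fin_prod : fin G -> fin H -> fin prod_grp.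
Proof.
move=> [s sP] [r rP]; exists (list_prod s r) => -[a b]; exact: in_prod.
Qed.
End ProdGrp.

(** * Terms and generators *)

(** Words are kept as syntax because one relator has to be evaluated in several groups: a power of
    [V], the free product, its quotient and central extensions of that quotient. *)
Inductive term (I : Type) : Type :=
  Var of I | One | Mul of term I & term I | Inv of term I.
Arguments One {I}.

Fixpoint ev (I : Type) (Y : Grp) (s : I -> Y) (t : term I) : Y :=
  match t with
  | Var i => s i
  | One => gone
  | Mul a b => ev s a ** ev s b
  | Inv a => ginv (ev s a)
  end.

Fixpoint tsub (I J : Type) (u : I -> term J) (t : term I) : term J :=
  match t with
  | Var i => u i
  | One => One
  | Mul a b => Mul (tsub u a) (tsub u b)
  | Inv a => Inv (tsub u a)
  end.

Definition tcj I (a b : term I) := Mul (Mul a b) (Inv a).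
Definition tcomm I (a b : term I) := Mul (Mul (Mul a b) (Inv a)) (Inv b).

Section Terms.
Variables (I : Type) (Y : Grp) (s : I -> Y).

Lemma ev_tsub J (u : J -> term I) t : ev s (tsub u t) = ev (fun j => ev s (u j)) t.
Proof. by elim: t => //= [a -> b ->|a ->]. Qed.

Lemma ev_hom (Z : Grp) (f : Y -> Z) t : is_hom f -> f (ev s t) = ev (fun i => f (s i)) t.
Proof.
move=> fM; elim: t => //= [|a IHa b IHb|a IHa]; first exact: hom1.
- by rewrite fM IHa IHb.
- by rewrite homV // IHa.
Qed.

Lemma ev_subgroup (S : Y -> Prop) t : is_subgroup S -> (forall i, S (s i)) -> S (ev s t).
Proof. by move=> [S1 [SM SV]] Ss; elim: t => //= [a Sa b Sb|a Sa]; auto. Qed.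

Lemma eq_ev (s' : I -> Y) t : (forall i, s i = s' i) -> ev s t = ev s' t.
Proof. by move=> e; elim: t => //= [a -> b ->|a ->]. Qed.

Definition generates := forall y, exists t, ev s t = y.

Lemma ev_is_subgroup : is_subgroup (fun y => exists t, ev s t = y).
Proof.
split; first by exists One.
by split=> [_ _ [a <-] [b <-]|_ [a <-]]; [exists (Mul a b) | exists (Inv a)].
Qed.

Lemma generates_subgroup (S : Y -> Prop) : generates -> is_subgroup S ->
  (forall i, S (s i)) -> forall y, S y.
Proof. by move=> sG SS Ss y; have [t <-] := sG y; apply: ev_subgroup. Qed.

Lemma generates_of_subgroup :
  (forall S : Y -> Prop, is_subgroup S -> (forall i, S (s i)) -> forall y, S y) -> generates.
Proof. by apply=> [|i]; [exact: ev_is_subgroup | exists (Var i)]. Qed.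

Lemma commute_generates x : generates -> (forall i, x ** s i = s i ** x) -> central x.
Proof.
move=> sG sx y; move: y; apply: generates_subgroup => //; split; first by rewrite ?gE.
by split=> [a b|a]; [apply: commute_mul | apply: commute_inv].
Qed.

Definition gen_grp : Grp := sub_grp ev_is_subgroup.
Definition gen_gen (i : I) : gen_grp := Sub_grp ev_is_subgroup (ex_intro _ (Var i) erefl).
End Terms.

Lemma sval_ev I (Y : Grp) (s : I -> Y) t : sval_grp (ev (gen_gen s) t) = ev s t.
Proof. exact: (ev_hom (gen_gen s) t (@sval_hom _ _ _)). Qed.

Lemma generates_gen (I : Type) (Y : Grp) (s : I -> Y) : generates (gen_gen s).
Proof.
by move=> y; have [t te] := sval_grpP y; exists t; apply: sval_grp_inj; rewrite sval_ev.
Qed.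

Lemma generates_image (I : Type) (Y Z : Grp) (s : I -> Y) (f : Y -> Z) :
  is_hom f -> surjective_fun f -> generates s -> generates (fun i => f (s i)).
Proof.
by move=> fM fS sG z; have [y <-] := fS z; have [t <-] := sG y; exists t; rewrite ev_hom.
Qed.

(** With [u = comm k1 k2] and [v = cj h u] one has [t = u ** ginv v]. The model is a pair of
    conjugate involutions with disjoint supports. *)
Definition doubled (Y : Grp) (t : Y) := exists k1 k2 h : Y,
  [/\ t = comm (comm k1 k2) h, comm k1 (cj h (comm k1 k2)) = gone,
      comm k2 (cj h (comm k1 k2)) = gone & comm k1 k2 ** comm k1 k2 = gone].

Lemma doubled_hom (Y Z : Grp) (f : Y -> Z) t : is_hom f -> doubled t -> doubled (f t).
Proof.
move=> fM [k1 [k2 [h [-> e1 e2 e3]]]]; exists (f k1), (f k2), (f h).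
by split; rewrite -?(hom_comm fM) -?(hom_cj fM) -?(hom_comm fM) -?fM ?e1 ?e2 ?e3 ?(hom1 fM).
Qed.

(* Relations may be weakened to hold modulo the centre, and the generator
   [comm u h] is still an involution: [cj h u] commutes with [u] exactly, because [u] is a
   commutator of elements commuting with [cj h u] modulo the centre. *)
Lemma doubled_square (Y : Grp) (k1 k2 h : Y) (u := comm k1 k2) :
  central (comm k1 (cj h u)) -> central (comm k2 (cj h u)) -> central (u ** u) ->
  comm u h ** comm u h = gone.
Proof.
rewrite -/u; move=> c1 c2 cu; set v := cj h u in c1 c2 *.
have vu : cj v u = u.
  move: (v) c1 c2 => w c1 c2; rewrite {1 2}/u.
  by rewrite cj_comm !(cjE w) -!(ginv_comm _ w) comm_centrall ?comm_centralr //; apply: centralV.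
have vv : v ** v = u ** u.
  by rewrite /v -cjM /cj -(cu h) -gmulA gmulrV gmulr1.
have -> : comm u h = u ** ginv v by rewrite /v /comm /cj ?gE.
clearbody u; move: (v) vu vv => w /cj_fixP wu ww.
have e : ginv w ** u = u ** ginv w by symmetry; apply: commute_inv.
have -> : u ** ginv w ** (u ** ginv w) = u ** (ginv w ** u) ** ginv w by rewrite -!gmulA.
by rewrite e -!gmulA -ginvM ww (gmulA u) gmulrV.
Qed.

(** * Direct powers *)

Section PowerGrp.
Variables (P : Grp) (d : nat).
Local Notation Pd := (power_grp P d).
Implicit Types (x y : Pd) (i k : 'I_d) (p q : P).

Lemma pw_ext x y : (forall i, x i = y i) -> x = y.
Proof. exact: functional_extensionality. Qed.

Definition single i p : Pd := fun k => if k == i then p else gone.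
Definition diag p : Pd := fun _ => p.
Definition coord i x : P := x i.

Lemma single_hom i : is_hom (single i).
Proof. by move=> p q; apply: pw_ext => k /=; rewrite /pw_mul /single; case: eqP; rewrite ?gE. Qed.

Lemma diag_hom : is_hom diag.
Proof. by move=> p q; apply: pw_ext. Qed.

Lemma coord_hom i : is_hom (coord i).
Proof. by []. Qed.

Lemma singleE i p : single i p i = p.
Proof. by rewrite /single eqxx. Qed.

Lemma single_neq i k p : k != i -> single i p k = gone.
Proof. by rewrite /single => /negPf->. Qed.

Lemma cj_single x i p : cj x (single i p) = single i (cj (x i) p).
Proof.
apply: pw_ext => k; rewrite -[LHS]/(cj (x k) (single i p k)) /single.
by case: eqP => [->|]; rewrite ?cj1.
Qed.

Lemma power_gen (S : Pd -> Prop) x : is_subgroup S -> (forall i, S (single i (x i))) -> S x.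
Proof.
move=> [S1 [SM _]] Sx.
suff Ss (s : seq 'I_d) : S (fun i => if i \in s then x i else gone).
  have -> : x = (fun i => if i \in enum 'I_d then x i else gone); last exact: Ss.
  by apply: functional_extensionality => i; rewrite mem_enum.
elim: s => [|i s IH]; first exact: S1.
have [is_|nis] := boolP (i \in s).
  suff -> : (fun k => if k \in i :: s then x k else gone) =
            (fun k => if k \in s then x k else gone) by [].
  by apply: functional_extensionality => k; rewrite inE; case: eqP => [->|]; rewrite ?is_.
suff -> : (fun k => if k \in i :: s then x k else gone) =
          ((fun k => if k \in s then x k else gone) : Pd) ** single i (x i) by apply: SM.
apply: pw_ext => k; rewrite -[RHS]/((if k \in s then x k else gone) ** single i (x i) k).
rewrite inE /single; case: (eqVneq k i) => [->|ki] /=; first by rewrite (negPf nis) gmul1.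
by rewrite gmulr1.
Qed.

Lemma power_central x : central x -> forall i, central (x i).
Proof. by move=> cx i p; have := congr1 (coord i) (cx (diag p)). Qed.

Lemma comm_coord x y i : comm x y i = comm (x i) (y i).
Proof. by []. Qed.

End PowerGrp.

(* [indecomp G] forces commuting normal subgroups of a subdirect power of [G] to live on
   disjoint sets of coordinates. *)
Definition indecomp (G : Grp) := forall U W : G -> Prop, is_normal U -> is_normal W ->
  (forall u w, U u -> W w -> u ** w = w ** u) ->
  (forall u, U u -> u = gone) \/ (forall w, W w -> w = gone).

(** * Counting commuting normal subgroups by the coordinates they occupy *)

Section Supports.
Variables (G H : Grp) (d : nat) (c : 'I_d -> H -> G) (K : finType) (U : K -> H -> Prop).
Hypotheses (cM : forall i, is_hom (c i)) (cS : forall i, surjective_fun (c i)).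
Hypothesis c_inj : forall x, (forall i, c i x = gone) -> x = gone.
Hypothesis nG : indecomp G.
Hypotheses (nU : forall k, is_normal (U k)) (U1 : forall k, exists x, U k x /\ x <> gone).
Hypothesis UU : forall k l, k != l -> forall x y, U k x -> U l y -> x ** y = y ** x.

Lemma image_normal i k : is_normal (fun y => exists x, U k x /\ c i x = y).
Proof.
split=> [|g _ [x [Ux <-]]]; first exact: image_subgroup (cM i) _ (proj1 (nU k)).
have [h <-] := cS i g; exists (cj h x); split; last by rewrite (hom_cj (cM i)).
exact: (proj2 (nU k)).
Qed.

Lemma supp_coord_exists k : exists i, exists x, U k x /\ c i x <> gone.
Proof.
have [x [Ux x1]] := U1 k; apply: NNPP => ni; apply: x1; apply: c_inj => i.
by apply: NNPP => cx; apply: ni; exists i, x.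
Qed.

Definition supp_coord k : 'I_d := proj1_sig (constructive_indefinite_description _ (supp_coord_exists k)).

Lemma supp_coordP k : exists x, U k x /\ c (supp_coord k) x <> gone.
Proof. exact: proj2_sig (constructive_indefinite_description _ (supp_coord_exists k)). Qed.

(** The images of [U k] and [U l] under [c i] are commuting normal subgroups of [G], so [indecomp]
    makes one of them trivial. *)
Lemma supp_coord_disj i k l x : k != l -> (exists x, U k x /\ c i x <> gone) -> U l x -> c i x = gone.
Proof.
move=> kl [y [Uy cy]] Ux.
have [|E|E] := nG (image_normal i k) (image_normal i l).
- by move=> _ _ [a [Ua <-]] [b [Ub <-]]; rewrite -!cM (UU kl Ua Ub).
- by case: cy; apply: E; exists y.
- by apply: E; exists x.
Qed.

Lemma supp_coord_inj : injective supp_coord.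
Proof.
move=> k l e; apply/eqP; apply: contraT => kl.
have [x [Ux cx]] := supp_coordP l; case: cx; rewrite -e.
exact: supp_coord_disj kl (supp_coordP k) Ux.
Qed.

Lemma card_supports : #|K| <= d.
Proof. by rewrite -[d]card_ord; apply: leq_card supp_coord_inj. Qed.

(** With as many subgroups as coordinates the injection [supp_coord] is onto, so every other
    coordinate already belongs to another subgroup. *)
Lemma supp_coord_only k i x : #|K| = d -> i != supp_coord k -> U k x -> c i x = gone.
Proof.
move=> Kd ik Ux.
have /codomP[l el] : i \in codom supp_coord by apply: inj_card_onto supp_coord_inj _ _; rewrite card_ord Kd.
apply: (@supp_coord_disj _ l) Ux; first by apply: contraNneq ik => <-; rewrite el.
by rewrite el; apply: supp_coordP.
Qed.
End Supports.

(** * Free products *)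

Section Words.
Variables (l : nat) (A : 'I_l -> Grp).
Definition letter := {j : 'I_l & A j}.
Implicit Types (w : seq letter) (j : 'I_l).

Definition avoids j w : Prop := if w is x :: _ then projT1 x <> j else True.

Fixpoint reduced w : Prop :=
  if w is x :: w' then [/\ projT2 x <> gone, avoids (projT1 x) w' & reduced w'] else True.

(** The first component is trivial when the word does not begin in the factor [j]; left
    multiplication by an element of that factor then only changes this component. This is van der
    Waerden's device for normal forms. *)
Definition split_head j w : A j * seq letter :=
  match w with
  | existT k b :: w' =>
      match k =P j with
      | ReflectT e => (eq_rect k (fun k => A k : Type) b j e, w')
      | ReflectF _ => (gone, w)
      end
  | [::] => (gone, [::])
  end.

Definition cons_red j (a : A j) w : seq letter :=
  if excluded_middle_informative (a = gone) then w else existT _ j a :: w.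

Lemma split_avoids j w : avoids j w -> split_head j w = (gone, w).
Proof. by case: w => //= -[k b] w /= kj; case: eqP. Qed.

Lemma split_cons j (a : A j) w : split_head j (existT _ j a :: w) = (a, w).
Proof. by rewrite /=; case: eqP => // e; rewrite (eq_axiomK e). Qed.

Lemma split_cons_red j (a : A j) w : avoids j w -> split_head j (cons_red a w) = (a, w).
Proof.
move=> jw; rewrite /cons_red; case: excluded_middle_informative => [a1|a1] /=.
  by rewrite split_avoids // a1.
exact: split_cons.
Qed.

Lemma split_headP j w : reduced w ->
  [/\ avoids j (split_head j w).2, reduced (split_head j w).2,
      cons_red (split_head j w).1 (split_head j w).2 = w &
      (size (split_head j w).2 <= size w)%N].
Proof.
case: w => [|[k b] w] rw.
  by split=> //=; rewrite /cons_red; case: excluded_middle_informative.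
have [kj|kj] := eqVneq k j.
  subst k; rewrite split_cons /=; case: rw => /= b1 jw rw; split=> //.
  by rewrite /cons_red; case: excluded_middle_informative.
rewrite split_avoids; last exact/eqP.
by split=> //=; [exact/eqP | rewrite /cons_red; case: excluded_middle_informative].
Qed.

Lemma reduced_cons_red j (a : A j) w : avoids j w -> reduced w -> reduced (cons_red a w).
Proof. by rewrite /cons_red; case: excluded_middle_informative. Qed.

Lemma size_cons_red j (a : A j) w : (size (cons_red a w) <= (size w).+1)%N.
Proof. by rewrite /cons_red; case: excluded_middle_informative. Qed.

(* Left multiplication by a letter on the reduced words of length at most [n]; a word of
   length [n] that would become longer is fixed. *)
Variable n : nat.
Definition letter_act j (a : A j) w : seq letter :=
  let: (b, w') := split_head j w in
  if (size w' < n)%N then cons_red (a ** b) w' else w.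

Definition ok w := reduced w /\ (size w <= n)%N.

Lemma ok_act j (a : A j) w : ok w -> ok (letter_act a w).
Proof.
move=> [rw sw]; rewrite /letter_act; have := split_headP j rw.
case: (split_head j w) => b w' /= [jw' rw' _ _]; case: ifP => // sw'.
by split; [apply: reduced_cons_red | apply: leq_trans (size_cons_red _ _) sw'].
Qed.

(** Whether truncation fixes a word depends only on the part after its leading letter in [j], which
    the factor [j] does not change; so truncating keeps this an action. *)
Lemma act_mul j (a b : A j) w : reduced w ->
  letter_act a (letter_act b w) = letter_act (a ** b) w.
Proof.
move=> rw; have := split_headP j rw; rewrite /letter_act.
case E : (split_head j w) => [c w'] /= [jw' rw' _ _].
by case: (ltnP (size w') n) => sw'; rewrite ?split_cons_red ?E ?sw' ?gmulA // ltnNge sw'.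
Qed.

Lemma act_one j w : reduced w -> letter_act (@gone (A j)) w = w.
Proof.
move=> rw; have := split_headP j rw; rewrite /letter_act.
by case: (split_head j w) => c w' /= [_ _ e _]; rewrite gmul1 e if_same.
Qed.

Lemma act_avoids j (a : A j) w : avoids j w -> (size w < n)%N -> a <> gone ->
  letter_act a w = existT _ j a :: w.
Proof.
move=> jw sw a1; rewrite /letter_act split_avoids // sw gmulr1 /cons_red.
by case: excluded_middle_informative.
Qed.

Definition ball := {w | ok w}.

Lemma ball_inj (x y : ball) : proj1_sig x = proj1_sig y -> x = y.
Proof. exact: eq_sig_hprop (fun _ => @proof_irrelevance _) x y. Qed.

Definition ball_act j (a : A j) (x : ball) : ball :=
  exist _ _ (ok_act a (proj2_sig x)).

Lemma ball_actK j (a : A j) x : ball_act (ginv a) (ball_act a x) = x.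
Proof.
by apply: ball_inj; case: x => w [rw sw] /=; rewrite act_mul // gmulV act_one.
Qed.

Lemma ball_actVK j (a : A j) x : ball_act a (ball_act (ginv a) x) = x.
Proof.
by apply: ball_inj; case: x => w [rw sw] /=; rewrite act_mul // gmulrV act_one.
Qed.

Definition ball_sym j (a : A j) : sym_grp ball := MkSym (ball_actK a) (ball_actVK a).

Lemma ball_sym_hom j : is_hom (@ball_sym j).
Proof.
move=> a b; apply: symP => x; apply: ball_inj; case: x => w [rw sw] /=.
by rewrite act_mul.
Qed.

Lemma fin_ball : (forall j, fin (A j)) -> fin ball.
Proof.
move=> finA; have [s sP] : fin letter.
  pose s j := proj1_sig (constructive_indefinite_description _ (finA j)).
  have sP j : forall a : A j, In a (s j) := proj2_sig (constructive_indefinite_description _ (finA j)).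
  exists (flat_map (fun j => List.map (fun a => existT _ j a) (s j)) (enum 'I_l)) => -[j a].
  apply/in_flat_map; exists j; split; last exact: (in_map _ _ _ (sP j a)).
  by elim: (enum 'I_l) (mem_enum 'I_l j) => // k r IH; rewrite inE => /orP[/eqP->|/IH]; [left | right].
have [r rP] := fin_lists s n; apply: (@fin_inj _ _ (fun x : ball => proj1_sig x) r).
  exact: ball_inj.
by case=> w [rw sw] /=; apply: rP => //; apply: leq_trans sw.
Qed.

End Words.

(** * Normal forms, residual finiteness and indecomposability of free products *)

Section FreeProduct.
Variables (l : nat) (G : 'I_l -> Grp) (P : Grp) (iota : forall j, G j -> P).
Arguments iota : clear implicits.
Hypothesis fpP : is_free_product l G P iota.

Lemma iota_hom j : is_hom (iota j).
Proof. by case: fpP. Qed.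
Arguments iota_hom : clear implicits.

(** The universal property gives a map into the subgroup, and its uniqueness clause makes the
    composite with the inclusion the identity. *)
Lemma free_product_gen (S : P -> Prop) : is_subgroup S -> (forall (j : 'I_l) (x : G j), S (iota j x)) ->
  forall p, S p.
Proof.
move=> SS Si; pose f j (x : G j) : sub_grp SS := Sub_grp SS (Si j x).
have fM j : is_hom (@f j) by apply: corestrict_hom; apply: iota_hom.
have [h [hM [hf _]]] := proj2 fpP _ f fM.
have [h0 [h0M [h0i h0u]]] := proj2 fpP P iota (iota_hom).
move=> p; have <- : sval_grp (h p) = p; last exact: sval_grpP.
have e1 := h0u id (fun _ _ => erefl) (fun _ _ => erefl) p.
rewrite [RHS]e1; apply: (h0u (fun p => sval_grp (h p))); first by move=> x y; rewrite hM.
by move=> j x; rewrite hf.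
Qed.

Definition wprod (w : seq (letter G)) : P :=
  foldr (fun x p => iota (projT1 x) (projT2 x) ** p) gone w.

Lemma wprod_cat w1 w2 : wprod (w1 ++ w2) = wprod w1 ** wprod w2.
Proof. by elim: w1 => [|x w1 IH] /=; rewrite ?gmul1 // IH gmulA. Qed.

Lemma wprod_cons_red j (a : G j) w : wprod (cons_red a w) = iota j a ** wprod w.
Proof.
rewrite /cons_red; case: excluded_middle_informative => [a1|] //=.
by rewrite a1 (hom1 (iota_hom j)) gmul1.
Qed.

Lemma reduced_word_exists p : exists w, reduced w /\ wprod w = p.
Proof.
(* Stability of reduced words under left multiplication. Closure under inverses is not automatic for
   [S], so [p] and [ginv p] are treated together. *)
pose S p := forall w, reduced w -> exists w', reduced w' /\ wprod w' = p ** wprod w.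
suff [Sp _] : S p /\ S (ginv p) by have [w] := Sp [::] I; rewrite gmulr1 => ?; exists w.
move: p; apply: free_product_gen.
  split; first by rewrite ginv1; split=> w rw; exists w; rewrite gmul1.
  have SM x y : S x -> S y -> S (x ** y).
    move=> Sx Sy w /Sy[w1 [/Sx[w2 [r2 e2]] e1]]; exists w2; split=> //.
    by rewrite e2 e1 gmulA.
  by split=> [x y [Sx Sx'] [Sy Sy']|x [Sx Sx']]; rewrite ?ginvM ?ginvK; split; auto.
have Si j (x : G j) : S (iota j x).
  move=> w rw; have [jw rw' e _] := split_headP j rw.
  exists (cons_red (x ** (split_head j w).1) (split_head j w).2); split.
    exact: reduced_cons_red.
  by rewrite -[in RHS]e !wprod_cons_red iota_hom gmulA.
by move=> j x; split; last rewrite -(homV (iota_hom j)).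
Qed.

Section Action.
Variables (A : 'I_l -> Grp) (phi : forall j, G j -> A j) (n : nat).
Hypothesis phiM : forall j, is_hom (@phi j).
Definition map_letter (x : letter G) : letter A := existT _ (projT1 x) (phi (projT2 x)).

(** Acting on the empty word writes down the word letter by letter. With [phi] the identity this
    separates normal forms; with finite quotients of the factors it gives residual finiteness. *)
Lemma word_action : exists f : P -> sym_grp (ball A n), is_hom f /\
  forall w, reduced (map map_letter w) -> (size w <= n)%N ->
    exists x : ball A n, proj1_sig ((f (wprod w) : sym _) x) = map map_letter w /\
                         proj1_sig x = [::].
Proof.
have [f [fM [fi _]]] := proj2 fpP _ (fun j (x : G j) => ball_sym n (phi x))
  (fun j => hom_comp (@phiM j) (@ball_sym_hom _ _ _ _)).
have ok0 : ok n (Nil (letter A)) by [].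
exists f; split=> // w rw sw; exists (exist _ _ ok0); split=> //.
elim: w rw sw => [|x w IH] /=; first by rewrite (hom1 fM).
move=> [x1 jw rw] sw; rewrite fM fi /= IH //; last exact: ltnW.
by rewrite act_avoids ?size_map.
Qed.
End Action.

Lemma wprod_inj w1 w2 : reduced w1 -> reduced w2 -> wprod w1 = wprod w2 -> w1 = w2.
Proof.
move=> r1 r2 e.
have [f [_ fP]] := @word_action G (fun _ => id) (size w1 + size w2) (fun _ _ _ => erefl).
have mid w : map (map_letter (fun j : 'I_l => @id (G j))) w = w.
  by elim: w => //= -[j a] w ->.
have [||x1 [e1 n1]] := fP w1; [by rewrite mid | exact: leq_addr |].
have [||x2 [e2 n2]] := fP w2; [by rewrite mid | exact: leq_addl |].
have x12 : x1 = x2 by apply: ball_inj; rewrite n1 n2.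
by move: e1; rewrite e x12 e2 !mid.
Qed.

Lemma finite_quotient_list (H : Grp) (s : list H) : residually_finite H ->
  (forall x, In x s -> x <> gone) ->
  exists (F : Grp) (phi : H -> F), [/\ fin F, is_hom phi & forall x, In x s -> phi x <> gone].
Proof.
move=> rfH; elim: s => [|x s IH] s1.
  exists (sym_grp unit), (fun _ => gone); split; last by [].
    by apply: fin_sym; exists (tt :: nil)%list => -[]; left.
  by move=> a b; rewrite gmul1.
have [F [phi [finF phiM phis]]] := IH (fun y ys => s1 y (or_intror ys)).
have [F' [phi' [finF' [phiM' phix]]]] := rfH x (s1 x (or_introl erefl)).
exists (prod_grp F F'), (fun y => (phi y, phi' y)); split.
- exact: fin_prod.
- by move=> y z /=; rewrite phiM phiM'.
by move=> y [<-|/phis ys] [] //.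
Qed.

(** Each factor is replaced by a finite quotient in which the letters of the given word survive; the
    word stays reduced and moves the empty word in a finite ball. *)
Lemma free_product_rf : (forall j, residually_finite (G j)) -> residually_finite P.
Proof.
move=> rfG p p1; have [w [rw ew]] := reduced_word_exists p.
have phi_ex (j : 'I_l) : exists Fphi : {F : Grp & G j -> F}, [/\ fin (projT1 Fphi),
    is_hom (projT2 Fphi) & forall a, In (existT _ j a) w -> projT2 Fphi a <> gone].
  (* The letters of [w] in the factor [j], transported to the type [G j]. *)
  pose s := flat_map (fun x : letter G => let: existT k b := x in
    match k =P j with ReflectT e => (eq_rect k (fun k => G k : Type) b j e :: nil)%list
    | ReflectF _ => nil end) w.
  have sP a : In a s <-> In (existT _ j a) w.
    rewrite in_flat_map; split=> [[[k b] [kw]]|jw].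
      by case: eqP => // e; subst k; rewrite /= => -[<-|].
    exists (existT _ j a); split=> //; case: eqP => // e; rewrite (eq_axiomK e) /=; by left.
  have [|F [phi [finF phiM phis]]] := @finite_quotient_list (G j) s (rfG j).
    move=> a /sP aw; elim: (w) rw aw => //= x w' IH [x1 _ rw'] [e|/IH]; last exact.
    by move: x1; rewrite e.
  by exists (existT _ F phi); split=> // a /sP/phis.
pose Fphi j := proj1_sig (constructive_indefinite_description _ (phi_ex j)).
have FphiP j := proj2_sig (constructive_indefinite_description _ (phi_ex j)).
rewrite -/(Fphi _) in FphiP.
pose A j := projT1 (Fphi j); pose phi j : G j -> A j := projT2 (Fphi j).
have phiM j : is_hom (@phi j) by case: (FphiP j).
have [f [fM fP]] := @word_action A phi (size w) phiM.
exists (sym_grp (ball A (size w))), f; split; last split=> //.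
  by apply/fin_sym/fin_ball => j; case: (FphiP j).
have [|//|x [ex x0]] := fP w.
  have phi1 x : In x w -> phi _ (projT2 x) <> gone.
    by case: x => j a; case: (FphiP j) => _ _; apply.
  elim: (w) rw phi1 => //= x w' IH [x1 jw rw] phi1; split.
  - by apply: phi1; left.
  - by case: (w') jw.
  - by apply: IH => // y yw; apply: phi1; right.
rewrite -ew => f1; move: ex; rewrite f1 /= x0 => w0.
by apply: p1; rewrite -ew; case: (w) w0.
Qed.

Lemma reduced_cat_rcons w (x : letter G) : w <> [::] -> reduced w -> projT2 x <> gone ->
  projT1 (last x w) <> projT1 x -> reduced (rcons w x).
Proof.
elim: w => // y w IH _ [y1 yw rw] x1; case: w yw rw IH => [|z w] yw rw IH lx.
  by split=> //= /esym.
by split=> //; apply: IH.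
Qed.

Variables i1 i2 i3 i4 : 'I_l.
Hypothesis four : uniq [:: i1; i2; i3; i4].
Hypothesis nontriv : forall i, i \in [:: i1; i2; i3; i4] -> exists x : G i, x <> gone.

(** Four nontrivial factors leave room to avoid three: those at both ends of a word and a prescribed
    one. *)
Lemma avoid3 (a b c : 'I_l) : exists i, i \in [:: i1; i2; i3; i4] /\ i \notin [:: a; b; c].
Proof.
apply: NNPP => ni.
have /(uniq_leq_size four) // : {subset [:: i1; i2; i3; i4] <= [:: a; b; c]}.
by move=> i ii; apply: contraT => ia; case: ni; exists i.
Qed.

(* Conjugating by a letter of a factor missing at both ends of the word makes the
   conjugate begin and end in that factor. *)
Lemma conj_word p k : p <> gone -> exists i g w, [/\ i <> k, reduced w, wprod w = cj g p &
  exists x w', w = x :: w' /\ projT1 x = i /\ projT1 (last x w) = i].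
Proof.
move=> p1; have [w [rw ew]] := reduced_word_exists p.
case: w rw ew => [|x w] rw ew; first by case: p1; rewrite -ew.
have [i [ii]] := avoid3 (projT1 x) (projT1 (last x w)) k.
rewrite !inE !negb_or => /and3P[/eqP ix /eqP il /eqP ik].
have [g g1] := nontriv ii.
exists i, (iota i g), (existT _ i g :: rcons (x :: w) (existT _ i (ginv g))); split=> //.
- split=> //; first by move=> /esym.
  apply: reduced_cat_rcons => //=; last by move=> /esym.
  by move=> e; apply: g1; rewrite -(ginvK g) e ginv1.
- rewrite -cats1 -cat1s !wprod_cat ew /= !gmulr1 (homV (iota_hom i)) /cj gmulA.
  done.
exists (existT _ i g), (rcons (x :: w) (existT _ i (ginv g))); split=> //; split=> //.
by rewrite -cat1s last_cat last_rcons.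
Qed.

(** After conjugation an element of [U] begins and ends in a factor [i] and one of [W] in another
    factor [k]; both products are reduced as written, so commuting contradicts uniqueness of normal
    forms. *)
Lemma free_product_indecomp : indecomp P.
Proof.
move=> U W [_ UJ] [_ WJ] UW.
have [U1|/not_all_ex_not[u nu]] := classic (forall u, U u -> u = gone); first by left.
have [W1|/not_all_ex_not[w nw]] := classic (forall w, W w -> w = gone); first by right.
have [Uu u1] : U u /\ u <> gone by tauto.
have [Ww w1] : W w /\ w <> gone by tauto.
have [i [g [a [_ ra ea [x [a' [ax [xi lx]]]]]]]] := conj_word i1 u1.
have [k [h [b [ki rb eb [y [b' [by_ [yk ly]]]]]]]] := conj_word i w1.
have cat_red (c d : seq (letter G)) z t c' d' : reduced c -> reduced d -> c = z :: c' ->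
    d = t :: d' -> projT1 (last z c) <> projT1 t -> reduced (c ++ d).
  move=> rc rd ec ed; subst c d; elim: c' z rc => [|z' c' IH] z [z1 zc rc] lz.
    by split=> //= /esym.
  by split=> //; apply: IH.
have e : wprod (a ++ b) = wprod (b ++ a).
  by rewrite !wprod_cat ea eb; apply: UW; [apply: UJ | apply: WJ].
have /(congr1 (fun w => if w is x :: _ then projT1 x else i)) := wprod_inj
  (cat_red _ _ _ _ _ _ ra rb ax by_ (fun e => ki (esym (etrans (esym lx) (etrans e yk)))))
  (cat_red _ _ _ _ _ _ rb ra by_ ax (fun e => ki (etrans (esym ly) (etrans e xi)))) e.
by rewrite ax by_ /= xi yk => /esym.
Qed.

End FreeProduct.

(** * Groups generated by swaps of cones *)

Definition Root := 'I_17.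

Lemma fresh_exists (s : seq Root) : (size s < 17)%N -> exists p, p \notin s.
Proof.
move=> ss; apply: NNPP => nf; have /(uniq_leq_size (enum_uniq Root)) : {subset enum Root <= s}.
  by move=> p _; apply: contraT => ps; case: nf; exists p.
by rewrite size_enum_ord leqNgt ss.
Qed.

Definition fresh (s : seq Root) : Root := odflt ord0 [pick p | p \notin s].

Lemma freshP (s : seq Root) : (size s < 17)%N -> fresh s \notin s.
Proof.
move=> /fresh_exists [p ps]; rewrite /fresh; case: pickP => //= /(_ p); by rewrite ps.
Qed.

Ltac neq_hyps := repeat match goal with
  | H : is_true (_ \notin _) |- _ => rewrite !inE ?negb_or in H
  | H : is_true (uniq _) |- _ => rewrite /= ?inE ?negb_or ?andbT in H
  | H : is_true (_ && _) |- _ => let H1 := fresh H in let H2 := fresh H in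
      case/andP: H => H1 H2
  end.
Ltac neqs := neq_hyps; rewrite /= ?inE ?negb_or ?andbT;
  repeat (apply/andP; split); try done; try assumption; try (rewrite eq_sym; assumption).
Ltac pick_fresh p s := let Hp := fresh "F" p in
  have [p Hp] := @fresh_exists s isT.

(* [g i a j] is to be thought of as the involution exchanging the root [j] of a forest of
   infinite binary trees with the cone at the child [a] of the root [i] ([a = None]: the root
   [i] itself); [E i al j] below plays this role for a deeper cone. *)
Record swap_rel (Y : Grp) (g : Root -> option bool -> Root -> Y) : Prop := {
  sr_diag : forall i a, g i a i = gone;
  sr_sq : forall i a j, g i a j ** g i a j = gone;
  sr_sym : forall i j, g i None j = g j None i;
  sr_far : forall i j k l a b, uniq [:: i; j; k; l] ->
    comm (g i a j) (g k b l) = gone;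
  sr_left : forall i j k b, uniq [:: i; j; k] -> cj (g i None k) (g k b j) = g i b j;
  sr_right : forall i j k a, uniq [:: i; j; k] -> cj (g j None k) (g i a j) = g i a k;
  sr_mid : forall i j k a, uniq [:: i; j; k] -> cj (g i a k) (g k None j) = g i a j;
  sr_near : forall i j k, uniq [:: i; j; k] ->
    comm (g i (Some false) j) (g i (Some true) k) = gone;
  sr_split : forall i j k, uniq [:: i; j; k] ->
    g i None j = cj (g i (Some false) k) (g j (Some false) k) **
                 cj (g i (Some true) k) (g j (Some true) k) }.

Section SwapGroup.
Variables (Y : Grp) (g : Root -> option bool -> Root -> Y).
Hypothesis gR : swap_rel g.
Local Notation e i j := (g i None j).

Lemma gV i a j : ginv (g i a j) = g i a j.
Proof. by rewrite -(ginv_eq (sr_sq gR i a j)). Qed.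

Lemma gcjK i a j x : cj (g i a j) (cj (g i a j) x) = x.
Proof. by rewrite -cj_mul (sr_sq gR) /cj ?gE. Qed.

Lemma cj_swap i a j x y : cj (g i a j) x = y -> cj (g i a j) y = x.
Proof. by move=> <-; rewrite gcjK. Qed.

Lemma g_equiv m n i a j : m != n -> i != j ->
  cj (e m n) (g i a j) = g (tperm m n i) a (tperm m n j).
Proof.
have base m' n' i' j' : uniq [:: m'; n'; i'] -> i' != j' -> j' != m' ->
    cj (e m' n') (g i' a j') = g (tperm m' n' i') a (tperm m' n' j').
  move=> u ij jm; rewrite (@tpermD _ _ _ i'); try by neqs.
  case: (eqVneq j' n') => [->|jn]; last first.
    by rewrite tpermD; [apply/comm1_cj/(sr_far gR); neqs | neqs | neqs].
  by rewrite tpermR (sr_sym gR) (sr_right gR); last by neqs.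
have base2 m' n' i' j' : uniq [:: m'; n'; i'] -> i' != j' ->
    cj (e m' n') (g i' a j') = g (tperm m' n' i') a (tperm m' n' j').
  move=> u ij; case: (eqVneq j' m') => [->|jm]; last exact: base.
  by rewrite (sr_sym gR) tpermC; apply: base; neqs.
have base3 m' n' a' j' : uniq [:: m'; n'; j'] -> 
    cj (e m' n') (g n' a' j') = g m' a' j'.
  by move=> u; rewrite (sr_left gR) //; neqs.
(* Both indices are exchanged, a case that no relation covers directly; a third root [l] is
   inserted. *)
have base4 m' n' : m' != n' -> cj (e m' n') (g n' a m') = g m' a n'.
  move=> mn; pick_fresh l [:: m'; n'].
  rewrite -(cj_swap (@sr_right _ _ gR n' m' l a _)); last by neqs.
  rewrite -cj_mul.
  have -> : e m' n' ** e m' l = e n' l ** e m' n'.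
    have : cj (e m' n') (e m' l) = e n' l.
      by rewrite (sr_sym gR m' n') base3 //; neqs.
    by move<-; rewrite /cj ?gE.
  rewrite cj_mul base3; last by neqs.
  by rewrite (sr_sym gR) (sr_right gR) //; neqs.
move=> mn ij; case: (eqVneq i n) => [ein|ni].
  subst i; rewrite tpermR; case: (eqVneq j m) => [->|jm]; first by rewrite tpermL base4.
  by rewrite tpermD; [apply: base3; neqs | neqs | neqs].
case: (eqVneq i m) => [eim|mi]; last by apply: base2 => //; neqs.
subst i; rewrite tpermL (sr_sym gR).
case: (eqVneq j n) => [->|jn]; first by rewrite tpermR base4 // eq_sym.
by rewrite tpermD; [apply: base3; neqs | neqs | neqs].
Qed.

Fixpoint E (i : Root) (al : seq bool) (j : Root) : Y :=
  if al is x :: al' then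
    let m := fresh [:: i; j] in cj (g i (Some x) m) (E m al' j)
  else e i j.

Let equiv al := forall m n i j, m != n -> i != j ->
  cj (e m n) (E i al j) = E (tperm m n i) al (tperm m n j).
Let far1 al := forall i j k l b, uniq [:: i; j; k; l] -> cj (g k b l) (E i al j) = E i al j.

(** [g i (Some x) m] is the conjugate by [g i (Some x) m'] of the root swap of [m'] and [m], and
    this root swap renames [m] in [E m al j]. *)
Let E_indep al x i j m m' : equiv al -> far1 al -> uniq [:: i; j; m] -> uniq [:: i; j; m'] ->
  cj (g i (Some x) m) (E m al j) = cj (g i (Some x) m') (E m' al j).
Proof.
move=> eq_al far_al um um'; case: (eqVneq m m') => [-> //|mm'].
have gm : g i (Some x) m = g i (Some x) m' ** e m' m ** g i (Some x) m'.
  by rewrite -(@sr_mid _ _ gR i m m') ?/cj ?gV //; neqs.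
rewrite {1}gm !cj_mul far_al; last by neqs.
rewrite eq_al ?tpermR; [|by neqs|by neqs].
by rewrite tpermD //; neqs.
Qed.

(** Independence of the auxiliary root for a longer address needs both statements for the shorter
    one, whence the joint induction. *)
Let equiv_far al : equiv al /\ far1 al.
Proof.
elim: al => [|x al [eq_al far_al]].
  split=> [m n i j mn ij|i j k l b u] /=; first exact: g_equiv.
  by apply/comm1_cj/(sr_far gR); neqs.
have step i j m : uniq [:: i; j; m] -> E i (x :: al) j = cj (g i (Some x) m) (E m al j).
  have Fp := @freshP [:: i; j] isT; move=> u; rewrite /=; apply: E_indep => //; neqs.
split=> [m n i j mn ij|i j k l b u].
- pick_fresh p [:: i; j; m; n].
  have tp : tperm m n p = p by rewrite tpermD //; neqs.
  have u : uniq [:: tperm m n i; tperm m n j; p].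
    rewrite -[X in [:: _; _; X]]tp (map_inj_uniq (@perm_inj _ (tperm m n)) [:: i; j; p]).
    by neqs.
  rewrite (step i j p); last by neqs.
  rewrite cj_cj g_equiv //; last by neqs.
  by rewrite eq_al ?tp //; [rewrite -step | neqs].
- pick_fresh p [:: i; j; k; l].
  rewrite (step i j p); last by neqs.
  rewrite cj_cj far_al; last by neqs.
  by rewrite (comm1_cj (sr_far gR _ _ _)) //; neqs.
Qed.

Lemma E_equiv al m n i j : m != n -> i != j ->
  cj (e m n) (E i al j) = E (tperm m n i) al (tperm m n j).
Proof. by case: (equiv_far al) => + _; apply. Qed.

Lemma E_far1 al i j k l b : uniq [:: i; j; k; l] -> cj (g k b l) (E i al j) = E i al j.
Proof. by case: (equiv_far al) => _; apply. Qed.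

Lemma E_cons x al i j m : uniq [:: i; j; m] ->
  E i (x :: al) j = cj (g i (Some x) m) (E m al j).
Proof.
case: (equiv_far al) => eq_al far_al u; have Fp := @freshP [:: i; j] isT.
by rewrite /=; apply: E_indep => //; neqs.
Qed.

Lemma E1 i x j : i != j -> E i [:: x] j = g i (Some x) j.
Proof.
move=> ij; pick_fresh p [:: i; j].
by rewrite (@E_cons _ _ _ _ p) /= ?(sr_mid gR) //; neqs.
Qed.

Lemma E_sq i al j : E i al j ** E i al j = gone.
Proof.
elim: al i j => [|x al IH] i j /=; first exact: (sr_sq gR).
by rewrite -cjM IH cj1.
Qed.

Lemma EV i al j : ginv (E i al j) = E i al j.
Proof. by rewrite -(ginv_eq (E_sq i al j)). Qed.

Lemma EcjK i al j x : cj (E i al j) (cj (E i al j) x) = x.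
Proof. by rewrite -cj_mul E_sq /cj ?gE. Qed.

Lemma cj_swapE i al j x y : cj (E i al j) x = y -> cj (E i al j) y = x.
Proof. by move=> <-; rewrite EcjK. Qed.

Lemma cj_fixC (x y : Y) : cj x y = y -> cj y x = x.
Proof. by rewrite !cj_fixP. Qed.

Lemma cj_cjl (a b c : Y) : cj (cj a b) c = cj a (cj b (cj (ginv a) c)).
Proof. by rewrite /cj ?gE. Qed.

(** Exchanging a cone with the root [k] carries all that lies below [k] into that cone. *)
Lemma E_cat al be i j k : uniq [:: i; j; k] ->
  cj (E i al k) (E k be j) = E i (al ++ be) j.
Proof.
elim: al i => [|x al IH] i u /=.
  rewrite E_equiv ?tpermR; [|by neqs|by neqs].
  by rewrite tpermD //; neqs.
pick_fresh p [:: i; j; k].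
rewrite -/(E i (x :: al) k) (@E_cons _ _ _ _ p); last by neqs.
rewrite cj_cjl gV (@E_far1 be); last by neqs.
rewrite IH; last by neqs.
by rewrite -E_cons //; neqs.
Qed.

Lemma E_far al be i j k l : uniq [:: i; j; k; l] -> cj (E k be l) (E i al j) = E i al j.
Proof.
elim: be k => [|x be IH] k u; first exact: E_far1.
pick_fresh p [:: i; j; k; l].
rewrite (@E_cons _ _ _ _ p); last by neqs.
by rewrite cj_cjl gV !(E_far1, IH) //; neqs.
Qed.

Definition incomp (al be : seq bool) := ~~ prefix al be && ~~ prefix be al.

(** The sibling cones are moved to separate roots [p] and [q], where the remaining swaps are far
    apart. *)
Let E_near01 al be i j k : uniq [:: i; j; k] ->
  cj (E i (false :: al) j) (E i (true :: be) k) = E i (true :: be) k.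
Proof.
move=> u; pick_fresh p [:: i; j; k]; pick_fresh q [:: i; j; k; p].
rewrite (@E_cons _ _ _ _ p); last by neqs.
rewrite (@E_cons _ _ _ _ q); last by neqs.
have gg : cj (g i (Some false) p) (g i (Some true) q) = g i (Some true) q.
  by apply/comm1_cj/(sr_near gR); neqs.
have Eg : cj (E p al j) (g i (Some true) q) = g i (Some true) q.
  by apply/cj_fixC/E_far1; neqs.
rewrite cj_cjl gV (cj_cj _ (g i (Some true) q)) gg E_far1; last by neqs.
rewrite (cj_cj _ (g i (Some true) q)) Eg E_far; last by neqs.
by rewrite (cj_cj _ (g i (Some true) q)) gg E_far1 //; neqs.
Qed.

(** Conjugation strips the common prefix down to two sibling cones. *)
Lemma E_near al be i j k : uniq [:: i; j; k] -> incomp al be ->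
  cj (E i al j) (E i be k) = E i be k.
Proof.
elim: al be i => [|x al IH] [|y be] i u; rewrite /incomp ?prefix0s ?andbF //.
case: (eqVneq x y) => [<-|]; last first.
  by case: x y => [] [] // _ _; [apply/cj_fixC/E_near01; neqs | apply/E_near01; neqs].
rewrite !prefix_cons !eqxx !andTb => ic.
pick_fresh p [:: i; j; k].
rewrite (@E_cons _ _ _ _ p); last by neqs.
rewrite (@E_cons _ _ _ _ p); last by neqs.
by rewrite -cj_cj IH //; neqs.
Qed.

(** * Addresses of cones and swaps of disjoint cones *)

Definition addr := (Root * seq bool)%type.
Implicit Types u v : addr.
Definition disj u v := (u.1 != v.1) || incomp u.2 v.2.
Definition ext u x : addr := (u.1, rcons u.2 x).
Definition Ea u p := E u.1 u.2 p.

Lemma incompC al be : incomp al be = incomp be al.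
Proof. by rewrite /incomp andbC. Qed.

Lemma disjC u v : disj u v = disj v u.
Proof. by rewrite /disj eq_sym incompC. Qed.

Lemma incomp_rconsl al be x : incomp al be -> incomp (rcons al x) be.
Proof.
rewrite /incomp -!negb_or; apply: contra.
elim: al be => [|a al IH] [|b be] //; rewrite rcons_cons !prefix_cons.
by rewrite [b == a]eq_sym -!andb_orr => /andP[-> /IH].
Qed.

Lemma incomp_rcons al be x y : incomp al be -> incomp (rcons al x) (rcons be y).
Proof. by move=> ic; rewrite incomp_rconsl // incompC incomp_rconsl // incompC. Qed.

Lemma disj_extl u v x : disj u v -> disj (ext u x) v.
Proof. by rewrite /disj /=; case: (u.1 == v.1) => //=; apply: incomp_rconsl. Qed.

Lemma disj_ext u v x y : disj u v -> disj (ext u x) (ext v y).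
Proof. by rewrite /disj /=; case: (u.1 == v.1) => //=; apply: incomp_rcons. Qed.

Lemma disj_ext01 u : disj (ext u false) (ext u true).
Proof.
rewrite /disj /= eqxx /= /incomp -!cats1 -!negb_or; case: u => _ al /=.
by elim: al => // a al IH; rewrite !cat_cons !prefix_cons eqxx.
Qed.

Lemma EaV u p : ginv (Ea u p) = Ea u p.
Proof. exact: EV. Qed.

Lemma Ea_disj u v p q : disj u v -> p != q -> p \notin [:: u.1; v.1] ->
  q \notin [:: u.1; v.1] -> cj (Ea u p) (Ea v q) = Ea v q.
Proof.
case: u v => [i al] [j be] /=; rewrite /disj /Ea /= => + pq Fp Fq.
case: (eqVneq i j) => [<- /= ic|ij _]; first by apply: E_near => //; neqs.
by apply: E_far; neqs.
Qed.

Lemma Sw_indep u v p q : disj u v -> p \notin [:: u.1; v.1] -> q \notin [:: u.1; v.1] ->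
  cj (Ea u p) (Ea v p) = cj (Ea u q) (Ea v q).
Proof.
move=> uv Fp Fq; case: (eqVneq p q) => [-> //|pq].
have Eu : Ea u p = cj (Ea u q) (e q p).
  by rewrite /Ea (@E_cat _ [::]) ?cats0 //; neqs.
rewrite Eu cj_cjl EaV (@Ea_disj u v q p) //; last by neqs.
by rewrite /Ea E_equiv ?tpermR ?tpermD //; neqs.
Qed.

(** The two cones may lie below the same root, hence the detour through an auxiliary root,
    immaterial by [Sw_indep]. *)
Definition Sw u v := let p := fresh [:: u.1; v.1] in cj (Ea u p) (Ea v p).

Lemma SwE u v p : disj u v -> p \notin [:: u.1; v.1] -> Sw u v = cj (Ea u p) (Ea v p).
Proof. by move=> uv Fp; apply: Sw_indep => //; apply: freshP. Qed.

Lemma Ea_cat u be p q : uniq [:: u.1; p; q] ->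
  cj (Ea u p) (E p be q) = Ea (u.1, u.2 ++ be) q.
Proof. by move=> F; apply: E_cat; neqs. Qed.

Lemma E_split i al j : i != j ->
  E i al j = Sw (ext (i, al) false) (j, [:: false]) ** Sw (ext (i, al) true) (j, [:: true]).
Proof.
move=> ij; pick_fresh k [:: i; j]; pick_fresh p [:: i; j; k].
have -> : E i al j = cj (E i al k) (e k j) by rewrite (@E_cat _ [::]) ?cats0 //; neqs.
rewrite (@sr_split _ _ gR k j p); last by neqs.
rewrite cjM -!E1; try by neqs.
rewrite (cj_cj _ (E k [:: false] p)) (cj_cj _ (E k [:: true] p)) !E_cat; try by neqs.
rewrite !(@E_far _ al j); try by neqs.
rewrite !cats1.
have d x : disj (ext (i, al) x) (j, [:: x]) by rewrite /disj /= ij.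
rewrite (@SwE _ _ p (d false)) ?(@SwE _ _ p (d true)) //; neqs.
Qed.

(** [E_split] cuts the swap of [v] with an auxiliary root [p] into two, and conjugation by [Ea u p]
    carries the halves of [p] to the halves of [u]. *)
Lemma Sw_split u v : disj u v ->
  Sw u v = Sw (ext v false) (ext u false) ** Sw (ext v true) (ext u true).
Proof.
move=> uv; pick_fresh p [:: u.1; v.1]; pick_fresh q [:: u.1; v.1; p].
have step x : cj (Ea u p) (Sw (ext v x) (p, [:: x])) = Sw (ext v x) (ext u x).
  rewrite (@SwE _ _ q); [|by rewrite /disj /=; apply/orP; left; neqs | by neqs].
  rewrite (@SwE _ _ q); [|by apply: disj_ext; rewrite disjC | by neqs].
  rewrite cj_cj {2}/Ea Ea_cat; last by neqs.
  rewrite cats1 (@Ea_disj u) //; [by rewrite disjC; apply: disj_extl; rewrite disjC | by neqs ..].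
have Ev : Ea v p = Sw (ext v false) (p, [:: false]) ** Sw (ext v true) (p, [:: true]).
  by rewrite /Ea E_split -?surjective_pairing //; neqs.
by rewrite (SwE uv Fp) Ev cjM !step.
Qed.

(** Splitting expresses a swap by swaps one level deeper, so the depth bound can be lowered step by
    step to 0. *)
Lemma Sw_comm_all x : (exists n, forall u v, disj u v -> (n <= size u.2)%N -> (n <= size v.2)%N ->
    cj x (Sw u v) = Sw u v) -> forall i a j, cj x (g i a j) = g i a j.
Proof.
move=> [n xS].
have {n} xS u v : disj u v -> cj x (Sw u v) = Sw u v.
  elim: n xS u v => [|n IH] xS; first by move=> u v uv; apply: xS.
  apply: IH => u v uv nu nv; rewrite Sw_split // cjM !xS ?size_rcons //; rewrite disjC;
    exact: disj_ext.
have xE i al j : i != j -> cj x (E i al j) = E i al j.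
  by move=> ij; rewrite E_split // cjM !xS // /disj /= ij.
move=> i a j; case: (eqVneq i j) => [<-|ij]; first by rewrite (sr_diag gR) cj1.
by case: a => [b|]; [rewrite -E1 // xE | apply: (xE i [::])].
Qed.

(** * Words acting on deep addresses *)

Definition opt_seq (a : option bool) : seq bool := if a is Some x then [:: x] else [::].

(** The value at the bare root [k] for [a = Some x] is a dummy: that cone is cut into pieces. Hence
    the nonemptiness hypotheses below. *)
Definition act (t : Root * option bool * Root) (u : addr) : addr :=
  let: (k, a, l) := t in
  if k == l then u else
  if u.1 == l then (k, opt_seq a ++ u.2) else
  if u.1 == k then
    match a, u.2 with
    | None, _ => (l, u.2)
    | Some x, y :: be => if x == y then (l, be) else u
    | Some x, [::] => u
    end
  else u.

Lemma act_Ea k a l u p : (0 < size u.2)%N -> p \notin [:: k; l; u.1] ->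
  cj (g k a l) (Ea u p) = Ea (act (k, a, l) u) p.
Proof.
case: u => i al /= sal Fp; case: (eqVneq k l) => [<-|kl].
  by rewrite (sr_diag gR) /cj ?gE.
have gE' : g k a l = E k (opt_seq a) l by case: (a) => [x|] //; rewrite /opt_seq E1.
case: (eqVneq i l) => [il|il]; first by subst i; rewrite gE' /Ea E_cat //; neqs.
case: (eqVneq i k) => [ik|ik]; last by rewrite /Ea E_far1 //; neqs.
subst i; case: a gE' => [x|] gE' /=.
  case: al sal => // y be _; case: (eqVneq x y) => [<-|xy].
    by rewrite gE'; apply/cj_swapE; rewrite /Ea E_cat //; neqs.
  rewrite gE' /Ea E_near //=; first by neqs.
  by rewrite /incomp !prefix_cons [y == x]eq_sym (negPf xy).
by rewrite gE'; apply/cj_swapE; rewrite /Ea E_cat //; neqs.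
Qed.

Lemma act_disj t u v : (0 < size u.2)%N -> (0 < size v.2)%N -> disj u v ->
  disj (act t u) (act t v).
Proof.
have icat ga al be : incomp (ga ++ al) (ga ++ be) = incomp al be.
  by elim: ga => //= x ga IH; rewrite -IH /incomp !prefix_cons !eqxx.
case: t => [[k a] l]; case: u v => [i al] [j be] /= sal sbe.
case: (eqVneq k l) => // kl.
rewrite /disj; case: (eqVneq i l) => [il|il]; case: (eqVneq j l) => [jl|jl] /=.
- by subst i j; rewrite !eqxx icat.
- subst i; case: (eqVneq j k) => [jk _|jk _] /=; last by rewrite eq_sym jk.
  subst j; case: a => [x|] /=; last by rewrite kl.
  case: be sbe => // y be _; case: (eqVneq x y) => [_|xy] /=; first by rewrite kl.
  by rewrite eqxx /incomp !prefix_cons [y == x]eq_sym (negPf xy).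
- subst j; case: (eqVneq i k) => [ik _|ik _] /=; last by rewrite ik.
  subst i; case: a => [x|] /=; last by rewrite eq_sym kl.
  case: al sal => // y al _; case: (eqVneq x y) => [_|xy] /=; first by rewrite eq_sym kl.
  by rewrite eqxx /incomp !prefix_cons [y == x]eq_sym (negPf xy).
case: (eqVneq i k) => [ik|ik]; case: (eqVneq j k) => [jk|jk] /=.
- subst i j; rewrite eqxx /=; case: a => [x|] /=; last by rewrite eqxx.
  case: al be sal sbe => [|y al] // [|z be] // _ _; rewrite /incomp !prefix_cons.
  by case: x y z => [] [] [] //=; rewrite ?eqxx ?(eq_sym l) ?kl // ?prefix_cons.
- subst i; move=> _; case: a => [x|]; first case: al sal => // y al _; first case: (x == y);
    by rewrite /= [_ == j]eq_sym ?jl ?jk.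
- subst j; move=> _; case: a => [x|]; first case: be sbe => // y be _; first case: (x == y);
    by rewrite /= ?il ?ik.
by [].
Qed.

(** A generator removes at most one letter, so a word of length [n] acts properly on addresses of
    depth at least [n]. *)
Lemma act_size t u : (size u.2 <= (size (act t u).2).+1)%N.
Proof.
case: t u => [[k a] l] [i al] /=; case: (k == l) => //; case: (i == l) => /=.
  by rewrite size_cat; lia.
by case: (i == k) => //; case: a => [x|] //; case: al => // y al; case: (x == y).
Qed.

Definition gen (t : Root * option bool * Root) : Y := g t.1.1 t.1.2 t.2.
Definition prodw (w : seq (Root * option bool * Root)) : Y :=
  foldr (fun t x => gen t ** x) gone w.
Definition actw (w : seq (Root * option bool * Root)) u : addr := foldr act u w.

Lemma act_Sw t u v : (0 < size u.2)%N -> (0 < size v.2)%N -> disj u v ->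
  cj (gen t) (Sw u v) = Sw (act t u) (act t v).
Proof.
move=> su sv uv; case: t => [[k a] l].
pick_fresh p [:: k; l; u.1; v.1; (act (k, a, l) u).1; (act (k, a, l) v).1].
rewrite (@SwE _ _ p) //; last by neqs.
rewrite cj_cj !act_Ea //; try by neqs.
by rewrite -SwE ?act_disj //; neqs.
Qed.

Lemma actw_size w u : (size u.2 <= size (actw w u).2 + size w)%N.
Proof. by elim: w => [|t w IH] /=; rewrite ?addn0 //; have := act_size t (actw w u); lia. Qed.

Lemma actw_Sw w u v : (size w <= size u.2)%N -> (size w <= size v.2)%N -> disj u v ->
  cj (prodw w) (Sw u v) = Sw (actw w u) (actw w v) /\ disj (actw w u) (actw w v).
Proof.
elim: w => [|t w IH] /= su sv uv; first by split=> //; rewrite /cj ?gE.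
have [|| e d] := IH _ _ uv; [lia|lia|].
have := actw_size w u; have := actw_size w v => sv' su'.
by rewrite cj_mul e act_Sw ?act_disj //; lia.
Qed.

(* Splitting every swap into swaps of small cones makes the conjugation action of a
   word on the generators visible from its action on deep addresses only. *)
Lemma prodw_central w : (exists n, forall u, (n <= size u.2)%N -> actw w u = u) ->
  forall t, cj (prodw w) (gen t) = gen t.
Proof.
move=> [n wn] t; apply: Sw_comm_all; exists (n + size w) => u v uv su sv.
by have [||-> _] := @actw_Sw w u v _ _ uv; rewrite ?wn //; lia.
Qed.


(** * Normal generation and finite quotients of swap groups *)

Lemma e_move (N : Y -> Prop) i j k : is_normal N -> uniq [:: i; j; k] ->
  N (e i j) -> N (e k j).
Proof.
move=> [_ NJ] u Nij; rewrite -(@sr_left _ _ gR k j i None); last by neqs.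
exact: NJ.
Qed.

(** Root swaps are all conjugate, moving one index at a time over fresh roots, and [sr_mid]
    conjugates them to the other generators. *)
Lemma normal_gen (N : Y -> Prop) i j : is_normal N -> i != j -> N (e i j) ->
  forall t, N (gen t).
Proof.
move=> nN ij Nij.
have Ne p q : p != q -> N (e p q).
  move=> pq; pick_fresh r [:: i; j; p; q]; pick_fresh s [:: i; j; p; q; r].
  have Nrj : N (e r j) by apply: e_move Nij => //; neqs.
  have Nrs : N (e s r) by apply: (@e_move N j r s nN); [neqs | rewrite (sr_sym gR)].
  have Nps : N (e p s) by apply: (@e_move N r s p nN); [neqs | rewrite (sr_sym gR)].
  by rewrite (sr_sym gR); apply: (@e_move N s p q nN); [neqs | rewrite (sr_sym gR)].
case=> [[k a] l]; rewrite /gen /=; case: (eqVneq k l) => [->|kl].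
  by rewrite (sr_diag gR); case: nN => [[]].
pick_fresh p [:: k; l]; rewrite -(@sr_mid _ _ gR k l p); last by neqs.
by apply: (proj2 nN); apply: Ne; neqs.
Qed.

Lemma Ea_Sw w u v p : disj u v -> disj w u -> disj w v -> p \notin [:: w.1; u.1; v.1] ->
  cj (Ea w p) (Sw u v) = Sw u v.
Proof.
move=> uv wu wv Fp; pick_fresh x [:: w.1; u.1; v.1; p].
rewrite (@SwE u v x) //; last by neqs.
by rewrite cj_cj !(@Ea_disj w) //; neqs.
Qed.

Lemma Ea_root u p q : uniq [:: u.1; p; q] -> cj (Ea u p) (Ea u q) = e p q.
Proof. by move=> F; apply: cj_swapE; rewrite (@Ea_cat _ [::]) ?cats0 //; neqs. Qed.

Lemma Sw_root u v p q : disj u v -> p != q -> p \notin [:: u.1; v.1] ->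
  q \notin [:: u.1; v.1] -> cj (Ea v q ** Ea u p) (Sw u v) = e q p.
Proof.
move=> uv pq Fp Fq; pick_fresh x [:: u.1; v.1; p; q].
rewrite (@SwE u v x) //; last by neqs.
rewrite cj_mul (cj_cj (Ea u p)) Ea_root; last by neqs.
rewrite (@Ea_disj u v p x) //; try by neqs.
rewrite /Ea E_equiv ?tpermR; [|by neqs|by neqs].
rewrite tpermD; [|by neqs|by neqs].
by rewrite -/(Ea v q) Ea_root //; neqs.
Qed.

Definition disj4 u v u' v' :=
  [&& disj u v, disj u u', disj u v', disj v u', disj v v' & disj u' v'].

Lemma Sw2_root u v u' v' p q p' q' : disj4 u v u' v' -> uniq [:: p; q; p'; q'] ->
  all (fun x => x \notin [:: u.1; v.1; u'.1; v'.1]) [:: p; q; p'; q'] ->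
  exists K, cj K (Sw u v ** Sw u' v') = e q p ** e q' p'.
Proof.
move=> /and5P[uv uu' uv' vu' /andP[vv' u'v']] upq /and5P[Fp Fq Fp' Fq' _].
exists ((Ea v' q' ** Ea u' p') ** (Ea v q ** Ea u p)).
rewrite cj_mul !(cjM _ (Sw u v)) Sw_root //; try by neqs.
have -> : cj (Ea v q ** Ea u p) (Sw u' v') = Sw u' v'.
  by rewrite cj_mul !Ea_Sw //; neqs.
rewrite cjM Sw_root //; try by neqs.
congr (_ ** _); rewrite cj_mul.
by rewrite /Ea !(@E_far [::] _ q p) //; neqs.
Qed.

(** By [Sw2_root] all such products are conjugate to one product of two root swaps. A single root
    swap splits into such a product too, so it lies in [N]. *)
Lemma Sw2_normal_gen (N : Y -> Prop) u v u' v' : is_normal N -> disj4 u v u' v' ->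
  N (Sw u v ** Sw u' v') -> forall t, N (gen t).
Proof.
move=> nN d NS; set s := [:: u.1; v.1; u'.1; v'.1].
have [p Fp] := @fresh_exists s isT.
have [q Fq] := @fresh_exists (p :: s) isT.
have [p' Fp'] := @fresh_exists (q :: p :: s) isT.
have [q' Fq'] := @fresh_exists (p' :: q :: p :: s) isT.
have [i Fi] := @fresh_exists [:: p; q; p'; q'] isT.
have [j Fj] := @fresh_exists [:: i; p; q; p'; q'] isT.
rewrite /s in Fp Fq Fp' Fq'.
have [||K KE] := @Sw2_root u v u' v' p q p' q' d; [by neqs | by neqs |].
have ij : i != j by neqs.
(* The halves of the roots [i] and [j], whose two swaps multiply to the swap of [i] and [j]. *)
have [|||K' KE'] := @Sw2_root (i, [:: false]) (j, [:: false]) (i, [:: true]) (j, [:: true])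
  p q p' q'; [|by neqs | by neqs |].
  by rewrite /disj4 /disj /= !eqxx ij [j == i]eq_sym ij.
have es : e i j = _ := @E_split i [::] j ij.
apply: (normal_gen nN ij); rewrite -(cjK K' (e i j)) es KE' -KE.
by do !apply: (proj2 nN).
Qed.

Lemma fin_not_inj (f : nat -> Y) : fin Y -> exists m n, (m < n)%N /\ f m = f n.
Proof.
move=> [s sP]; apply: NNPP => nf.
have fI : injective f.
  move=> m n emn; apply/eqP; apply: contraT => mn; case: nf.
  by case: (ltngtP m n) mn => // lt _; [exists m, n | exists n, m].
have [r rP] : fin nat by apply: (@fin_inj _ _ f s).
have : exists M, forall n, In n r -> (n < M)%N.
  elim: (r) => [|a l [M MP]]; first by exists 0.
  by exists (M + a.+1)%N => n /= [<-|/MP]; lia.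
by case=> M /(_ M (rP M)); rewrite ltnn.
Qed.

(** Infinitely many pairwise incomparable cones lie below one root, so finiteness identifies two of
    their swaps. The collapse spreads until the generators on the remaining roots coincide, and
    [sr_split] turns their common value into a conjugate of the square of an involution. *)
Lemma swap_fin_trivial : fin Y -> forall t, gen t = gone.
Proof.
move=> finY; pose i : Root := inord 0; pose j : Root := inord 1.
have ij : i != j by rewrite -val_eqE /= !inordK.
pose al m := rcons (nseq m true) false.
have ic m n : (m < n)%N -> incomp (al m) (al n).
  rewrite /incomp /al; elim: m n => [|m IH] [|n] //= mn.
  exact: IH.
have [m [n [mn Emn]]] := fin_not_inj (fun m => E i (al m) j) finY.
(* By incomparability [E i (al m) j] fixes [E i (al n) k], which equals [E i (al m) k]; but it
   conjugates the latter to the swap of [j] and [k]. *)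
have jk k : k \notin [:: i; j] -> e j k = E i (al m) k.
  move=> Fk; have Ek : E i (al n) k = E i (al m) k.
    have tE a : E i a k = cj (e j k) (E i a j).
      by rewrite E_equiv ?tpermL ?tpermD //; neqs.
    by rewrite !tE Emn.
  have : cj (E i (al m) j) (E i (al n) k) = E i (al n) k by apply: E_near; [neqs | apply: ic].
  rewrite Ek => <-; symmetry; apply: cj_swapE.
  by rewrite (@E_cat _ [::]) ?cats0 //; neqs.
(* The right side of [jk] commutes with the swap of [j] and [l], so [j] may be renamed to [l]. *)
have lk k l : uniq [:: i; j; k; l] -> e l k = e j k.
  move=> u; rewrite (jk k); last by neqs.
  rewrite -(@E_far1 (al m) i k j l None); last by neqs.
  by rewrite -jk ?g_equiv ?tpermL ?tpermD //; neqs.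
have [k Fk] := @fresh_exists [:: i; j] isT.
have [l Fl] := @fresh_exists [:: i; j; k] isT.
have [p Fp] := @fresh_exists [:: i; j; k; l] isT.
have [q Fq] := @fresh_exists [:: i; j; k; l; p] isT.
have const a b : uniq [:: i; j; a; b] -> e a b = e k l.
  move=> u; have ea : e a b = e j b by apply: lk; neqs.
  have eb : e a b = e j a by rewrite (sr_sym gR); apply: lk; neqs.
  have [c Fc] := @fresh_exists [:: i; j; k; l; a; b] isT.
  have e1 : e c a = e j a by apply: lk; neqs.
  have e2 : e a c = e j c by apply: lk; neqs.
  have e3 : e k c = e j c by apply: lk; neqs.
  have e4 : e c k = e j k by apply: lk; neqs.
  have e5 : e l k = e j k by apply: lk; neqs.
  by rewrite eb -e1 (sr_sym gR) e2 -e3 (sr_sym gR) e4 -e5 (sr_sym gR).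
have gc a b x : uniq [:: i; j; a; b] -> g a (Some x) b = e k l.
  move=> u; have [c Fc] := @fresh_exists [:: i; j; a; b] isT.
  have [d Fd] := @fresh_exists [:: i; j; a; b; c] isT.
  have [f Ff] := @fresh_exists [:: i; j; a; b; c; d] isT.
  rewrite -(@sr_mid _ _ gR a b c); last by neqs.
  rewrite (const c b); last by neqs.
  rewrite -(const d f); last by neqs.
  by apply/comm1_cj/(sr_far gR); neqs.
have e1 : e k l = gone.
  have -> : e k l = cj (e k l) (e k l) ** cj (e k l) (e k l).
    rewrite {1}(@sr_split _ _ gR k l p); last by neqs.
    by rewrite !gc //; neqs.
  by rewrite -cjM (sr_sq gR) cj1.
apply: (@normal_gen (fun x => x = gone) k l) => //; [exact: trivial_normal | neqs].
Qed.

End SwapGroup.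

(** * The swap group acting on points *)

(* The tree below each root is modelled on [nat], the children of [z] being [2 z] and
   [2 z + 1], so that the cone at [u] is the set of all [pt u z]. *)
Definition point := (Root * nat)%type.
Definition bits (al : seq bool) (z : nat) : nat := foldr (fun (b : bool) z => b + z.*2)%N z al.
Definition pt (u : addr) (z : nat) : point := (u.1, bits u.2 z).

Definition mgen (k : Root) (a : option bool) (l : Root) (x : point) : point :=
  if k == l then x else
  if x.1 == l then pt (k, opt_seq a) x.2 else
  if x.1 == k then
    if a is Some b then (if odd x.2 == b then (l, x.2./2) else x) else (l, x.2)
  else x.

Lemma odd_bit (b : bool) z : odd (b + z.*2) = b.
Proof. by rewrite oddD odd_double addbF oddb. Qed.

Lemma half_bit (b : bool) z : (b + z.*2)./2 = z.
Proof. exact: half_bit_double. Qed.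

Ltac neq_simp := repeat match goal with
  | H : is_true (?a != ?b) |- context [?a == ?b] => rewrite (negPf H)
  | H : is_true (?a != ?b) |- context [?b == ?a] => rewrite [b == a]eq_sym (negPf H)
  end.


Lemma mgenK k a l : involutive (mgen k a l).
Proof.
case=> h z; rewrite /mgen; case: (eqVneq k l) => //= kl.
case: (eqVneq h l) => [->|hl] /=.
  by case: a => [b|] /=; rewrite eqxx; neq_simp; rewrite ?odd_bit ?half_bit ?eqxx.
case: (eqVneq h k) => [->|hk] /=; last by neq_simp.
case: a => [b|] /=; last by rewrite eqxx.
case: (odd z =P b) => [ob|/eqP/negPf nob] /=; last by rewrite eqxx; neq_simp; rewrite nob.
by rewrite eqxx -{2}(odd_double_half z) ob.
Qed.

Definition msym k a l : sym_grp point := MkSym (mgenK k a l) (mgenK k a l).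

Lemma msymV k a l : ginv (msym k a l) = msym k a l.
Proof. exact: symP. Qed.

Lemma cj_msym k a l x : cj (msym k a l) x = msym k a l ** x ** msym k a l.
Proof. by rewrite /cj msymV. Qed.

Ltac msimp := rewrite ?/msym /= ?/mgen /pt /=;
  do 5 (neq_simp; rewrite /= ?eqxx ?odd_bit ?half_bit).
Ltac mcase := msimp; repeat (match goal with
  | |- context [if (odd ?z == ?b) then _ else _] => case: (odd z == b) / idP => ?
  end; msimp).
Ltac mroots h s := lazymatch s with
  | ?i :: ?s' => case: (eqVneq h i) => [?|?]; [subst h; mcase | mroots h s']
  | [::] => mcase
  end.

Lemma mgen_l k a l z : k != l -> mgen k a l (l, z) = pt (k, opt_seq a) z.
Proof. by move=> kl; rewrite /mgen (negPf kl) eqxx. Qed.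

Lemma mgen_kNone k l z : k != l -> mgen k None l (k, z) = (l, z).
Proof. by move=> kl; rewrite /mgen /= (negPf kl) eqxx. Qed.

Lemma mgen_kSome k b l z : k != l -> mgen k (Some b) l (k, b + z.*2)%N = (l, z).
Proof. by move=> kl; rewrite /mgen /= (negPf kl) eqxx odd_bit half_bit eqxx. Qed.

Lemma mgen_kSome' k b c l z : k != l -> c != b ->
  mgen k (Some b) l (k, c + z.*2)%N = (k, c + z.*2)%N.
Proof. by move=> kl cb; rewrite /mgen /= (negPf kl) eqxx odd_bit (negPf cb). Qed.

Lemma mgen_o k a l h z : h != k -> h != l -> mgen k a l (h, z) = (h, z).
Proof. by move=> hk hl; rewrite /mgen /= (negPf hk) (negPf hl) if_same. Qed.

Ltac meval := repeat (first [rewrite mgen_l; last by neqs | rewrite mgen_kNone; last by neqs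
  | rewrite mgen_kSome; last by neqs | rewrite mgen_kSome'; [|by neqs|by neqs]
  | rewrite mgen_o; [|by neqs|by neqs]]; rewrite ?/pt /=).

Lemma msym_swap_rel : swap_rel msym.
Proof.
split.
- by move=> i a; apply: symP => x; rewrite /= /mgen eqxx.
- by move=> i a j; apply: symP => x; rewrite /= mgenK.
- move=> i j; apply: symP => -[h z]; case: (eqVneq i j) => [-> //|ij].
  by mroots h [:: i; j].
- move=> i j k l a b u; apply/comm1P/symP => -[h z] /=; neq_hyps.
  by case: a b => [a|] [b|]; mroots h [:: i; j; k; l].
- move=> i j k b u; rewrite cj_msym; apply: symP => -[h z]; neq_hyps.
  by case: b => [b|]; mroots h [:: i; j; k].
- move=> i j k a u; rewrite cj_msym; apply: symP => -[h z]; neq_hyps.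
  by case: a => [a|]; mroots h [:: i; j; k].
- move=> i j k a u; rewrite cj_msym; apply: symP => -[h z]; neq_hyps.
  by case: a => [a|]; mroots h [:: i; j; k].
- move=> i j k u; have: false != true by []; move: false true => c d cd.
  apply/comm1P/symP => -[h z]; neq_hyps.
  rewrite -(odd_double_half z); move: (odd z) (z./2) => b w.
  by case: (eqVneq b c) => [?|?]; [subst b | case: (eqVneq b d) => [?|?]; [subst b|]];
    mroots h [:: i; j; k].
- move=> i j k u; rewrite !cj_msym; apply: symP => -[h z]; neq_hyps.
  have: false != true by []; have: forall b, (b == false) || (b == true) by case.
  move: false true => c d all_cd cd; move: (all_cd (odd z)).
  have dc : d != c by rewrite eq_sym.
  rewrite -(odd_double_half z) odd_bit; move: (odd z) (z./2) => b w.
  by case/orP => /eqP ?; subst b => /=; (case: (eqVneq h i) => [->|hi];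
    [|case: (eqVneq h j) => [->|hj]; [|case: (eqVneq h k) => [->|hk]]]); meval.
Qed.

Lemma swap_rel_inj (Y Z : Grp) (f : Y -> Z) g : is_hom f -> injective f ->
  swap_rel (fun i a j => f (g i a j)) -> swap_rel g.
Proof.
move=> fM fI [R1 R2 R3 R4 R5 R6 R7 R8 R9]; split.
- by move=> i a; apply: fI; rewrite R1 (hom1 fM).
- by move=> i a j; apply: fI; rewrite fM R2 (hom1 fM).
- by move=> i j; apply: fI; rewrite R3.
- by move=> i j k l a b u; apply: fI; rewrite (hom_comm fM) R4 // (hom1 fM).
- by move=> i j k b u; apply: fI; rewrite (hom_cj fM) R5.
- by move=> i j k b u; apply: fI; rewrite (hom_cj fM) R6.
- by move=> i j k b u; apply: fI; rewrite (hom_cj fM) R7.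
- by move=> i j k u; apply: fI; rewrite (hom_comm fM) R8 // (hom1 fM).
- by move=> i j k u; apply: fI; rewrite fM !(hom_cj fM); apply: R9.
Qed.

Definition label := (Root * option bool * Root)%type.

Lemma prodw_cat (Y : Grp) (g : Root -> option bool -> Root -> Y) w1 w2 :
  prodw g (w1 ++ w2) = prodw g w1 ** prodw g w2.
Proof. by elim: w1 => [|t w1 IH] /=; rewrite ?gmul1 // IH gmulA. Qed.

(** Inversion becomes reversal because the generators of a swap group are involutions. *)
Fixpoint flat (t : term label) : seq label :=
  match t with
  | Var i => [:: i]
  | One => [::]
  | Mul a b => flat a ++ flat b
  | Inv a => rev (flat a)
  end.

Lemma ev_flat (Y : Grp) (g : Root -> option bool -> Root -> Y) t : swap_rel g ->
  ev (gen g) t = prodw g (flat t).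
Proof.
move=> gR; elim: t => //= [i|a -> b ->|a ->]; first by rewrite gmulr1.
  by rewrite prodw_cat.
elim: (flat a) => [|i w IH] /=; first by rewrite ginv1.
by rewrite rev_cons -cats1 prodw_cat /= gmulr1 ginvM -IH /gen gV.
Qed.

Lemma mgen_act t u z : (0 < size u.2)%N -> gen msym t (pt u z) = pt (act t u) z.
Proof.
case: t => [[k a] l]; case: u => [i al] /=; rewrite /gen /= => sal.
case: (eqVneq k l) => [<-|kl]; first by rewrite /mgen eqxx.
case: (eqVneq i l) => [->|il]; first by rewrite /pt mgen_l // /pt /bits foldr_cat.
case: (eqVneq i k) => [->|ik]; last by rewrite /pt mgen_o.
case: a => [x|]; last by rewrite /pt mgen_kNone.
case: al sal => // y al _; rewrite /pt /=; case: (eqVneq x y) => [->|xy].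
  by rewrite mgen_kSome.
by rewrite mgen_kSome' // eq_sym.
Qed.

Lemma prodw_actw w u z : (size w <= size u.2)%N ->
  (prodw msym w : sym_grp point) (pt u z) = pt (actw w u) z.
Proof.
elim: w => // t w IH sw; rewrite /= in sw.
rewrite -[LHS]/((gen msym t : sym_grp point) ((prodw msym w : sym_grp point) (pt u z))).
rewrite IH; last by lia.
by rewrite mgen_act //; have := actw_size w u; lia.
Qed.

Lemma bitsE al z : bits al z = (bits al 0 + 2 ^ size al * z)%N.
Proof.
elim: al => [|b al IH] /=; first by rewrite mul1n.
by rewrite IH expnS doubleD -!muln2; lia.
Qed.

Lemma bits_inj al be : (forall z, bits al z = bits be z) -> al = be.
Proof.
elim: al be => [|x al IH] [|y be] //= e.
- by have := e 0; have := e 1; case: y {e} => /=; lia.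
- by have := e 0; have := e 1; case: x {e} => /=; lia.
have xy : x = y by have := congr1 odd (e 0); rewrite !odd_bit.
congr (_ :: _) => //; apply: IH => z; have := congr1 half (e z).
by rewrite !half_bit.
Qed.

Lemma pt_inj u v : (forall z, pt u z = pt v z) -> u = v.
Proof.
case: u v => [i al] [j be] e; have [ij _] := e 0; congr (_, _) => //.
by apply: bits_inj => z; case: (e z).
Qed.

(* A swap group is determined modulo its centre: it is a central extension of its image
   in the permutations of [point]. *)
Lemma ev_central (Y : Grp) (g : Root -> option bool -> Root -> Y) t : swap_rel g ->
  generates (gen g) -> ev (gen msym) t = gone -> central (ev (gen g) t).
Proof.
move=> gR gG; rewrite !ev_flat //; last exact: msym_swap_rel.
set w := flat t => ew; apply: commute_generates gG _ => i; apply/cj_fixP.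
apply: prodw_central => //; exists (size w) => u su.
by apply: pt_inj => z; rewrite -prodw_actw // ew.
Qed.

(** Numbers, read in binary from the lowest bit, stand for the eventually zero ends of a binary
    tree; the generators act by exchanging prefixes. *)
Definition V := gen_grp (gen msym).
Definition vgen (t : label) : V := gen_gen (gen msym) t.
Definition vg i a j : V := vgen (i, a, j).

Lemma vg_swap_rel : swap_rel vg.
Proof.
apply: (@swap_rel_inj _ _ (@sval_grp _ _ (ev_is_subgroup (gen msym)))) => //.
  exact: sval_grp_inj.
exact: msym_swap_rel.
Qed.

Lemma gen_vg t : gen vg t = vgen t.
Proof. by case: t => [[i a] j]. Qed.

Lemma vgen_generates : generates (gen vg).
Proof.
have -> : gen vg = vgen by apply: functional_extensionality => t; apply: gen_vg.
exact: generates_gen.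
Qed.

Definition vval (x : V) : sym_grp point := sval_grp x.

Lemma vval_hom : is_hom vval.
Proof. by []. Qed.

Lemma vval_prodw w : vval (prodw vg w) = prodw msym w.
Proof.
elim: w => // t w IH; rewrite -[LHS]/(vval (gen vg t) ** vval (prodw vg w)) IH.
by case: t => [[i a] j].
Qed.

Lemma vval_inj : injective vval.
Proof. exact: sval_grp_inj. Qed.

Fixpoint abits n z := if n is n'.+1 then odd z :: abits n' z./2 else [::].

Lemma size_abits n z : size (abits n z) = n.
Proof. by elim: n z => //= n IH z; rewrite IH. Qed.

Lemma bits_abits n z : bits (abits n z) (iter n half z) = z.
Proof.
elim: n z => // n IH z; rewrite iterSr.
by rewrite -[RHS](odd_double_half z) -[in RHS](IH z./2).
Qed.

(** The numbers in the cone at [al] form a residue class modulo [2 ^ size al]. *)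
Lemma bits_small al r s : (bits al r < 2 ^ size al)%N -> (bits al s < 2 ^ size al)%N ->
  bits al r = bits al s.
Proof.
by rewrite (bitsE al r) (bitsE al s); case: r s => [|r] [|s]; rewrite // ?mulnS; lia.
Qed.

Lemma act_ext t u x : (0 < size u.2)%N -> act t (ext u x) = ext (act t u) x.
Proof.
case: t => [[k a] l]; case: u => [i al] /= sal.
case: (k == l) => //; case: (i == l); first by rewrite /ext /= rcons_cat.
case: (i == k) => //; case: a => [b|] //.
by case: al sal => // y al _ /=; case: (b == y).
Qed.

Lemma actw_ext w u x : (size w <= size u.2)%N -> actw w (ext u x) = ext (actw w u) x.
Proof.
elim: w => //= t w IH sw; rewrite IH ?act_ext //; last by lia.
by have := actw_size w u; lia.
Qed.

(** Were a small cone at the point comparable with its image, the point and its image would lie in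
    the larger of the two cones and below its modulus, hence agree by [bits_small]. *)
Lemma moved_disj w x : (prodw msym w : sym_grp point) x <> x ->
  exists u, (size w < size u.2)%N /\ disj u (actw w u).
Proof.
case: x => [h z]; case e : ((prodw msym w : sym_grp point) (h, z)) => [h' z'] ne.
(* Deep enough for the modulus to exceed both coordinates even after [w] has removed [size w]
   letters. *)
set n := (size w + z + z').+1; set u := (h, abits n z).
have su : size u.2 = n by apply: size_abits.
exists u; split; first by rewrite su /n; lia.
set v := actw w u.
have sv : (z + z' < size v.2)%N by have := actw_size w u; rewrite -/v su /n; lia.
set r := iter n half z.
have eu : bits u.2 r = z by apply: bits_abits.
have [eh ez] : pt v r = (h', z').
  by rewrite -prodw_actw ?su; [rewrite /pt eu e | rewrite /n; lia].
have small (al : seq bool) m : (m <= z + z')%N -> (z + z' < size al)%N -> (m < 2 ^ size al)%N.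
  move=> mz al_z; apply: leq_trans (ltn_expl m (isT : 1 < 2)%N) _; rewrite leq_exp2l //.
  exact: leq_trans (ltnW al_z).
rewrite /disj /incomp -negb_or -negb_and; apply/negP => /andP[/eqP hh pf]; case: ne; rewrite -eh -hh; congr (_, _).
case/orP: pf => /prefixP[ga ega].
- have ez' : bits u.2 (bits ga r) = z' by rewrite -ez ega /bits foldr_cat.
  rewrite -ez' -[RHS]eu; apply: bits_small.
    by rewrite ez'; apply: small; rewrite ?su /n; lia.
  by rewrite eu; apply: small; rewrite ?su /n; lia.
- have ez' : bits v.2 (bits ga r) = z by rewrite -eu ega /bits foldr_cat.
  rewrite -ez -[RHS]ez'; apply: bits_small.
    by rewrite ez; apply: small; lia.
  by rewrite ez'; apply: small; lia.
Qed.

(** * Simplicity of the swap permutation group *)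

Definition simple_grp (G : Grp) :=
  forall N : G -> Prop, is_normal N -> (exists x, N x /\ x <> gone) -> forall x, N x.

(** A nontrivial [x] moves some cone [u] to a disjoint cone [v]. Its commutator with the swap of the
    halves of [u] is that swap times the swap of the halves of [v], and such a product normally
    generates. *)
Lemma V_simple : simple_grp V.
Proof.
move=> N nN [x [Nx x1]]; have [t te] := vgen_generates x.
have gR := vg_swap_rel; move: te; rewrite ev_flat //; set w := flat t => ew.
have [p0 np0] : exists p, (prodw msym w : sym_grp point) p <> p.
  apply: NNPP => nm; apply: x1; rewrite -ew; apply: vval_inj; rewrite vval_prodw.
  by apply: symP => p; apply: NNPP => np; apply: nm; exists p.
have [u [su d]] := moved_disj np0.
set v := actw w u in d; have sv := actw_size w u.
set S := Sw vg (ext u false) (ext u true).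
have ES : cj (prodw vg w) S = Sw vg (ext v false) (ext v true).
  have [||-> _] := @actw_Sw _ _ gR w _ _ _ _ (disj_ext01 u); rewrite ?size_rcons; try lia.
  by rewrite !actw_ext //; lia.
have SV y z : ginv (Sw vg y z) = Sw vg y z by rewrite /Sw -cjV EaV.
have NS : N (Sw vg (ext v false) (ext v true) ** Sw vg (ext u false) (ext u true)).
  rewrite -ES -/S.
  have -> : cj (prodw vg w) S ** S = prodw vg w ** cj S (ginv (prodw vg w)).
    by rewrite /cj (SV (ext u false)) -!gmulA.
  rewrite ew; case: nN => [[_ [NM NV]] NJ].
  by apply: NM => //; apply: NJ; apply: NV.
have d4 : disj4 (ext v false) (ext v true) (ext u false) (ext u true).
  by rewrite /disj4 !disj_ext01 ?disj_ext // disjC.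
apply: generates_subgroup vgen_generates (proj1 nN) _.
exact (Sw2_normal_gen gR nN d4 NS).
Qed.

Lemma V_nonabelian : exists x y : V, x ** y <> y ** x.
Proof.
pose i k : Root := inord k.
have i01 : i 0 != i 1 by rewrite -val_eqE /= !inordK.
have i12 : i 1 != i 2 by rewrite -val_eqE /= !inordK.
have i02 : i 0 != i 2 by rewrite -val_eqE /= !inordK.
exists (vg (i 0) None (i 1)), (vg (i 1) None (i 2)) => /(congr1 vval).
move=> /(congr1 (fun s : sym_grp point => s (i 2, 0))).
move: (i 0) (i 1) (i 2) i01 i12 i02 => a b c ab bc ac /=.
by meval => -[eab]; rewrite eab eqxx in ab.
Qed.

Lemma V_indecomp : indecomp V.
Proof.
move=> U W nU nW UW.
have [U1|/not_all_ex_not[u nu]] := classic (forall u, U u -> u = gone); first by left.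
have [W1|/not_all_ex_not[w nw]] := classic (forall w, W w -> w = gone); first by right.
have allU : forall x, U x by apply: V_simple nU _; exists u; apply: NNPP => ?; apply: nu; tauto.
have allW : forall x, W x by apply: V_simple nW _; exists w; apply: NNPP => ?; apply: nw; tauto.
by have [x [y []]] := V_nonabelian; apply: UW.
Qed.

Lemma V_centerless z : central z -> z = gone :> V.
Proof.
move=> cz; have [||||] := @V_indecomp (@central V) (fun _ => True).
- exact: central_normal.
- by split.
- by move=> x y cx _; apply: cx.
- by apply.
- by move=> V1; apply: V1.
Qed.

(** * Three doubled involutions generating the swap group *)

Definition rootfun (s : sym_grp Root) (x : point) : point := ((s : Root -> Root) x.1, x.2).

Lemma rootfunK (s : sym_grp Root) x : rootfun (ginv s) (rootfun s x) = x.
Proof. by case: x => i z; rewrite /rootfun /= sfunK. Qed.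

Lemma rootfunVK (s : sym_grp Root) x : rootfun s (rootfun (ginv s) x) = x.
Proof. by case: x => i z; rewrite /rootfun /= sfinvK. Qed.

Definition rootsym (s : sym_grp Root) : sym_grp point := MkSym (rootfunK s) (rootfunVK s).

Lemma rootsym_V s : exists t, ev (gen msym) t = rootsym s.
Proof.
have sI : injective (s : Root -> Root) by move=> x y e; rewrite -(sfunK s x) e sfunK.
have [ts es] := prod_tpermP (perm sI).
suff [t te] : exists t, forall i z, (ev (gen msym) t : sym_grp point) (i, z) =
    ((\prod_(t <- ts) tperm t.1 t.2)%g i, z).
  by exists t; apply: symP => -[i z]; rewrite te -es permE.
move=> {es}; elim: ts => [|[a b] ts [t te]]; first by exists One => i z; rewrite big_nil perm1.
(* [permM] applies the left factor first, so the new transposition goes to the right. *)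
exists (Mul t (Var (a, None, b))) => i z.
rewrite big_cons permM -te /=; congr (sfun _ _).
rewrite /gen /= /mgen /=; case: (eqVneq a b) => [->|ab]; first by rewrite tperm1 perm1.
case: (eqVneq i b) => [->|ib]; first by rewrite tpermR.
case: (eqVneq i a) => [->|ia]; first by rewrite tpermL.
by rewrite tpermD // eq_sym.
Qed.

Definition rootV (s : sym_grp Root) : V := Sub_grp (ev_is_subgroup _) (rootsym_V s).

Lemma rootV_hom : is_hom rootV.
Proof. by move=> s t; apply: vval_inj; apply: symP. Qed.

Lemma cj_rootV s i a j : cj (rootV s) (vg i a j) = vg ((s : Root -> Root) i) a ((s : Root -> Root) j).
Proof.
apply: vval_inj; rewrite (hom_cj vval_hom); apply: symP => -[h z].
have sI : injective (s : Root -> Root) by move=> x y e; rewrite -(sfunK s x) e sfunK.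
have [h' ->] : exists h', h = (s : Root -> Root) h' by exists (sfinv s h); rewrite sfinvK.
rewrite /= /rootfun /= sfunK /mgen /= !(inj_eq sI) {h}; move: h' => h.
case: (i == j) => //; case: (h == j) => //; case: (h == i) => //; case: a => // b.
by case: (odd z == b).
Qed.

(* Permutations of the 17 roots given by arithmetic functions and their inverses; their
   identities are checked by computation. *)
Definition nsym := ((nat -> nat) * (nat -> nat))%type.
Definition rep (s : sym_grp Root) (p : nsym) :=
  forall i : Root, nat_of_ord ((s : Root -> Root) i) = p.1 i /\ nat_of_ord (sfinv s i) = p.2 i.
Definition nmul (p q : nsym) : nsym := (fun m => p.1 (q.1 m), fun m => q.2 (p.2 m)).
Definition ninv (p : nsym) : nsym := (p.2, p.1).
Definition ncomm p q := nmul (nmul (nmul p q) (ninv p)) (ninv q).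
Definition ncj p q := nmul (nmul p q) (ninv p).
Definition neq_sym (p q : nsym) := all (fun m => p.1 m == q.1 m) (iota 0 17).
Definition nok (p : nsym) :=
  all (fun m => [&& p.1 m < 17, p.2 m < 17, p.2 (p.1 m) == m & p.1 (p.2 m) == m])%N (iota 0 17).

Lemma rep_mul s t p q : rep s p -> rep t q -> rep (s ** t) (nmul p q).
Proof. by move=> rs rt i; split=> /=; [rewrite (proj1 (rs _)) (proj1 (rt _)) | rewrite (proj2 (rt _)) (proj2 (rs _))]. Qed.

Lemma rep_inv s p : rep s p -> rep (ginv s) (ninv p).
Proof. by move=> rs i; case: (rs i). Qed.

Lemma rep_comm s t p q : rep s p -> rep t q -> rep (comm s t) (ncomm p q).
Proof. by move=> rs rt; do !apply: rep_mul => //; apply: rep_inv. Qed.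

Lemma rep_cj s t p q : rep s p -> rep t q -> rep (cj s t) (ncj p q).
Proof. by move=> rs rt; do !apply: rep_mul => //; apply: rep_inv. Qed.

Lemma rep_eq s t p q : rep s p -> rep t q -> neq_sym p q -> s = t.
Proof.
move=> rs rt /allP e; apply: symP => i; apply: val_inj; rewrite /= (proj1 (rs i)) (proj1 (rt i)).
by apply/eqP/e; rewrite mem_iota add0n ltn_ord.
Qed.

Lemma rep_exists p : nok p -> exists s, rep s p.
Proof.
move=> /allP okp.
have ok (i : Root) : [&& p.1 i < 17, p.2 i < 17, p.2 (p.1 i) == i & p.1 (p.2 i) == i]%N.
  by apply: okp; rewrite mem_iota add0n ltn_ord.
pose F (i : Root) : Root := inord (p.1 i); pose F' (i : Root) : Root := inord (p.2 i).
have eF i : nat_of_ord (F i) = p.1 i by rewrite inordK //; case/and4P: (ok i).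
have eF' i : nat_of_ord (F' i) = p.2 i by rewrite inordK //; case/and4P: (ok i).
have FK i : F' (F i) = i.
  by apply: val_inj; rewrite /= eF' eF; apply/eqP; case/and4P: (ok i).
have F'K i : F (F' i) = i.
  by apply: val_inj; rewrite /= eF eF'; apply/eqP; case/and4P: (ok i).
by exists (MkSym FK F'K) => i /=; rewrite eF eF'.
Qed.

(** Chosen by [epsilon], hence meaningful only under [nok p]; explicit permutations can thus be
    named without carrying proofs. *)
Definition rsym (p : nsym) : sym_grp Root :=
  epsilon (inhabits gone) (fun s => rep s p).

Lemma rsymP p : nok p -> rep (rsym p) p.
Proof. by move=> /rep_exists/(epsilon_spec (inhabits gone)). Qed.

Lemma rep1 : rep gone (id, id).
Proof. by []. Qed.

Lemma doubled_rsym p k1 k2 h : nok p -> nok k1 -> nok k2 -> nok h ->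
  neq_sym p (ncomm (ncomm k1 k2) h) ->
  neq_sym (ncomm k1 (ncj h (ncomm k1 k2))) (id, id) ->
  neq_sym (ncomm k2 (ncj h (ncomm k1 k2))) (id, id) ->
  neq_sym (nmul (ncomm k1 k2) (ncomm k1 k2)) (id, id) ->
  doubled (rootV (rsym p)).
Proof.
move=> /rsymP rp /rsymP r1 /rsymP r2 /rsymP rh e1 e2 e3 e4.
apply: doubled_hom rootV_hom _; exists (rsym k1), (rsym k2), (rsym h).
have r12 := rep_comm r1 r2; have rv := rep_cj rh r12.
split; [exact: rep_eq rp (rep_comm r12 rh) e1 | exact: rep_eq (rep_comm r1 rv) rep1 e2 |
  exact: rep_eq (rep_comm r2 rv) rep1 e3 | exact: rep_eq (rep_mul r12 r12) rep1 e4].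
Qed.

(** Storing the function as its own inverse is right for disjoint transpositions; [nok] checks each
    use. *)
Definition swaps (s : seq (nat * nat)) : nsym :=
  let f m := foldr (fun ab m => if m == ab.1 then ab.2 else if m == ab.2 then ab.1 else m) m s in
  (f, f).
Definition refl c : nsym := let f m := ((c + 17 - m) %% 17)%N in (f, f).
Definition rot k : nsym := (fun m => (m + k) %% 17, fun m => (m + (17 - k)) %% 17)%N.

(** Bracketing with [k2] turns the two transpositions of [k1] into four, and [h] turns these into
    the eight of the reflection, which fixes only root 0. *)
Lemma doubled_refl0 : doubled (rootV (rsym (refl 0))).
Proof.
by apply: (@doubled_rsym _ (swaps [:: (1, 16); (2, 15)])
  (swaps [:: (1, 3); (16, 14); (2, 4); (15, 13)])
  (swaps [:: (1, 5); (16, 12); (2, 6); (15, 11); (3, 7); (14, 10); (4, 8); (13, 9)]));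
  vm_compute.
Qed.

Lemma doubled_cj (Y : Grp) (x y : Y) : doubled y -> doubled (cj x y).
Proof. exact/doubled_hom/cj_hom. Qed.

Lemma doubled_refl1 : doubled (rootV (rsym (refl 1))).
Proof.
(* 9 is half of 1 modulo 17: rotation by [k] turns the reflection [-m] into [2k - m]. *)
have -> : rsym (refl 1) = cj (rsym (rot 9)) (rsym (refl 0)).
  by apply: rep_eq (rsymP _) (rep_cj (rsymP _) (rsymP _)) _; vm_compute.
by rewrite (hom_cj rootV_hom); apply/doubled_cj/doubled_refl0.
Qed.

Definition rt (k : nat) : Root := inord k.

Lemma rt_inj_uniq (s : seq nat) : uniq s && all (fun k => k < 17)%N s -> uniq (map rt s).
Proof.
case/andP=> us /allP s17; rewrite map_inj_in_uniq // => k l /s17 k17 /s17 l17.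
by move/(congr1 val); rewrite /= !inordK.
Qed.

Lemma rt_val (i : Root) : rt i = i.
Proof. exact: inord_val. Qed.

Definition ok_roots s := uniq s && all (fun k => k < 17)%N s.

Lemma vfar i j k l a b : ok_roots [:: i; j; k; l] ->
  cj (vg (rt i) a (rt j)) (vg (rt k) b (rt l)) = vg (rt k) b (rt l).
Proof. by move=> /rt_inj_uniq u; apply/comm1_cj/(sr_far vg_swap_rel). Qed.

Lemma vmid i j k a : ok_roots [:: i; j; k] ->
  cj (vg (rt i) a (rt k)) (vg (rt k) None (rt j)) = vg (rt i) a (rt j).
Proof. by move=> /rt_inj_uniq u; apply: (sr_mid vg_swap_rel). Qed.

Lemma vleft i j k a : ok_roots [:: i; j; k] ->
  cj (vg (rt i) None (rt k)) (vg (rt k) a (rt j)) = vg (rt i) a (rt j).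
Proof. by move=> /rt_inj_uniq u; apply: (sr_left vg_swap_rel). Qed.

Lemma vnear i j k : ok_roots [:: i; j; k] ->
  cj (vg (rt i) (Some false) (rt j)) (vg (rt i) (Some true) (rt k)) =
  vg (rt i) (Some true) (rt k).
Proof. by move=> /rt_inj_uniq u; apply/comm1_cj/(sr_near vg_swap_rel). Qed.

Lemma vsym i j : vg (rt i) None (rt j) = vg (rt j) None (rt i).
Proof. exact: sr_sym vg_swap_rel _ _. Qed.

Lemma rep_rt s p k : rep s p -> (k < 17)%N -> (s : Root -> Root) (rt k) = rt (p.1 k).
Proof.
by move=> rs k17; rewrite -[LHS]rt_val (proj1 (rs _)) /rt inordK.
Qed.

Lemma vg_root a b : ok_roots [:: a; b] ->
  vg (rt a) None (rt b) = rootV (rsym (swaps [:: (a, b)])).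
Proof.
move=> /[dup] /rt_inj_uniq u; rewrite /ok_roots /= inE !andbT => /and3P[ab a17 b17].
have ba : (b == a) = false by rewrite eq_sym (negPf ab).
have : nok (swaps [:: (a, b)]).
  apply/allP => m; rewrite mem_iota /= add0n => m17.
  case: (eqVneq m a) => [->|ma] /=; first by rewrite ?eqxx ?ba ?eqxx ?a17 ?b17 ?eqxx.
  case: (eqVneq m b) => [->|mb] /=; first by rewrite ?eqxx ?a17 ?b17.
  by rewrite (negPf ma) (negPf mb) m17 eqxx.
move=> /rsymP; set s := rsym _ => rs.
apply: vval_inj; apply: symP => -[h z].
rewrite -[RHS]/((s : Root -> Root) h, z) -[LHS]/(mgen (rt a) None (rt b) (h, z)).
rewrite -(rt_val h) (rep_rt rs) //; move: (nat_of_ord h) (ltn_ord h) => {}h h17 /=.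
case: (eqVneq h a) => [->|ha]; first by rewrite mgen_kNone //; neqs.
case: (eqVneq h b) => [->|hb]; first by rewrite mgen_l //; neqs.
have hh c : h != c -> (c < 17)%N -> rt h != rt c.
  by move=> hc c17; rewrite -val_eqE /= !inordK.
by rewrite mgen_o ?hh.
Qed.

Lemma cjM3 (Y : Grp) (x a b c : Y) : cj x (a ** b ** c) = cj x a ** cj x b ** cj x c.
Proof. by rewrite /cj ?gE. Qed.

Lemma cjM4 (Y : Grp) (x a b c d : Y) :
  cj x (a ** b ** c ** d) = cj x a ** cj x b ** cj x c ** cj x d.
Proof. by rewrite /cj ?gE. Qed.

Definition tau3_base := rootV (rsym (swaps [:: (1, 2); (6, 7); (8, 4); (9, 5)])).

Lemma doubled_tau3_base : doubled tau3_base.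
Proof.
by apply: (@doubled_rsym _ (swaps [:: (1, 2)]) (swaps [:: (1, 6); (2, 7)])
  (swaps [:: (1, 8); (2, 4); (6, 9); (7, 5)])); vm_compute.
Qed.

Lemma tau3_baseE : tau3_base = vg (rt 1) None (rt 2) ** vg (rt 6) None (rt 7) **
  vg (rt 8) None (rt 4) ** vg (rt 9) None (rt 5).
Proof.
rewrite !vg_root // -!rootV_hom; congr rootV.
apply: (@rep_eq _ _ _ _ (rsymP _) (rep_mul (rep_mul (rep_mul (rsymP _) (rsymP _)) (rsymP _)) (rsymP _)));
  by vm_compute.
Qed.

(** [tau3_base] with the two children of root 3 in place of roots 8 and 9. The root swap (1 2) will
    yield 3-cycles; the last two factors connect two levels of the forest. *)
Definition tau3 := vg (rt 1) None (rt 2) ** vg (rt 6) None (rt 7) **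
  vg (rt 3) (Some false) (rt 4) ** vg (rt 3) (Some true) (rt 5).

Lemma doubled_tau3 : doubled tau3.
Proof.
have -> : tau3 = cj (vg (rt 3) (Some false) (rt 8) ** vg (rt 3) (Some true) (rt 9)) tau3_base.
  rewrite tau3_baseE cj_mul !cjM4.
  rewrite !(@vfar 3 9 1 2, @vfar 3 9 6 7, @vfar 3 9 8 4, @vfar 3 8 1 2, @vfar 3 8 6 7) //.
  by rewrite !(@vmid 3 4 8, @vmid 3 5 9) // (@vnear 3 8 5).
exact/doubled_cj/doubled_tau3_base.
Qed.

Definition cyc3 k (b : bool) : nsym :=
  let f m := if m == k then k.+1 else if m == k.+1 then k.+2 else if m == k.+2 then k else m in
  let f' m := if m == k then k.+2 else if m == k.+1 then k else if m == k.+2 then k.+1 else m in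
  if b then (f, f') else (f', f).

(* Sorts the double transposition (4 11)(5 12) by rotations of three consecutive roots. *)
Definition word := [:: (10, true); (9, true); (8, true); (7, true); (6, true); (5, false);
  (6, true); (8, true); (10, true); (4, false); (5, true); (7, true); (9, true)].

Lemma comm_mul_split (Y : Grp) (a b a' b' : Y) : cj b a' = a' -> cj b b' = b' ->
  cj a b' = b' -> comm (a ** b) (a' ** b') = comm a a'.
Proof.
move=> ba' bb' ab'; rewrite -(ginv_comm (a' ** b')).
have -> : comm (a' ** b') (a ** b) = a' ** b' ** ginv (cj (a ** b) (a' ** b')).
  by rewrite /comm /cj ?gE.
rewrite cj_mul !(cjM _ a' b') ba' bb' (cjM _ a' b') ab' /comm /cj ?gE; done.
Qed.

(** * Recovering all swap generators from two reflections and [tau3] *)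

Section Generation.
Variable S : V -> Prop.
Hypotheses (SS : is_subgroup S) (S1 : S (rootV (rsym (refl 0))))
  (S2 : S (rootV (rsym (refl 1)))) (S3 : S tau3).
Let R s := S (rootV s).
Let RS : is_subgroup R.
Proof. exact: (preimage_subgroup rootV_hom SS). Qed.
Let RM s t : R s -> R t -> R (s ** t).
Proof. by case: RS => _ [RM _]; apply: RM. Qed.
Let SJ x y : S x -> S y -> S (cj x y).
Proof. exact: subgroup_cj. Qed.

Let R_rot k : (k < 17)%N -> R (rsym (rot k)).
Proof.
have ok : all (fun k => nok (rot k)) (iota 0 17) by vm_compute.
have step : all (fun k => neq_sym (rot k.+1) (nmul (rot 1) (rot k))) (iota 0 16) by vm_compute.
have okk j : (j < 17)%N -> nok (rot j) by move=> j17; apply: (allP ok); rewrite mem_iota.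
elim: k => [|k IH] k17.
  have -> : rsym (rot 0) = gone by apply: rep_eq (rsymP (okk _ _)) rep1 _.
  by case: RS.
have -> : rsym (rot k.+1) = rsym (rot 1) ** rsym (rot k).
  apply: rep_eq (rsymP (okk _ _)) (rep_mul (rsymP (okk _ _)) (rsymP (okk _ _))) _ => //.
    exact: ltnW.
  by apply: (allP step); rewrite mem_iota.
apply: RM; last by apply: IH; apply: ltnW.
have -> : rsym (rot 1) = rsym (refl 1) ** rsym (refl 0).
  by apply: rep_eq (rsymP _) (rep_mul (rsymP _) (rsymP _)) _; vm_compute.
exact: RM.
Qed.

Let R_refl2 : R (rsym (refl 2)).
Proof.
have -> : rsym (refl 2) = cj (rsym (refl 1)) (rsym (refl 0)).
  by apply: rep_eq (rsymP _) (rep_cj (rsymP _) (rsymP _)) _; vm_compute.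
exact: subgroup_cj.
Qed.

(** The reflection [2 - m] fixes root 1, the only root that [tau3] shares with its conjugate. So
    only (1 2) and (1 0) fail to commute, and their commutator is a 3-cycle. *)
Let R_cyc0 : R (rsym (cyc3 0 true)).
Proof.
have c3 : comm tau3 (cj (rootV (rsym (refl 2))) tau3) = rootV (rsym (cyc3 0 true)).
  have rr := @rsymP (refl 2) isT.
  have -> : cj (rootV (rsym (refl 2))) tau3 = vg (rt 1) None (rt 0) ** (vg (rt 13) None (rt 12) **
      vg (rt 16) (Some false) (rt 15) ** vg (rt 16) (Some true) (rt 14)).
    by rewrite cjM4 !cj_rootV !(rep_rt rr) // -!gmulA.
  have -> : tau3 = vg (rt 1) None (rt 2) ** (vg (rt 6) None (rt 7) **
      vg (rt 3) (Some false) (rt 4) ** vg (rt 3) (Some true) (rt 5)).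
    by rewrite /tau3 -!gmulA.
  rewrite comm_mul_split.
  - rewrite commE (gV vg_swap_rel) (vsym 1 0) vleft // !vg_root // -rootV_hom; congr rootV.
    by apply: rep_eq (rep_mul (rsymP _) (rsymP _)) (rsymP _) _; vm_compute.
  - by rewrite !cj_mul !vfar.
  - by rewrite !cj_mul; do 3! rewrite cjM3 !vfar //.
  - by rewrite cjM3 !vfar.
rewrite /R -c3; apply: subgroup_comm => //; apply: SJ => //.
Qed.

Let R_cyc k b : (k < 15)%N -> R (rsym (cyc3 k b)).
Proof.
have ok : all (fun k => nok (cyc3 k true) && nok (cyc3 k false)) (iota 0 15) by vm_compute.
have okr : all (fun k => nok (rot k)) (iota 0 15) by vm_compute.
have e1 : all (fun k => neq_sym (cyc3 k true) (ncj (rot k) (cyc3 0 true))) (iota 0 15).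
  by vm_compute.
move=> k15; have ki : k \in iota 0 15 by rewrite mem_iota.
have /andP[okt okf] := allP ok _ ki.
have Rt : R (rsym (cyc3 k true)).
  have -> : rsym (cyc3 k true) = cj (rsym (rot k)) (rsym (cyc3 0 true)).
    apply: rep_eq (rsymP okt) (rep_cj (rsymP (allP okr _ ki)) (rsymP _)) _ => //.
    exact: (allP e1).
  by apply: subgroup_cj => //; apply: R_rot; lia.
case: b => //; have -> : rsym (cyc3 k false) = ginv (rsym (cyc3 k true)).
  apply: rep_eq (rsymP okf) (rep_inv (rsymP okt)) _.
  by apply/allP => m _; apply: eqxx.
by case: RS => _ [_]; apply.
Qed.

Let S_double : S (vg (rt 4) None (rt 11) ** vg (rt 5) None (rt 12)).
Proof.
rewrite !vg_root // -rootV_hom -/(R _).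
pose w := foldr (fun kb s => rsym (cyc3 kb.1 kb.2) ** s) gone word.
have -> : rsym (swaps [:: (4, 11)]) ** rsym (swaps [:: (5, 12)]) = w.
  apply: (@rep_eq _ _ _ (foldr (fun kb p => nmul (cyc3 kb.1 kb.2) p) (id, id) word)
    (rep_mul (rsymP _) (rsymP _))); [by vm_compute | by vm_compute | | by vm_compute].
  by rewrite /w /=; do ![apply: rep_mul; first by apply: rsymP; vm_compute]; apply: rep1.
have: all (fun kb => kb.1 < 15)%N word by [].
rewrite /w; elim: word => [|[k b] l IH] /=; first by case: RS.
by case/andP=> k15 /IH; apply: RM; apply: R_cyc.
Qed.

(** [t7] exchanges roots 11 and 12 with the children of root 10, and [tau3] exchanges roots 4 and 5
    with those of root 3. So (4 11)(5 12) becomes the product of the swaps of corresponding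
    children, which is (3 10) by [sr_split]. *)
Let S_e310 : S (vg (rt 3) None (rt 10)).
Proof.
have R7 := R_rot (isT : 7 < 17)%N; set t7 := cj (rootV (rsym (rot 7))) tau3.
have S7 : S t7 by apply: SJ.
have rr := @rsymP (rot 7) isT.
have e7 : t7 = vg (rt 8) None (rt 9) ** vg (rt 13) None (rt 14) **
    vg (rt 10) (Some false) (rt 11) ** vg (rt 10) (Some true) (rt 12).
  by rewrite /t7 cjM4 !cj_rootV !(rep_rt rr).
have -> : vg (rt 3) None (rt 10) =
    cj tau3 (cj t7 (vg (rt 4) None (rt 11) ** vg (rt 5) None (rt 12))).
  rewrite (cjM _ (vg _ _ _)) (vsym 4) (vsym 5) e7 !cj_mul.
  rewrite (@vfar 10 12 11 4) // (@vmid 10 4 11) // (@vmid 10 5 12) // (@vnear 10 11 5) //.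
  rewrite (@vfar 13 14 10 4) // (@vfar 13 14 10 5) // (@vfar 8 9 10 4) // (@vfar 8 9 10 5) //.
  rewrite (cjM _ (vg _ _ _)) (@vfar 3 5 10 4) //.
  rewrite (cjM _ (vg _ _ _)) (cj_cj _ (vg (rt 3) (Some true) _)) vnear // (@vfar 3 4 10 5) //.
  rewrite !(cjM _ (cj _ _)) !(cj_cj (vg (rt 6) _ _)) !(@vfar 6 7 3 _) // !(@vfar 6 7 10 _) //.
  rewrite !(cj_cj (vg (rt 1) _ _)) !(@vfar 1 2 3 _) // !(@vfar 1 2 10 _) //.
  have ne i j : ok_roots [:: i; j] -> rt i != rt j by move=> /rt_inj_uniq; rewrite /= inE andbT.
  have : cj (Ea vg (rt 3, [:: true]) (rt 4)) (Ea vg (rt 10, [:: true]) (rt 4)) =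
         cj (Ea vg (rt 3, [:: true]) (rt 5)) (Ea vg (rt 10, [:: true]) (rt 5)).
    by apply: (Sw_indep vg_swap_rel); rewrite /disj /= ?inE ?negb_or !ne.
  rewrite /Ea !(E1 vg_swap_rel) ?ne // => <-.
  by apply: (sr_split vg_swap_rel); rewrite -[[:: _; _; _]]/(map rt [:: 3; 10; 4]) rt_inj_uniq.
by do !apply: SJ.
Qed.

Let S_rot k i a j : (k < 17)%N -> (i < 17)%N -> (j < 17)%N -> S (vg (rt i) a (rt j)) ->
  S (vg (rt ((i + k) %% 17)) a (rt ((j + k) %% 17))).
Proof.
move=> k17 i17 j17 Sij.
have ok : all (fun k => nok (rot k)) (iota 0 17) by vm_compute.
have /rsymP rr : nok (rot k) by apply: (allP ok); rewrite mem_iota.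
have := SJ (R_rot k17) Sij; by rewrite cj_rootV !(rep_rt rr).
Qed.

Let ord7 m : Root := rt ((3 + 7 * m) %% 17).

(** Rotations of (3 10) join consecutive points of the sequence 3, 10, 17, ... modulo 17, and swaps
    along a path give all swaps between its points. *)
Let S_path m n : (m < n < 17)%N -> S (vg (ord7 m) None (ord7 n)).
Proof.
have S1p p : S (vg (ord7 p) None (ord7 p.+1)).
  have := S_rot (ltn_pmod (7 * p) (isT : 0 < 17)%N) (isT : 3 < 17)%N (isT : 10 < 17)%N S_e310.
  by rewrite !modnDmr /ord7 mulnS (addnA 3) (addnC 3 7).
have inj p q : (p < q < 17)%N -> ord7 p != ord7 q.
  have tab : all (fun p => all (fun q => (3 + 7 * p) %% 17 != (3 + 7 * q) %% 17)%N
      (iota p.+1 (16 - p))) (iota 0 17) by vm_compute.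
  move=> pq; rewrite -val_eqE /= !inordK ?ltn_mod //.
  apply: (allP (allP tab p _) q); rewrite mem_iota; lia.
elim: n m => // n IH m /andP[mn n17]; case: (eqVneq m n) => [->|nmn]; first exact: S1p.
rewrite -(@sr_right _ _ vg_swap_rel _ (ord7 n)).
  by apply: SJ; [apply: S1p | apply: IH; lia].
by rewrite /= !inE !negb_or !inj; lia.
Qed.

Let S_e i j : i != j -> S (vg i None j).
Proof.
have surj (r : Root) : exists m, (m < 17)%N /\ r = ord7 m.
  (* 5 is the inverse of 7, and 14 is -3, modulo 17. *)
  exists ((5 * (r + 14)) %% 17)%N; split; first exact: ltn_pmod.
  have tab : all (fun r => (3 + 7 * ((5 * (r + 14)) %% 17)) %% 17 == r)%N (iota 0 17).
    by vm_compute.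
  rewrite /ord7 (eqP (allP tab r _)) ?rt_val // mem_iota add0n; exact: ltn_ord.
have [m [m17 ->]] := surj i; have [n [n17 ->]] := surj j.
case: (ltngtP m n) => [mn _|nm _|->]; last by rewrite eqxx.
  by apply: S_path; rewrite mn.
by rewrite (sr_sym vg_swap_rel); apply: S_path; rewrite nm.
Qed.

Let S_B : S (vg (rt 3) (Some false) (rt 4) ** vg (rt 3) (Some true) (rt 5)).
Proof.
have -> : vg (rt 3) (Some false) (rt 4) ** vg (rt 3) (Some true) (rt 5) =
    vg (rt 6) None (rt 7) ** (vg (rt 1) None (rt 2) ** tau3).
  rewrite /tau3 -!gmulA (gmulA (vg (rt 1) _ _)) (sr_sq vg_swap_rel) gmul1.
  by rewrite gmulA (sr_sq vg_swap_rel) gmul1.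
have e_ok i j : ok_roots [:: i; j] -> S (vg (rt i) None (rt j)).
  by move=> /rt_inj_uniq; rewrite /= inE andbT; apply: S_e.
by case: (SS) => _ [SM _]; do 2! (apply: (SM); first exact: e_ok).
Qed.

(** The element of [S_B] exchanges roots 4 and 5 with the children of root 3, so it carries (4 10)
    and (5 10) to these generators. *)
Let S_g3 x : S (vg (rt 3) (Some x) (rt 10)).
Proof.
have e_ok i j : ok_roots [:: i; j] -> S (vg (rt i) None (rt j)).
  by move=> /rt_inj_uniq; rewrite /= inE andbT; apply: S_e.
case: x.
- have := SJ S_B (e_ok 5 10 isT); by rewrite cj_mul vmid // vnear.
- have := SJ S_B (e_ok 4 10 isT); by rewrite cj_mul (@vfar 3 5 4 10) // vmid.
Qed.

Lemma tau_generate y : S y.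
Proof.
move: y; apply: generates_subgroup vgen_generates SS _ => -[[i a] j]; rewrite /gen /=.
case: (eqVneq i j) => [->|ij]; first by rewrite (sr_diag vg_swap_rel); case: SS.
case: a => [x|]; last exact: S_e.
have r310 : rt 3 != rt 10 by rewrite -val_eqE /= !inordK.
have gR := vg_swap_rel.
have [p Fp] := @fresh_exists [:: rt 3; rt 10; i; j] isT.
have [q Fq] := @fresh_exists [:: rt 3; rt 10; i; j; p] isT.
rewrite -(@sr_right _ _ gR i q j); last by neqs.
apply: SJ; first by apply: S_e; neqs.
rewrite -(@sr_left _ _ gR i q p); last by neqs.
apply: SJ; first by apply: S_e; neqs.
rewrite -(@sr_right _ _ gR p (rt 10) q); last by neqs.
apply: SJ; first by apply: S_e; neqs.
rewrite -(@sr_left _ _ gR p (rt 10) (rt 3)); last by neqs.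
by apply: SJ => //; apply: S_e; neqs.
Qed.
End Generation.

(** * Four involutions generating the powers *)

(** Pairwise incomparable cones, one for each coordinate; they make the coordinates of the fourth
    involution distinguishable. *)
Definition tau4_addr k : addr := (rt 0, rcons (nseq k true) false).
Definition tau4_base := rootV (rsym (swaps [:: (2, 1); (5, 6); (7, 8); (9, 10)])).
Definition tau4 k := cj (Ea vg (tau4_addr k) (rt 2)) tau4_base.

Lemma doubled_tau4 k : doubled (tau4 k).
Proof.
apply: doubled_cj.
by apply: (@doubled_rsym _ (swaps [:: (2, 1)]) (swaps [:: (2, 5); (1, 6)])
  (swaps [:: (2, 7); (1, 8); (5, 9); (6, 10)])); vm_compute.
Qed.

Lemma tau4_baseE : tau4_base = vg (rt 2) None (rt 1) ** vg (rt 5) None (rt 6) **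
  vg (rt 7) None (rt 8) ** vg (rt 9) None (rt 10).
Proof.
rewrite !vg_root // -!rootV_hom; congr rootV.
by apply: (@rep_eq _ _ _ _ (rsymP _) (rep_mul (rep_mul (rep_mul (rsymP _) (rsymP _)) (rsymP _)) (rsymP _)));
  vm_compute.
Qed.

Lemma far_tau4 i j k al : ok_roots [:: i; j; 5; 6; 7; 8; 9; 10] -> k \in [:: 5; 7; 9] ->
  cj (E vg (rt i) al (rt j)) (vg (rt k) None (rt k.+1)) = vg (rt k) None (rt k.+1).
Proof.
move=> /rt_inj_uniq u kin; apply/cj_fixC/(E_far1 vg_swap_rel).
by move: kin; rewrite !inE => /or3P[] /eqP->; neqs.
Qed.

Lemma tau4E k : tau4 k = Ea vg (tau4_addr k) (rt 1) ** vg (rt 5) None (rt 6) **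
  vg (rt 7) None (rt 8) ** vg (rt 9) None (rt 10).
Proof.
rewrite /tau4 tau4_baseE cjM4 !(@far_tau4 0 2) //.
by rewrite (@Ea_cat _ _ vg_swap_rel _ [::]) ?cats0 // -[[:: _; _; _]]/(map rt [:: 0; 2; 1]) rt_inj_uniq.
Qed.

Lemma tau4_comm_neq k l : k != l ->
  comm (Ea vg (tau4_addr k) (rt 2)) (tau4 l) = gone.
Proof.
move=> kl; rewrite comm1P -cj_fixP tau4E cjM4 !(@far_tau4 0 2) //.
congr (_ ** _ ** _ ** _); apply: (E_near vg_swap_rel).
  by rewrite -[[:: _; _; _]]/(map rt [:: 0; 2; 1]) rt_inj_uniq.
rewrite /incomp /=; elim: k l kl => [|k IH] [|l] //=; exact: IH.
Qed.

Lemma tau4_comm_eq k : comm (Ea vg (tau4_addr k) (rt 2)) (tau4 k) <> gone.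
Proof.
rewrite comm1P -cj_fixP {1}/tau4 -cj_mul (E_sq vg_swap_rel) => e.
have {}e : vg (rt 2) None (rt 1) = Ea vg (tau4_addr k) (rt 1).
  have : tau4_base = tau4 k by rewrite -e /cj ?gE.
  by rewrite tau4_baseE tau4E => /gmul_injr/gmul_injr/gmul_injr.
(* The cone lies below root 0, so its swap with root 1 commutes with (2 3), whereas (2 1) does
   not. *)
have : cj (vg (rt 2) None (rt 3)) (vg (rt 2) None (rt 1)) = vg (rt 2) None (rt 1).
  rewrite e; apply: (E_far1 vg_swap_rel).
  by rewrite -[[:: _; _; _; _]]/(map rt [:: 0; 1; 2; 3]) rt_inj_uniq.
rewrite (vsym 2 3) vleft // => /(congr1 vval) /(congr1 (fun s : sym_grp point => s (rt 2, 0))).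
have r23 : rt 2 != rt 3 by rewrite -val_eqE /= !inordK.
have r13 : rt 1 != rt 3 by rewrite -val_eqE /= !inordK.
have r12 : rt 1 != rt 2 by rewrite -val_eqE /= !inordK.
move=> /=; meval => -[] r; by rewrite r eqxx in r12.
Qed.

Definition tau n (b : 'I_4) : power_grp V n := fun k =>
  match nat_of_ord b with
  | 0 => rootV (rsym (refl 0)) | 1 => rootV (rsym (refl 1)) | 2 => tau3 | _ => tau4 k
  end.

Arguments tau : clear implicits.

(** The first three involutions are constant and generate the diagonal. A commutator of a diagonal
    element with the fourth isolates coordinate [i], and simplicity of [V] under diagonal
    conjugation gives the whole coordinate. *)
Lemma tau_generates n : generates (tau n).
Proof.
apply: generates_of_subgroup => S SS St.
have Sd v : S (@diag V n v).
  move: v; apply: tau_generate; first exact: preimage_subgroup (@diag_hom V n) _ SS.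
  - exact: (St (inord 0)) || (by have := St (@Ordinal 4 0 isT)).
  - by have := St (@Ordinal 4 1 isT).
  - by have := St (@Ordinal 4 2 isT).
move=> x; apply: power_gen => // i; move: (x i) => {x}.
apply: V_simple; first split.
- exact: preimage_subgroup (@single_hom V n i) _ SS.
- by move=> v p Sp; rewrite -(cj_single (@diag V n v)); apply: subgroup_cj.
set g := Ea vg (tau4_addr i) (rt 2); exists (comm g (tau4 i)); split; last exact: tau4_comm_eq.
have -> : single i (comm g (tau4 i)) = comm (@diag V n g) (tau n (@Ordinal 4 3 isT)).
  apply: pw_ext => k; rewrite comm_coord /single; case: (eqVneq k i) => [->|ki] //.
  by rewrite -[RHS]/(comm g (tau4 k)) tau4_comm_neq // eq_sym.
by apply: subgroup_comm.
Qed.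

Lemma doubled_power (G : Grp) n (x : power_grp G n) : (forall k, doubled (x k)) -> doubled x.
Proof.
move=> dx; have /choice[f1 f1P] := dx; have /choice[f2 f2P] := f1P; have /choice[f3 f3P] := f2P.
by exists f1, f2, f3; split; apply: pw_ext => k; case: (f3P k).
Qed.

Lemma doubled_tau n b : doubled (tau n b).
Proof.
apply: doubled_power => k; rewrite /tau; case: (nat_of_ord b) => [|[|[|_]]].
- exact: doubled_refl0.
- exact: doubled_refl1.
- exact: doubled_tau3.
- exact: doubled_tau4.
Qed.

(** * Finite presentations modulo the centre *)

(* [B] is, modulo the centre, presented by finitely many relators on the generators [s],
   strongly enough to exclude finite quotients. *)
Definition presented_mod_center (I : Type) (B : Grp) (s : I -> B) :=
  exists (J : finType) (R : J -> term I), (forall j, ev s (R j) = gone) /\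
    forall (Y : Grp) (r : I -> Y), generates r -> (forall j, ev r (R j) = gone) ->
      (forall t, ev s t = gone -> central (ev r t)) /\ (fin Y -> forall y : Y, y = gone).

(** A Tietze transformation: the translated relators, together with one relator equating each new
    generator with its expression through the old ones. *)
Lemma presented_change (I : Type) (I' : finType) (B : Grp) (s : I -> B) (s' : I' -> B) :
  generates s -> generates s' -> presented_mod_center s -> presented_mod_center s'.
Proof.
move=> sG s'G [J [R [sR RP]]].
have [u uP] := choice _ (fun i => s'G (s i)); have [v vP] := choice _ (fun i => sG (s' i)).
have us t : ev s' (tsub u t) = ev s t by rewrite ev_tsub; apply: eq_ev.
exists (J + I')%type, (fun j => match j with
  | inl j => tsub u (R j)
  | inr i => Mul (tsub u (v i)) (Inv (Var i)) end); split=> [[j|i]|Y r' r'G r'R].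
- by rewrite us.
- by rewrite /= us vP gmulrV.
pose r i := ev r' (u i).
have rv i : ev r (v i) = r' i.
  have := r'R (inr i); rewrite /= ev_tsub -/r => /ginv_eq/(congr1 (@ginv Y)).
  by rewrite !ginvK => ->.
have rv' t : ev r (tsub v t) = ev r' t by rewrite ev_tsub; apply: eq_ev.
have [||r1 r2] := RP Y r.
- by move=> y; have [t <-] := r'G y; exists (tsub v t).
- by move=> j; have := r'R (inl j); rewrite /= ev_tsub.
split=> // t t1; rewrite -rv'; apply: r1; rewrite ev_tsub -t1.
by apply: eq_ev.
Qed.

(** The coordinate subgroups of [Y] commute but may overlap. A word acts by conjugation on the
    [k]-th one as its [k]-th projection does, and that projection is central there if the word is
    trivial in the power. *)
Lemma presented_power (I : finType) (B : Grp) (s : I -> B) n : generates s ->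
  presented_mod_center s ->
  presented_mod_center (fun ik : I * 'I_n => single ik.2 (s ik.1)).
Proof.
move=> sG [J [R [sR RP]]].
pose cp k : term I -> term (I * 'I_n) := tsub (fun i => Var (i, k)).
exists ((J * 'I_n) + ((I * 'I_n) * (I * 'I_n)))%type, (fun j => match j with
  | inl (j, k) => cp k (R j)
  | inr ((i, k), (i', k')) => if k == k' then One else tcomm (Var (i, k)) (Var (i', k')) end).
split=> [[[j k]|[[i k] [i' k']]]|Y r rG rR].
- rewrite ev_tsub /= -(ev_hom s _ (@single_hom B n k)) sR; exact: (hom1 (@single_hom B n k)).
- case: (eqVneq k k') => // kk'; apply: (proj2 (comm1P (single k (s i)) (single k' (s i')))).
  by rewrite -cj_fixP cj_single single_neq ?(central_cj _ (@central1 _)) // eq_sym.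
pose rk k i := r (i, k).
have rkR k j : ev (rk k) (R j) = gone by have := rR (inl (j, k)); rewrite /= ev_tsub.
have comm_r i k i' k' : k != k' -> r (i, k) ** r (i', k') = r (i', k') ** r (i, k).
  by move=> kk'; have := rR (inr ((i, k), (i', k'))); rewrite /= (negPf kk') => /comm1P.
pose Yk k := gen_grp (rk k).
have [Yk_central Yk_fin] : (forall k t, ev s t = gone -> central (ev (gen_gen (rk k)) t)) /\
    (forall k, fin (Yk k) -> forall y : Yk k, y = gone).
  split=> k; have [|P1 P2] := RP (Yk k) (gen_gen (rk k)) (@generates_gen _ _ _).
  + by move=> j; apply: sval_grp_inj; rewrite sval_ev rkR.
  + exact: P1.
  + by move=> j; apply: sval_grp_inj; rewrite sval_ev rkR.
  + exact: P2.
split; last first.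
  move=> finY; apply: generates_subgroup rG (proj1 (trivial_normal Y)) _ => -[i k].
  have := Yk_fin k (fin_sub _ finY) (gen_gen (rk k) i); exact: (congr1 (@sval_grp _ _ _)).
move=> w w1.
pose pk k : term (I * 'I_n) -> term I := tsub (fun ik => if ik.2 == k then Var ik.1 else One).
have pk_tau k : ev s (pk k w) = gone.
  have <- : coord k (ev (fun ik : I * 'I_n => single ik.2 (s ik.1)) w) = gone by rewrite w1.
  rewrite (ev_hom _ _ (@coord_hom B n k)).
  rewrite ev_tsub; apply: eq_ev => -[i k'] /=; rewrite /coord /single eq_sym.
  by case: eqP.
have cjw k t a : cj (ev r t) (ev (rk k) a) = cj (ev (rk k) (pk k t)) (ev (rk k) a).
  elim: t a => [[i k']||t1 IH1 t2 IH2|t1 IH1] a //=.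
  - rewrite /pk /=; case: (eqVneq k' k) => [->//|kk'] /=; rewrite (central_cj _ (@central1 _)).
    apply/cj_fixP; apply: (@ev_subgroup _ _ _ (fun y => r (i, k') ** y = y ** r (i, k'))).
      by split; [rewrite ?gE | split=> [x y|x]; [apply: commute_mul | apply: commute_inv]].
    by move=> j; apply: comm_r.
  - by rewrite !cj_mul (IH2 a) -[cj (ev (rk k) (pk k t2)) _]/(ev (rk k) (tcj (pk k t2) a)) IH1.
  - set X := ev (rk k) (pk k t1); set A := ev (rk k) a.
    have e : cj (ev r t1) (cj (ginv X) A) = A.
      by rewrite -[RHS](cjVK X); apply: (IH1 (tcj (Inv (pk k t1)) a)).
    by rewrite -{1}e cjK.
apply: commute_generates rG _ => -[i k]; apply/cj_fixP.
rewrite -[r (i, k)]/(ev (rk k) (Var i)) cjw; apply/cj_fixP.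
have := Yk_central k _ (pk_tau k) (gen_gen (rk k) i) => /(congr1 (@sval_grp _ _ _)).
by rewrite -!(@sval_ev _ _ (rk k)).
Qed.

Definition teq I (a b : term I) := Mul a (Inv b).

Lemma ev_teq I (Y : Grp) (r : I -> Y) a b : ev r (teq a b) = gone <-> ev r a = ev r b.
Proof.
split=> /= [e|->]; last by rewrite gmulrV.
by apply: (@gmul_injr _ (ginv (ev r b))); rewrite e gmulrV.
Qed.

(** The number in ['I_9] selects a field of [swap_rel]. All fields share one parameter type, and
    instances violating distinctness become [One]. *)
Definition swap_index := ('I_9 * (Root * Root * Root * Root) * (option bool * option bool))%type.

Definition swap_relator (x : swap_index) : term label :=
  let: (c, (i, j, k, l), (a, b)) := x in
  let v i a j := Var (i, a, j) in
  let guard (b : bool) (t : term label) := if b then t else One in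
  match nat_of_ord c with
  | 0 => v i a i
  | 1 => Mul (v i a j) (v i a j)
  | 2 => teq (v i None j) (v j None i)
  | 3 => guard (uniq [:: i; j; k; l]) (tcomm (v i a j) (v k b l))
  | 4 => guard (uniq [:: i; j; k]) (teq (tcj (v i None k) (v k b j)) (v i b j))
  | 5 => guard (uniq [:: i; j; k]) (teq (tcj (v j None k) (v i a j)) (v i a k))
  | 6 => guard (uniq [:: i; j; k]) (teq (tcj (v i a k) (v k None j)) (v i a j))
  | 7 => guard (uniq [:: i; j; k]) (tcomm (v i (Some false) j) (v i (Some true) k))
  | _ => guard (uniq [:: i; j; k]) (teq (v i None j)
           (Mul (tcj (v i (Some false) k) (v j (Some false) k))
                (tcj (v i (Some true) k) (v j (Some true) k))))
  end.

Lemma swap_relatorP (Y : Grp) (r : label -> Y) :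
  (forall x, ev r (swap_relator x) = gone) <-> swap_rel (fun i a j => r (i, a, j)).
Proof.
split=> [H|gR].
  have Hc c (c9 : (c < 9)%N) i j k l a b := H (Ordinal c9, (i, j, k, l), (a, b)).
  split.
  - by move=> i a; have := Hc 0 isT i i i i a a.
  - by move=> i a j; have := Hc 1 isT i j i i a a.
  - by move=> i j; have /ev_teq := Hc 2 isT i j i i None None.
  - by move=> i j k l a b u; have := Hc 3 isT i j k l a b; rewrite /swap_relator u.
  - by move=> i j k b u; have := Hc 4 isT i j k k b b; rewrite /swap_relator u => /ev_teq.
  - by move=> i j k b u; have := Hc 5 isT i j k k b b; rewrite /swap_relator u => /ev_teq.
  - by move=> i j k b u; have := Hc 6 isT i j k k b b; rewrite /swap_relator u => /ev_teq.
  - by move=> i j k u; have := Hc 7 isT i j k k None None; rewrite /swap_relator u.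
  - by move=> i j k u; have := Hc 8 isT i j k k None None; rewrite /swap_relator u => /ev_teq.
case: gR => R1 R2 R3 R4 R5 R6 R7 R8 R9 [[c [[[i j] k] l]] [a b]]; rewrite /swap_relator.
case: (nat_of_ord c) => [|[|[|[|[|[|[|[|_]]]]]]]]; try case: ifP => // u.
- exact: R1.
- exact: R2.
- exact/ev_teq/R3.
- exact: R4.
- exact/ev_teq/R5.
- exact/ev_teq/R6.
- exact/ev_teq/R7.
- exact: R8.
- exact/ev_teq/R9.
Qed.

Lemma V_presented : presented_mod_center (gen vg).
Proof.
exists swap_index, swap_relator; split; first by apply/swap_relatorP; exact: vg_swap_rel.
move=> Y r rG /swap_relatorP; set g := fun i a j => r (i, a, j) => gR.
have er : r = gen g by apply: functional_extensionality => -[[i a] j].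
split=> [t t1|finY y].
  rewrite er; apply: ev_central gR _ _; first by rewrite -er.
  have := congr1 vval t1; rewrite (ev_hom _ _ vval_hom) => e.
  rewrite -[RHS]e; apply: eq_ev => x; by rewrite gen_vg.
move: y; apply: generates_subgroup rG (proj1 (trivial_normal Y)) _ => t; rewrite er.
exact: swap_fin_trivial.
Qed.

Lemma tau_presented n : presented_mod_center (tau n).
Proof.
apply: presented_change (@tau_generates n) (presented_power n vgen_generates V_presented).
apply: generates_of_subgroup => S SS Ss x; apply: power_gen => // k; move: (x k) => {x}.
apply: generates_subgroup vgen_generates _ _.
  exact: (preimage_subgroup (@single_hom V n k)).
by move=> i; apply: (Ss (i, k)).
Qed.

(** * Fibre products *)

Definition no_finite_quotient (P : Grp) (N : P -> Prop) := forall (F : Grp) (f : P -> F),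
  fin F -> is_hom f -> (forall n, N n -> f n = gone) -> forall p, f p = gone.

Definition is_quotient (P : Grp) (N : P -> Prop) (X : Grp) (q : P -> X) :=
  [/\ is_hom q, surjective_fun q & forall p, q p = gone <-> N p].

Definition central_ext_split (X : Grp) := forall (E : Grp) (f : E -> X),
  is_hom f -> surjective_fun f -> (forall z, f z = gone -> central z) ->
  exists s : X -> E, is_hom s /\ forall x, f (s x) = x.

(** [f] maps into the normalizer of [M], whose quotient by [M] is finite; the induced map kills [N],
    hence everything. *)
Lemma nfq_normalized (P : Grp) (N : P -> Prop) (F : Grp) (f : P -> F) (M : F -> Prop) :
  no_finite_quotient N -> fin F -> is_hom f -> is_subgroup M ->
  (forall p x, M x -> M (cj (f p) x)) -> (forall n, N n -> M (f n)) -> forall p, M (f p).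
Proof.
move=> nfq finF fM MS MJ Mn p.
pose T g := forall x, M x <-> M (cj g x).
have TS : is_subgroup T.
  split; first by move=> x; rewrite (central_cj _ (@central1 _)).
  split=> [g h Tg Th x|g Tg x]; first by rewrite cj_mul (Th x) (Tg (cj h x)).
  by rewrite (Tg (cj (ginv g) x)) cjVK.
have Tf p' : T (f p').
  move=> x; split; first exact: MJ.
  by move/(MJ (ginv p')); rewrite (homV fM) cjK.
have TM g : M g -> T g.
  move=> Mg x; split; first exact: subgroup_cj.
  by move=> Mx; rewrite -(cjK g x); apply: subgroup_cj => //; apply: (proj2 (proj2 MS)).
pose MT (x : sub_grp TS) := M (sval_grp x).
have nMT : is_normal MT.
  split; first exact: (preimage_subgroup (@sval_hom _ _ TS)).
  by move=> g x; rewrite /MT (hom_cj (@sval_hom _ _ TS)) -(sval_grpP g _).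
have [Q [q [qM [qS qK]]]] := quotient_exists nMT.
pose f' p := Sub_grp TS (Tf p).
have f'M : is_hom f' by apply: corestrict_hom.
have := nfq Q (fun p => q (f' p)) (fin_surj qS (fin_sub _ finF)) (hom_comp f'M qM) _ p.
by rewrite qK; apply=> n Nn; rewrite qK; apply: Mn.
Qed.

(** * Extending a homomorphism from [N] to [P] by a split central extension *)

Section Extension.
Variables (P : Grp) (N : P -> Prop) (X : Grp) (q : P -> X).
Hypotheses (nN : is_normal N) (qX : is_quotient N q) (spl : central_ext_split X).
(** These model a homomorphism on the fibre product, restricted to the diagonal and to the copies of
    [N] in the two linked coordinates; so [b] and [c] are constrained on [N] only. *)
Variables (F : Grp) (a b c : P -> F).
Hypotheses (aM : is_hom a)
  (bM : forall n m, N n -> N m -> b (n ** m) = b n ** b m)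
  (cM : forall n m, N n -> N m -> c (n ** m) = c n ** c m)
  (bc : forall n m, N n -> N m -> b n ** c m = c m ** b n)
  (acb : forall n, N n -> a n = c n ** b n)
  (abJ : forall p n, N n -> cj (a p) (b n) = b (cj p n))
  (aCB : forall p, exists n m, [/\ N n, N m & a p = c n ** b m]).

Let N1 : N gone. Proof. by case: nN => [[]]. Qed.
Let NM n m : N n -> N m -> N (n ** m). Proof. by case: nN => [[_ [NM _]] _]; apply: NM. Qed.
Let NV n : N n -> N (ginv n). Proof. by case: nN => [[_ [_ NV]] _]; apply: NV. Qed.
Let NJ p n : N n -> N (cj p n). Proof. by case: nN => [_ NJ]; apply: NJ. Qed.

Let b1 : b gone = gone.
Proof. by apply: (@gmul_injl _ (b gone)); rewrite -bM // ?gE. Qed.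
Let c1 : c gone = gone.
Proof. by apply: (@gmul_injl _ (c gone)); rewrite -cM // ?gE. Qed.
Let bV n : N n -> b (ginv n) = ginv (b n).
Proof. by move=> Nn; apply: ginv_eq; rewrite -bM ?gmulrV //; apply: NV. Qed.
Let cV n : N n -> c (ginv n) = ginv (c n).
Proof. by move=> Nn; apply: ginv_eq; rewrite -cM ?gmulrV //; apply: NV. Qed.

(** With [B] and [C] the images of [N] under [b] and [c]: the pairs [(p, x)] with [x] in [B] and
    [a p] in [C x]. *)
Let ES (px : prod_grp P F) : Prop :=
  exists n m, [/\ N n, N m, px.2 = b n & a px.1 = c m ** px.2].

Let ES_sub : is_subgroup ES.
Proof.
split; first by exists gone, gone; rewrite /= b1 c1 (hom1 aM) gmul1.
split=> [[p x] [p' x'] [n [m [/= Nn Nm -> ap]]] [n' [m' [/= Nn' Nm' -> ap']]]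
        |[p x] [n [m [/= Nn Nm -> ap]]]].
- exists (n ** n'), (m ** m'); rewrite /= bM // cM // aM ap ap'; split; auto.
  by rewrite -!gmulA (gmulA (b n)) bc // !gmulA.
- exists (ginv n), (ginv m); rewrite /= bV // cV // (homV aM) ap ginvM; split; auto.
  by rewrite -bV // -cV // bc //; apply: NV.
Qed.

Let cj_b p x n : ES (p, x) -> N n -> cj x (b n) = b (cj p n).
Proof.
move=> [k [m [/= Nk Nm -> ap]]] Nn.
have -> : b k = ginv (c m) ** a p by rewrite ap ?gE.
rewrite cj_mul abJ // -cV //; apply/cj_fixP; rewrite bc //; [exact: NJ | exact: NV].
Qed.

(* Pulling back along [P -> F / C] gives a central extension of [P / N] whose splitting
   is the required extension of [b]. *)
Lemma extend_hom : exists r : P -> F, [/\ is_hom r, forall n, N n -> r n = b n &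
  forall p, exists n, N n /\ r p = b n].
Proof.
case: qX => qM qS qK.
pose E := sub_grp ES_sub; pose e1 (e : E) : P := (sval_grp e).1; pose e2 (e : E) : F := (sval_grp e).2.
have e1M : is_hom e1 by [].
have e2M : is_hom e2 by [].
have ext (e e' : E) : e1 e = e1 e' -> e2 e = e2 e' -> e = e'.
  move=> h1 h2; apply: sval_grp_inj; move: h1 h2; rewrite /e1 /e2.
  by case: (sval_grp e) (sval_grp e') => [u v] [u' v'] /= -> ->.
(* The graph of [b], a normal copy of [N] in [E]. *)
pose Nh (e : E) := N (e1 e) /\ e2 e = b (e1 e).
have eES (e : E) : ES (e1 e, e2 e) by have := sval_grpP e; rewrite -surjective_pairing.
have nNh : is_normal Nh.
  split; [split; [|split]|].
  - by split=> //; rewrite (hom1 e2M) (hom1 e1M) b1.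
  - by move=> x y [Nx ex] [Ny ey]; split; rewrite ?e1M ?e2M ?bM ?ex ?ey //; apply: NM.
  - by move=> x [Nx ex]; split; rewrite ?(homV e1M) ?(homV e2M) ?bV ?ex //; apply: NV.
  - move=> g x [Nx ex]; rewrite /Nh (hom_cj e1M) (hom_cj e2M) ex (cj_b (eES g)) //.
    by split=> //; apply: NJ.
have [E0 [qE [qEM [qES qEK]]]] := quotient_exists nNh.
have inE p x (h : ES (p, x)) : exists e : E, e1 e = p /\ e2 e = x.
  by exists (Sub_grp ES_sub h).
have bE n : N n -> exists e : E, [/\ e1 e = n, e2 e = b n & Nh e].
  move=> Nn; have [|e [en eb]] := inE n (b n); last by exists e; split; rewrite /Nh ?en.
  by exists n, n; split=> //=; apply: acb.
have [pi [piM piE]] : exists f' : E0 -> X, is_hom f' /\ forall e, f' (qE e) = q (e1 e).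
  apply: (hom_factor (f := fun e => q (e1 e))) qEM qES (hom_comp e1M qM) _.
  by move=> e /qEK[Ne _]; apply/qK.
have piS : surjective_fun pi.
  move=> x; have [p <-] := qS x; have [n [m [Nn Nm ap]]] := aCB p.
  have [|e [ep _]] := inE p (b m); last by exists (qE e); rewrite piE ep.
  by exists m, n.
have piC z : pi z = gone -> central z.
  have [e <-] := qES z; rewrite piE => /qK Ne z'; have [e' <-] := qES z'.
  apply/comm1P; rewrite -(hom_comm qEM); apply/qEK.
  have [k' [m' [/= Nk' Nm' xe' ae']]] := eES e'.
  have [k [m [/= Nk Nm xe ae]]] := eES e.
  rewrite /Nh (hom_comm e1M) (hom_comm e2M) commE; split.
    by apply: NM => //; apply: NJ; apply: NV.
  rewrite bM //; last by apply: NJ; apply: NV.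
  (* Over [N], an element of [E] differs from the graph of [b] by a value [w] of [c], which commutes
     with all values of [b]. *)
  have zx : e2 e = (c (ginv m ** e1 e)) ** b (e1 e).
    have NVm := NV Nm; by rewrite cM // cV // -gmulA -acb // ae gmulVK.
  set w := c _ in zx; have wB n : N n -> w ** b n = b n ** w.
    by move=> Nn; rewrite bc //; apply: NM => //; apply: NV.
  rewrite -(cj_b (eES e')); last exact: NV.
  by rewrite bV // zx comm_commutel ?commE // ?xe' wB.
have [s [sM sK]] := spl piM piS piC.
(* The class [s (q p)] contains exactly one pair over [p]; its second component is the value of the
   extension. *)
have r_ex p : exists e : E, e1 e = p /\ qE e = s (q p).
  have [e eq] := qES (s (q p)).
  have Nn : N (ginv (e1 e) ** p).
    by apply/qK; rewrite qM (homV qM) -piE eq sK gmulV.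
  have [e' [e'n e'b Ne']] := bE _ Nn; exists (e ** e'); rewrite e1M e'n gmulKV; split=> //.
  by rewrite qEM eq; have /qEK-> := Ne'; rewrite gmulr1.
have [re reP] := choice _ r_ex.
have uniq_e e e' : e1 e = e1 e' -> qE e = qE e' -> e = e'.
  move=> ee qq; have /qEK[_ eb] : qE (ginv e ** e') = gone by rewrite qEM (homV qEM) qq gmulV.
  have ee' : e1 (ginv e ** e') = gone by rewrite e1M (homV e1M) ee gmulV.
  apply: (@gmul_injl _ (ginv e)); rewrite gmulV; symmetry; apply: ext.
    by rewrite ee' (hom1 e1M).
  by rewrite eb ee' b1 (hom1 e2M).
have reM x y : re (x ** y) = re x ** re y.
  have [[exy qxy] [ex qx] [ey qy]] := And3 (reP (x ** y)) (reP x) (reP y).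
  by apply: uniq_e; rewrite ?e1M ?qEM ?exy ?ex ?ey // qxy qx qy qM sM.
exists (fun p => e2 (re p)); split.
- by move=> x y; rewrite reM.
- move=> n Nn; have [e [en eb Ne]] := bE n Nn; have [ren qn] := reP n.
  suff -> : re n = e by [].
  apply: uniq_e; rewrite ?ren ?en // qn; have /qEK-> := Ne.
  by have /qK-> := Nn; rewrite (hom1 sM).
- by move=> p; have [n [m [/= Nn _ e _]]] := eES (re p); exists n.
Qed.
End Extension.

Definition normal_fg (P : Grp) (N : P -> Prop) := exists R : list P,
  (forall r, In r R -> N r) /\
  forall M : P -> Prop, is_normal M -> (forall r, In r R -> M r) -> forall n, N n -> M n.

Section FibreProduct.
Variables (P : Grp) (d : nat) (i0 i1 : 'I_d).
Hypothesis i01 : i0 != i1.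
Local Notation Pd := (power_grp P d).

Definition fib (N : P -> Prop) (x : Pd) : Prop := N (ginv (x i0) ** x i1).

Lemma fib_subgroup N : is_normal N -> is_subgroup (fib N).
Proof.
move=> [[N1 [NM NV]] NJ]; rewrite /fib; split; first by rewrite gmulV.
split=> [x y Nx Ny|x Nx].
- have -> : ginv ((x ** y) i0) ** (x ** y) i1 =
      cj (ginv (y i0)) (ginv (x i0) ** x i1) ** (ginv (y i0) ** y i1).
    by rewrite -[(x ** y) i0]/(x i0 ** y i0) -[(x ** y) i1]/(x i1 ** y i1) /cj ?gE.
  by apply: NM => //; apply: NJ.
- have -> : ginv (ginv x i0) ** ginv x i1 = cj (x i0) (ginv (ginv (x i0) ** x i1)).
    by rewrite -[ginv x i0]/(ginv (x i0)) -[ginv x i1]/(ginv (x i1)) /cj ?gE.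
  by apply: NJ; apply: NV.
Qed.

Definition dg p : Pd := fun i => if (i == i0) || (i == i1) then p else gone.
Definition rest (x : Pd) : Pd := fun i => if (i == i0) || (i == i1) then gone else x i.

Lemma dg_hom : is_hom dg.
Proof. by move=> p q; apply: pw_ext => i; rewrite -[RHS]/(dg p i ** dg q i) /dg; case: ifP; rewrite ?gE. Qed.

Lemma rest_hom : is_hom rest.
Proof. by move=> x y; apply: pw_ext => i; rewrite -[RHS]/(rest x i ** rest y i) /rest; case: ifP; rewrite ?gE. Qed.

Lemma fib_decomp (x : Pd) : x = dg (x i0) ** single i1 (ginv (x i0) ** x i1) ** rest x.
Proof.
apply: pw_ext => i; rewrite -[RHS]/(dg (x i0) i ** single i1 (ginv (x i0) ** x i1) i ** rest x i).
rewrite /dg /single /rest; case: (eqVneq i i0) => [->|ni0] /=.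
  by rewrite (negPf i01) !gmulr1.
by case: (eqVneq i i1) => [->|ni1]; rewrite ?gE.
Qed.

Section OneN.
Variable N : P -> Prop.
Hypothesis nN : is_normal N.
Let FS := fib_subgroup nN.
Definition fibre : Grp := sub_grp FS.
Definition fval (h : fibre) : Pd := sval_grp h.

Lemma fval_inj : injective fval. Proof. exact: sval_grp_inj. Qed.
Lemma fvalP h : fib N (fval h). Proof. exact: sval_grpP. Qed.

Let N1 : N gone. Proof. by case: nN => [[]]. Qed.

Lemma fib_dg p : fib N (dg p).
Proof. by rewrite /fib /dg !eqxx orbT gmulV. Qed.

Lemma fib_rest x : fib N (rest x).
Proof. by rewrite /fib /rest !eqxx orbT gmulV. Qed.

Lemma fib_single1 n : N n -> fib N (single i1 n).
Proof. by rewrite /fib singleE single_neq // ?gE. Qed.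

Lemma fib_single0 n : N n -> fib N (single i0 n).
Proof.
rewrite /fib singleE single_neq 1?eq_sym // gmulr1; case: nN => [[_ [_ NV]] _]; exact: NV.
Qed.

Lemma fib_single i p : i != i0 -> i != i1 -> fib N (single i p).
Proof. by move=> n0 n1; rewrite /fib !single_neq 1?eq_sym // gmulV. Qed.

Lemma fib_ind (S : Pd -> Prop) : is_subgroup S ->
  (forall p, S (dg p)) -> (forall n, N n -> S (single i1 n)) ->
  (forall i p, i != i0 -> i != i1 -> S (single i p)) -> forall x, fib N x -> S x.
Proof.
move=> SS Sd Sn Ss x fx; case: (SS) => S1 [SM _]; rewrite (fib_decomp x).
apply: (SM); first by apply: SM => //; apply: Sn.
apply: power_gen => // i; rewrite /rest; case: (eqVneq i i0) => [->|n0] /=.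
  by rewrite (hom1 (single_hom i0)).
case: (eqVneq i i1) => [->|n1] /=; last exact: Ss.
by rewrite (hom1 (single_hom i1)).
Qed.

(** Conjugating the normal generators of [N], placed in coordinate [i1], by the elements [dg p]
    produces all of [N] there. *)
Lemma fibre_fg : finitely_generated P -> normal_fg N -> finitely_generated fibre.
Proof.
move=> [s sP] [R [RN RP]].
pose toF (x : Pd) : fibre :=
  match excluded_middle_informative (fib N x) with left h => Sub_grp FS h | right _ => gone end.
have toFE x (h : fib N x) : toF x = Sub_grp FS h.
  rewrite /toF; case: excluded_middle_informative => // h'.
  exact: sval_grp_inj.
pose L := (List.map dg s ++ List.map (single i1) R ++
  flat_map (fun i => List.map (single i) s) (enum 'I_d))%list.
exists (List.map toF L) => S SS SL.
pose T (x : Pd) := exists h : fib N x, S (Sub_grp FS h).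
have TL x : fib N x -> In x L -> T x.
  by move=> fx xL; exists fx; rewrite -toFE; apply: SL; apply: in_map.
have TS : is_subgroup T.
  case: SS => S1 [SM SV]; case: (FS) => F1 [FM FV]; split.
    by exists F1; rewrite (_ : Sub_grp FS F1 = gone) //; apply: sval_grp_inj.
  split=> [x y [fx Sx] [fy Sy]|x [fx Sx]].
  - exists (FM _ _ fx fy); rewrite (_ : Sub_grp FS _ = Sub_grp FS fx ** Sub_grp FS fy).
      exact: SM.
    exact: sval_grp_inj.
  - exists (FV _ fx); rewrite (_ : Sub_grp FS _ = ginv (Sub_grp FS fx)); first exact: SV.
    exact: sval_grp_inj.
have Tdg p : T (dg p).
  apply: (sP (fun p => T (dg p))); first exact: (preimage_subgroup dg_hom).
  move=> x xs; apply: TL; first exact: fib_dg.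
  by apply/in_or_app; left; apply: in_map.
have Tn n : N n -> T (single i1 n).
  move: n; apply: (RP (fun n => T (single i1 n))).
    split; first exact: (preimage_subgroup (single_hom i1)).
    move=> g n Tn; have := subgroup_cj TS (Tdg g) Tn.
    by rewrite cj_single /dg eqxx orbT.
  move=> r rR; apply: TL; first exact/fib_single1/RN.
  by apply/in_or_app; right; apply/in_or_app; left; apply: in_map.
have Ts i p : i != i0 -> i != i1 -> T (single i p).
  move=> n0 n1; apply: (sP (fun p => T (single i p))).
    exact: (preimage_subgroup (single_hom i)).
  move=> x xs; apply: TL; first exact: fib_single.
  apply/in_or_app; right; apply/in_or_app; right; apply/in_flat_map; exists i.
  split; last exact: in_map.
  by elim: (enum 'I_d) (mem_enum 'I_d i) => // k r IH; rewrite inE => /orP[/eqP->|/IH]; [left | right].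
move=> g; have [h Sh] := fib_ind TS Tdg Tn Ts (sval_grpP g).
by rewrite (_ : g = Sub_grp FS h) //; apply: sval_grp_inj.
Qed.

Lemma fibre_rf : residually_finite P -> residually_finite fibre.
Proof.
move=> rfP g g1.
have [i gi] : exists i, sval_grp g i <> gone.
  apply: NNPP => ni; apply: g1; apply: sval_grp_inj; apply: pw_ext => i.
  by apply: NNPP => h; apply: ni; exists i.
have [F [phi [finF [phiM phig]]]] := rfP _ gi.
exists F, (fun g : fibre => phi (sval_grp g i)); split=> //; split=> // x y.
exact: phiM.
Qed.

Variables (X : Grp) (q : P -> X).
Hypotheses (qX : is_quotient N q) (spl : central_ext_split X) (nfq : no_finite_quotient N).

(** By [nfq_normalized] the image of coordinate [i1] equals that of its subgroup [N], so [f] stays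
    surjective on the fibre product. *)
Lemma fibre_quotient_of_power (F : Grp) : fin F ->
  (exists f : Pd -> F, is_hom f /\ surjective_fun f) ->
  exists f : fibre -> F, is_hom f /\ surjective_fun f.
Proof.
move=> finF [f [fM fS]]; exists (fun g => f (sval_grp g)); split; first by move=> x y; rewrite -fM.
move=> y; have [x <-] := fS y.
have [n [Nn fn]] : exists n, N n /\ f (single i1 (ginv (x i0) ** x i1)) = f (single i1 n).
  have f1M : is_hom (fun p => f (single i1 p)) := hom_comp (single_hom i1) fM.
  have := nfq_normalized (M := fun z => exists n, N n /\ f (single i1 n) = z) nfq finF f1M.
  move=> /(_ _ _ _ (ginv (x i0) ** x i1)); case.
  - exact: (image_subgroup f1M (proj1 nN)).
  - move=> p _ [n [Nn <-]]; exists (cj p n); split; first exact: (proj2 nN).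
    exact: (hom_cj f1M).
  - by move=> n Nn; exists n.
  by move=> n [Nn e]; exists n.
have h : fib N (dg (x i0) ** single i1 n ** rest x).
  case: (FS) => _ [FM _]; apply: (FM); last exact: fib_rest.
  by apply: FM; [apply: fib_dg | apply: fib_single1].
by exists (Sub_grp FS h); rewrite /= !fM -fn -!fM -fib_decomp.
Qed.

(** The restrictions to both copies of [N] extend to [P] by [extend_hom] without enlarging their
    images. These commute with each other and with the image of the other coordinates, so the pieces
    multiply to a homomorphism. *)
Lemma power_quotient_of_fibre (F : Grp) : fin F ->
  (exists f : fibre -> F, is_hom f /\ surjective_fun f) ->
  exists f : Pd -> F, is_hom f /\ surjective_fun f.
Proof.
move=> finF [phi [phiM phiS]].
pose on (x : Pd) : F :=
  match excluded_middle_informative (fib N x) with left h => phi (Sub_grp FS h) | right _ => gone end.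
have onE x (h : fib N x) : on x = phi (Sub_grp FS h).
  rewrite /on; case: excluded_middle_informative => // h'.
  by congr phi; apply: sval_grp_inj.
have [F1 [FM FV]] := FS.
have onM x y : fib N x -> fib N y -> on (x ** y) = on x ** on y.
  move=> fx fy; rewrite (onE _ fx) (onE _ fy) (onE _ (FM _ _ fx fy)) -phiM.
  by congr phi; apply: sval_grp_inj.
have onJ x y : fib N x -> fib N y -> on (cj x y) = cj (on x) (on y).
  move=> fx fy; have fxy := FM _ _ fx fy; have fVx := FV _ fx.
  rewrite /cj !onM //; congr (_ ** _); apply: ginv_eq; rewrite -onM // gmulrV.
  by apply: (@gmul_injl _ (on gone)); rewrite -onM // ?gE.
pose a p := on (dg p); pose b n := on (single i1 n); pose c n := on (single i0 n).
have aM : is_hom a by move=> p p'; rewrite /a dg_hom onM //; apply: fib_dg.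
have bM n m : N n -> N m -> b (n ** m) = b n ** b m.
  by move=> Nn Nm; rewrite /b single_hom onM //; apply: fib_single1.
have cM n m : N n -> N m -> c (n ** m) = c n ** c m.
  by move=> Nn Nm; rewrite /c single_hom onM //; apply: fib_single0.
have s01 n m : single i1 n ** single i0 m = single i0 m ** single i1 n :> Pd.
  apply/cj_fixP; rewrite cj_single single_neq ?(central_cj _ (@central1 _)) //.
have bc n m : N n -> N m -> b n ** c m = c m ** b n.
  move=> Nn Nm; rewrite /b /c -!onM ?s01 //; solve [exact: fib_single0 | exact: fib_single1].
have acb n : N n -> a n = c n ** b n.
  move=> Nn; rewrite /b /c -onM; [|exact: fib_single0|exact: fib_single1].
  congr on; apply: pw_ext => i; rewrite -[RHS]/(single i0 n i ** single i1 n i) /dg /single.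
  case: (eqVneq i i0) => [->|] /=; first by rewrite (negPf i01) gmulr1.
  by case: (eqVneq i i1) => ?; rewrite gmul1.
have abJ p n : N n -> cj (a p) (b n) = b (cj p n).
  move=> Nn; rewrite /a /b -onJ ?cj_single; [|exact: fib_dg|exact: fib_single1].
  by rewrite /dg eqxx orbT.
have acJ p n : N n -> cj (a p) (c n) = c (cj p n).
  move=> Nn; rewrite /a /c -onJ ?cj_single; [|exact: fib_dg|exact: fib_single0].
  by rewrite /dg eqxx.
have [[_ [NM NV]] NJ] := nN.
have c1 : c gone = gone by apply: (@gmul_injl _ (c gone)); rewrite -cM // ?gE.
have b1 : b gone = gone by apply: (@gmul_injl _ (b gone)); rewrite -bM // ?gE.
have bV n : N n -> b (ginv n) = ginv (b n).
  by move=> Nn; apply: ginv_eq; rewrite -bM ?gmulrV //; apply: NV.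
have cV n : N n -> c (ginv n) = ginv (c n).
  by move=> Nn; apply: ginv_eq; rewrite -cM ?gmulrV //; apply: NV.
(* The product of the images of both copies of [N] is normalized by the image of the diagonal and
   contains that of the diagonal copy of [N]. *)
have aCB p : exists n m, [/\ N n, N m & a p = c n ** b m].
  apply: (nfq_normalized (M := fun z => exists n m, [/\ N n, N m & z = c n ** b m]) nfq finF aM).
  - split; first by exists gone, gone; rewrite c1 b1 gmul1.
    split=> [_ _ [n [m [Nn Nm ->]]] [n' [m' [Nn' Nm' ->]]]|_ [n [m [Nn Nm ->]]]].
    + exists (n ** n'), (m ** m'); rewrite cM // bM //; split; auto.
      by rewrite -!gmulA (gmulA (b m)) bc // !gmulA.
    + exists (ginv n), (ginv m); rewrite cV // bV // ginvM; split; auto.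
      by rewrite -cV // -bV // bc //; apply: NV.
  - move=> p' _ [n [m [Nn Nm ->]]]; exists (cj p' n), (cj p' m); split; try exact: NJ.
    by rewrite cjM acJ // abJ.
  - by move=> n Nn; exists n, n; rewrite acb.
have [rb [rbM rbN rbE]] := extend_hom nN qX spl aM bM cM bc acb abJ aCB.
have [rc [rcM rcN rcE]] : exists r : P -> F, [/\ is_hom r, forall n, N n -> r n = c n &
    forall p, exists n, N n /\ r p = c n].
  apply: (extend_hom nN qX spl aM cM bM (fun n m Nn Nm => esym (bc m n Nm Nn)) _ acJ).
    by move=> n Nn; rewrite acb // bc.
  by move=> p; have [n [m [Nn Nm e]]] := aCB p; exists m, n; split; rewrite // bc.
pose e x := on (rest x).
have eM : is_hom e by move=> x y; rewrite /e rest_hom onM //; apply: fib_rest.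
have restC i x p : (i == i0) || (i == i1) -> single i p ** rest x = rest x ** single i p :> Pd.
  move=> ii; apply: esym; apply/cj_fixP; rewrite cj_single /rest ii.
  by rewrite (central_cj _ (@central1 _)).
have be n x : N n -> e x ** b n = b n ** e x.
  move=> Nn; rewrite /e /b -!onM ?restC ?eqxx ?orbT //;
    solve [exact: fib_rest | exact: fib_single1].
have ce n x : N n -> e x ** c n = c n ** e x.
  move=> Nn; rewrite /e /c -!onM ?restC ?eqxx ?orbT //;
    solve [exact: fib_rest | exact: fib_single0].
exists (fun x => rc (x i0) ** rb (x i1) ** e x); split.
  move=> x y; rewrite -[(x ** y) i0]/(x i0 ** y i0) -[(x ** y) i1]/(x i1 ** y i1) rcM rbM eM.
  have [n [Nn rn]] := rcE (y i0); have [m [Nm rm]] := rbE (x i1).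
  have [k [Nk rk]] := rbE (y i1).
  rewrite rn rm rk -!gmulA; congr (_ ** _).
  rewrite (gmulA (e x) (c n)) ce // -!gmulA (gmulA (b m) (c n)) bc // -!gmulA.
  by congr (_ ** (_ ** _)); rewrite !gmulA be.
move=> y; have [h <-] := phiS y; set x := sval_grp h.
have hx : phi h = on x.
  by rewrite (onE _ (sval_grpP h)); congr phi; apply: sval_grp_inj.
have fx : fib N x := sval_grpP h.
(* The image of the diagonal part of [x] is redistributed over the two coordinates as
   [c n ** b m]. *)
have [n [m [Nn Nm anm]]] := aCB (x i0); set k := ginv (x i0) ** x i1.
have Nk : N k := fx.
exists (single i0 n ** single i1 (m ** k) ** rest x : Pd).
have -> : (single i0 n ** single i1 (m ** k) ** rest x : Pd) i0 = n.
  rewrite -[LHS]/(single i0 n i0 ** single i1 (m ** k) i0 ** rest x i0) singleE.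
  by rewrite single_neq // /rest eqxx ?gE.
have -> : (single i0 n ** single i1 (m ** k) ** rest x : Pd) i1 = m ** k.
  rewrite -[LHS]/(single i0 n i1 ** single i1 (m ** k) i1 ** rest x i1) singleE.
  by rewrite single_neq 1?eq_sym // /rest eqxx orbT ?gE.
have -> : e (single i0 n ** single i1 (m ** k) ** rest x) = e x.
  congr on; apply: pw_ext => i; rewrite /rest; case: ifP => // ii.
  rewrite -[LHS]/(single i0 n i ** single i1 (m ** k) i ** rest x i) /single /rest ii.
  by have /norP[/negPf-> /negPf->] := negbT ii; rewrite ?gE.
rewrite rcN // rbN; last exact: NM.
rewrite (bM m k Nm Nk).
rewrite hx [in RHS](fib_decomp x) !onM.
- by rewrite -/(a _) -/(b _) anm gmulA.
- exact: fib_dg.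
- exact: fib_single1.
- by apply: FM; [apply: fib_dg | apply: fib_single1].
- exact: fib_rest.
Qed.

Lemma fibre_same_quotients : same_finite_quotients Pd fibre.
Proof. by move=> F finF; split; [apply: fibre_quotient_of_power | apply: power_quotient_of_fibre]. Qed.

End OneN.

(** * Recovering the quotient of [P] from the fibre product *)

Section Rigidity.
Hypothesis indP : indecomp P.

Definition axis N (nN : is_normal N) (k : 'I_d) (h : fibre nN) : Prop :=
  forall i, i != k -> fval h i = gone.

(** The kernel of the map from the fibre product onto the quotient of [P] by [N]. *)
Definition fib_ker N (nN : is_normal N) (h : fibre nN) : Prop :=
  N (fval h i0) /\ N (fval h i1).

Lemma axis_fib_ker N (nN : is_normal N) k (h : fibre nN) : axis k h -> fib_ker h.
Proof.
move=> hk; have Nh : fib N (fval h) := fvalP h; have [[N1 [NM NV]] NJ] := nN.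
have [e|n0] := eqVneq i0 k.
  have h1 : fval h i1 = gone by apply: hk; rewrite -e eq_sym.
  move: Nh; rewrite /fib_ker /fib h1 gmulr1 => /NV; rewrite ginvK => h0.
  by split=> //; rewrite h1.
have h0 : fval h i0 = gone by apply: hk.
move: Nh; rewrite /fib_ker /fib h0 ginv1 gmul1 => h1.
by split=> //; rewrite h0.
Qed.

Lemma axis_normal N (nN : is_normal N) k : is_normal (@axis N nN k).
Proof.
split; [split; [|split]|].
- by move=> i _.
- by move=> x y hx hy i ik; rewrite -[LHS]/(fval x i ** fval y i) hx // hy // gmul1.
- by move=> x hx i ik; rewrite -[LHS]/(ginv (fval x i)) hx // ginv1.
- by move=> g x hx i ik; rewrite -[LHS]/(cj (fval g i) (fval x i)) hx // cj1.
Qed.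

Lemma axis_nontrivial N (nN : is_normal N) k : (exists n, N n /\ n <> gone) ->
  exists h, @axis N nN k h /\ h <> gone.
Proof.
move=> [n [Nn n1]].
have fk : fib N (single k n).
  have [->|n0] := eqVneq k i0; first exact: fib_single0.
  by have [->|n1'] := eqVneq k i1; [apply: fib_single1 | apply: fib_single].
exists (Sub_grp (fib_subgroup nN) fk); split; first by move=> i ik; apply: single_neq.
move=> /(congr1 (fun h : fibre nN => fval h k)).
by rewrite -[LHS]/(single k n k) singleE.
Qed.

Lemma axis_comm N (nN : is_normal N) k l (x y : fibre nN) : k != l -> axis k x -> axis l y ->
  x ** y = y ** x.
Proof.
move=> kl xk yl; apply: fval_inj; apply: pw_ext => i.
rewrite -[LHS]/(fval x i ** fval y i) -[RHS]/(fval y i ** fval x i).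
case: (eqVneq i k) => [->|ik]; last by rewrite xk // ?gE.
by rewrite (yl k kl) ?gE.
Qed.

(** The [d] axes are commuting nontrivial normal subgroups, so their images occupy one coordinate
    each and lie in axes, hence in [fib_ker]; and the axes generate [fib_ker]. *)
Lemma fib_ker_iso N N' (nN : is_normal N) (nN' : is_normal N')
  (f : fibre nN -> fibre nN') (g : fibre nN' -> fibre nN) :
  is_hom f -> is_hom g -> (forall x, g (f x) = x) -> (forall y, f (g y) = y) ->
  (exists n, N n /\ n <> gone) -> forall h, fib_ker h -> fib_ker (f h).
Proof.
move=> fM gM fK gK N1 h [h0 h1].
pose c (i : 'I_d) (y : fibre nN') : P := fval y i.
have cM i : is_hom (c i) by [].
have cS i : surjective_fun (c i).
  move=> p; have fd : fib N' (@diag P d p) by rewrite /fib gmulV; have [[]] := nN'.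
  by exists (Sub_grp (fib_subgroup nN') fd).
have c_inj y : (forall i, c i y = gone) -> y = gone.
  by move=> y1; apply: fval_inj; apply: pw_ext.
pose U (k : 'I_d) (y : fibre nN') := axis k (g y).
have nU k : is_normal (U k) := preimage_normal gM (axis_normal nN k).
have U1 k : exists y, U k y /\ y <> gone.
  have [x [xk x1]] := axis_nontrivial nN k N1; exists (f x); split; first by rewrite /U fK.
  by move=> fx; apply: x1; rewrite -(fK x) fx (hom1 gM).
have UU k l : k != l -> forall x y, U k x -> U l y -> x ** y = y ** x.
  by move=> kl x y xk yl; rewrite -(gK x) -(gK y) -!fM (axis_comm kl xk yl).
have Uaxis k y : U k y -> exists j, axis j y.
  move=> Uy; exists (supp_coord c_inj U1 k) => i ik.
  rewrite -[LHS]/(c i y).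
  exact: (supp_coord_only cM cS indP nU UU (card_ord d) ik Uy).
have SL : is_subgroup (@fib_ker N' nN').
  have [[N1' [NM NV]] _] := nN'; split; [by [] | split].
  - by move=> x y [x0 x1] [y0 y1]; split; apply: NM.
  - by move=> x [x0 x1]; split; apply: NV.
pose T (x : Pd) := exists fx : fib N x, fib_ker (f (Sub_grp (fib_subgroup nN) fx)).
suff [fh] : T (fval h).
  by rewrite (_ : Sub_grp _ fh = h) //; apply: fval_inj.
apply: power_gen.
  case: (fib_subgroup nN) (SL) => [F1 [FM FV]] [L1 [LM LV]]; split.
    exists F1; rewrite (_ : Sub_grp _ F1 = gone) ?(hom1 fM) //; exact: fval_inj.
  split=> [x y [fx Lx] [fy Ly]|x [fx Lx]].
  - exists (FM _ _ fx fy); rewrite (_ : Sub_grp (fib_subgroup nN) _ =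
      Sub_grp (fib_subgroup nN) fx ** Sub_grp (fib_subgroup nN) fy) ?fM; first exact: LM.
    exact: fval_inj.
  - exists (FV _ fx); rewrite (_ : Sub_grp (fib_subgroup nN) _ =
      ginv (Sub_grp (fib_subgroup nN) fx)) ?(homV fM); first exact: LV.
    exact: fval_inj.
move=> i.
have fi : fib N (single i (fval h i)).
  have [->|n0] := eqVneq i i0; first exact: fib_single0.
  by have [->|n1] := eqVneq i i1; [apply: fib_single1 | apply: fib_single].
exists fi; set x := Sub_grp _ fi.
have [|j fxj] := Uaxis i (f x); last exact: axis_fib_ker fxj.
by rewrite /U fK => k ki; apply: single_neq.
Qed.

Lemma fibre_iso N N' (nN : is_normal N) (nN' : is_normal N') (X X' : Grp)
  (q : P -> X) (q' : P -> X') : is_quotient N q -> is_quotient N' q' ->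
  (exists n, N n /\ n <> gone) -> (exists n, N' n /\ n <> gone) ->
  grp_iso (fibre nN) (fibre nN') -> grp_iso X X'.
Proof.
move=> qX qX' N1 N1' [f [g [fM [fK gK]]]].
have gM : is_hom g by move=> x y; rewrite -{1}(gK x) -{1}(gK y) -fM fK.
have key M M' (nM : is_normal M) (nM' : is_normal M') (Y Y' : Grp) (r : P -> Y) (r' : P -> Y')
    (u : fibre nM -> fibre nM') (v : fibre nM' -> fibre nM) :
    is_quotient M r -> is_quotient M' r' -> is_hom u -> is_hom v ->
    (forall x, v (u x) = x) -> (forall y, u (v y) = y) -> (exists n, M n /\ n <> gone) ->
    exists w : Y -> Y', is_hom w /\ forall h, w (r (fval h i0)) = r' (fval (u h) i0).
  move=> [rM rS rK] [rM' rS' rK'] uM vM uK vK M1.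
  have cM L (nL : is_normal L) : is_hom (fun h : fibre nL => fval h i0) by [].
  apply: (hom_factor (q := fun h : fibre nM => r (fval h i0))
    (f := fun h : fibre nM => r' (fval (u h) i0))).
  - exact: (hom_comp (cM _ nM) rM).
  - move=> y; have [p <-] := rS y.
    by exists (Sub_grp (fib_subgroup nM) (fib_dg nM p)); rewrite /= /dg eqxx.
  - exact: (hom_comp uM (hom_comp (cM _ nM') rM')).
  - move=> h /rK Mh; apply/rK'; apply: (proj1 (@fib_ker_iso _ _ nM nM' u v _ _ _ _ M1 h _)) => //.
    split=> //; have Mf : fib M (fval h) := fvalP h.
    by rewrite -(gmulKV (fval h i0) (fval h i1)); have [[_ [MM _]] _] := nM; apply: MM.
have [w [wM wE]] := key _ _ nN nN' _ _ _ _ f g qX qX' fM gM fK gK N1.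
have [w' [w'M w'E]] := key _ _ nN' nN _ _ _ _ g f qX' qX gM fM gK fK N1'.
have lift0 M (nM : is_normal M) p : exists h : fibre nM, fval h i0 = p.
  by exists (Sub_grp (fib_subgroup nM) (fib_dg nM p)); rewrite /= /dg eqxx.
exists w, w'; split=> //; split=> x.
- case: qX => _ /(_ x) [p <-] _; have [h <-] := lift0 _ nN p.
  by rewrite wE w'E fK.
- case: qX' => _ /(_ x) [p <-] _; have [h <-] := lift0 _ nN' p.
  by rewrite w'E wE gK.
Qed.
End Rigidity.
End FibreProduct.

(** * The quotients of the free product *)

(** The kernel lies in the second centre: one layer is the centre of [X], the other comes from a
    presentation valid modulo the centre. *)
Definition hypercentral_cover (n : nat) (X : Grp) := exists p : X -> power_grp V n,
  [/\ is_hom p, surjective_fun p & forall x, p x = gone -> forall y, central (comm x y)].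

Lemma power_V_centerless n (w : power_grp V n) : central w -> w = gone.
Proof. by move=> cw; apply: pw_ext => i; apply/V_centerless/power_central. Qed.

(** A surjection onto a centreless group kills the second centre, so [f] matches the two kernels;
    the axes of the first power become [n] commuting nontrivial normal subgroups of the second. *)
Lemma cover_le n m X X' : hypercentral_cover n X -> hypercentral_cover m X' ->
  grp_iso X X' -> (n <= m)%N.
Proof.
move=> [p [pM pS pC]] [p' [p'M p'S p'C]] [f [g [fM [fK gK]]]].
have gM : is_hom g by move=> x y; rewrite -{1}(gK x) -{1}(gK y) -fM fK.
have key k1 k2 (Y Y' : Grp) (r : Y -> power_grp V k1) (r' : Y' -> power_grp V k2)
    (u : Y -> Y') (v : Y' -> Y) : is_hom r' -> surjective_fun r' -> is_hom u ->
    (forall y, u (v y) = y) -> (forall x, r x = gone -> forall y, central (comm x y)) ->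
    forall x, r x = gone -> r' (u x) = gone.
  move=> r'M r'S uM uv rC x rx; apply: power_V_centerless => w; have [y <-] := r'S w.
  apply/comm1P; rewrite -(hom_comm r'M); apply: power_V_centerless => w'.
  have [y' <-] := r'S w'; rewrite -!r'M; congr r'.
  by rewrite -(uv y) -(hom_comm uM) -(uv y') -!uM; congr u; apply: rC.
pose U (k : 'I_n) (y : power_grp V m) := exists x, (forall i, i != k -> p x i = gone) /\ p' (f x) = y.
pose c (i : 'I_m) (y : power_grp V m) : V := y i.
have [x0 [y0 xy0]] := V_nonabelian.
have [v v1] : exists v : V, v <> gone.
  apply: NNPP => nv; have e z : z = gone :> V by apply: NNPP => z1; apply: nv; exists z.
  by apply: xy0; rewrite (e x0) (e y0).
rewrite -[n]card_ord; apply: (@card_supports V (power_grp V m) m c _ U).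
- by [].
- by move=> i z; exists (@diag V m z).
- by move=> y y1; apply: pw_ext.
- exact: V_indecomp.
- move=> k; split.
    have -> : U k = (fun y => exists x, (forall i, i != k -> p x i = gone) /\ p' (f x) = y) by [].
    apply: (image_subgroup (hom_comp fM p'M)); split; first by move=> i _; rewrite (hom1 pM).
    split=> [x y hx hy|x hx] i ik; rewrite ?pM ?(homV pM).
      by rewrite -[LHS]/(p x i ** p y i) hx // hy // gmul1.
    by rewrite -[LHS]/(ginv (p x i)) hx // ginv1.
  move=> w _ [x [hx <-]]; have [y ey] := p'S w; exists (cj (g y) x); split.
    by move=> i ik; rewrite (hom_cj pM) -[LHS]/(cj (p (g y) i) (p x i)) hx // cj1.
  by rewrite (hom_cj fM) (hom_cj p'M) gK ey.
- move=> k; have [x ex] := pS (single k v); exists (p' (f x)); split.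
    by exists x; split=> // i ik; rewrite ex single_neq.
  move=> e; apply: v1; have := key _ _ _ _ p' p g f pM pS gM fK p'C _ e.
  by rewrite fK ex => /(congr1 (fun z : power_grp V n => z k)); rewrite singleE.
- move=> k l' kl _ _ [x [hx <-]] [y [hy <-]]; apply/comm1P.
  rewrite -(hom_comm p'M) -(hom_comm fM).
  apply: (key _ _ _ _ p p' f g p'M p'S fM gK pC); rewrite (hom_comm pM); apply/comm1P.
  apply: pw_ext => i; rewrite -[LHS]/(p x i ** p y i) -[RHS]/(p y i ** p x i).
  case: (eqVneq i k) => [->|ik]; last by rewrite hx // ?gE.
  by rewrite (hy k) ?gE.
Qed.

(** * The normal subgroup of the free product and its quotient *)

Section Kernel.
Variables (l : nat) (G : 'I_l -> Grp) (P : Grp) (iota : forall j, G j -> P).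
Arguments iota : clear implicits.
Hypothesis fpP : is_free_product l G P iota.
Hypothesis fgG : forall j, finitely_generated (G j).
(** [jj] selects four factors and [lab] recovers the label. [K] has index 2 in these and is
    everything in the others, which therefore die in the quotient; [xx] supplies elements outside
    [K]. *)
Variables (jj : 'I_4 -> 'I_l) (lab : 'I_l -> 'I_4) (K : forall j, G j -> Prop) (xx : forall j, G j).
Arguments K : clear implicits.
Hypotheses (jjK : forall b, lab (jj b) = b)
  (KS : forall j, is_subgroup (K j)) (K2 : forall j x y, ~ K j x -> ~ K j y -> K j (x ** y))
  (Kx : forall b, ~ K (jj b) (xx (jj b)))
  (Kall : forall j, jj (lab j) = j \/ forall x, K j x).

Let xi b : P := iota (jj b) (xx (jj b)).
Let iotaM j : is_hom (iota j). Proof. exact: (proj1 fpP). Qed.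

Lemma hom_of_involutions (Y : Grp) (s : 'I_4 -> Y) : (forall b, s b ** s b = gone) ->
  exists f : P -> Y, [/\ is_hom f, forall b, f (xi b) = s b &
    forall j x, K j x -> f (iota j x) = gone].
Proof.
move=> s2; pose fj j (x : G j) : Y := if excluded_middle_informative (K j x) then gone else s (lab j).
have fM j : is_hom (@fj j).
  have [K1 [KM KV]] := KS j; move=> x y; rewrite /fj.
  case: (excluded_middle_informative (K j x)) => kx; case: (excluded_middle_informative (K j y)) => ky;
    case: excluded_middle_informative => kxy; rewrite /= ?gE ?s2 //.
  - by case: kxy; apply: KM.
  - by case: ky; rewrite -(gmulVK x y); apply: KM => //; apply: KV.
  - by case: kx; rewrite -(gmulr1 x) -(gmulrV y) gmulA; apply: KM => //; apply: KV.
  - by case: kxy; apply: K2.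
have [f [fM' [fi _]]] := proj2 fpP _ fj fM.
exists f; split=> // [b|j x kx]; rewrite fi /fj; case: excluded_middle_informative => //.
- by move=> kx; case: (Kx kx).
- by rewrite jjK.
Qed.

Section Relators.
Variables (n : nat) (J : finType) (R : J -> term 'I_4) (k1 k2 h : 'I_4 -> term 'I_4).
Let tu b := tcomm (k1 b) (k2 b).
Let tv b := tcj (h b) (tu b).
Let td b := tcomm (tu b) (h b).
Hypothesis tauR : forall j, ev (tau n) (R j) = gone.
Hypothesis RP : forall (Y : Grp) (r : 'I_4 -> Y), generates r -> (forall j, ev r (R j) = gone) ->
  (forall t, ev (tau n) t = gone -> central (ev r t)) /\ (fin Y -> forall y : Y, y = gone).
Hypotheses (tauD : forall b, ev (tau n) (td b) = tau n b)
  (tau1 : forall b, ev (tau n) (tcomm (k1 b) (tv b)) = gone)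
  (tau2 : forall b, ev (tau n) (tcomm (k2 b) (tv b)) = gone)
  (tau3 : forall b, ev (tau n) (Mul (tu b) (tu b)) = gone).

Let M (x : J + 'I_4 * 'I_3) : term 'I_4 :=
  match x with
  | inl j => R j
  | inr (b, c) => match nat_of_ord c with
     | 0 => tcomm (k1 b) (tv b) | 1 => tcomm (k2 b) (tv b) | _ => Mul (tu b) (tu b) end
  end.

(* The relators of the kernel: the words [M] are only made central, so that the quotient
   becomes its own universal central extension. *)
Let rel (r : P) : Prop :=
  (exists j (x : G j), K j x /\ r = iota j x) \/
  (exists a x, r = comm (xi a) (ev xi (M x))) \/
  (exists b, r = ginv (ev xi (td b)) ** xi b).
Let N (p : P) : Prop := forall S : P -> Prop, is_normal S -> (forall r, rel r -> S r) -> S p.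

Lemma N_normal : is_normal N.
Proof.
split; [split; [|split]|].
- by move=> S nS _; case: nS => [[]].
- by move=> x y Nx Ny S nS Sr; have [[_ [SM _]] _] := nS; apply: SM; [apply: Nx | apply: Ny].
- by move=> x Nx S nS Sr; have [[_ [_ SV]] _] := nS; apply: SV; apply: Nx.
- by move=> g x Nx S nS Sr; have [_ SJ] := nS; apply: SJ; apply: Nx.
Qed.

Lemma N_rel r : rel r -> N r.
Proof. by move=> rr S _; apply. Qed.

(** No generating set of [K j] is needed: a homomorphism that kills [xx j ** xx j] and every
    generator of [G j], corrected by [xx j] when it lies outside [K j], is trivial on [K j] and
    constant on its complement. *)
Lemma N_fg : normal_fg N.
Proof.
have Z_ex j : exists z : list (G j), (forall x, In x z -> K j x) /\
    forall (Y : Grp) (f : G j -> Y), is_hom f -> (forall x, In x z -> f x = gone) ->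
      forall x, K j x -> f x = gone.
  have [s sP] := fgG j; have [K1 [KM KV]] := KS j.
  case: (Kall j) => [ej|Kj]; last first.
    exists s; split=> // Y f fM fs x _.
    by apply: (sP (fun x => f x = gone)) => //; apply: (preimage_subgroup fM (proj1 (trivial_normal Y))).
  have nKx : ~ K j (xx j) by have := @Kx (lab j); rewrite ej.
  have KnM x y : K j x -> ~ K j y -> ~ K j (x ** y).
    by move=> kx ky kxy; apply: ky; rewrite -(gmulVK x y); apply: KM => //; apply: KV.
  have KMn x y : ~ K j x -> K j y -> ~ K j (x ** y).
    by move=> kx ky kxy; apply: kx; rewrite -(gmulr1 x) -(gmulrV y) gmulA; apply: KM => //; apply: KV.
  have KVn x : ~ K j x -> ~ K j (ginv x) by move=> kx /KV; rewrite ginvK.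
  pose zs x := if excluded_middle_informative (K j x) then x else ginv (xx j) ** x.
  exists ((xx j ** xx j) :: List.map zs s)%list; split.
    move=> x [<-|/in_map_iff[y [<- _]]]; first exact: K2.
    by rewrite /zs; case: excluded_middle_informative => // ky; apply: K2 => //; apply: KVn.
  move=> Y f fM fz.
  have y2 : f (xx j) ** f (xx j) = gone by rewrite -fM; apply: fz; left.
  pose T x := (K j x /\ f x = gone) \/ (~ K j x /\ f x = f (xx j)).
  suff allT : forall x, T x by move=> x kx; case: (allT x) => -[].
  apply: sP.
    split; first by left; rewrite (hom1 fM).
    split=> [x y|x].
      move=> [[kx fx]|[kx fx]] [[ky fy]|[ky fy]]; rewrite /T fM fx fy ?gE; auto.
    by move=> [[kx fx]|[kx fx]]; rewrite /T (homV fM) fx ?gE; [left | right; rewrite -(ginv_eq y2)]; auto.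
  move=> x xs; have := fz (zs x) (or_intror (in_map zs _ _ xs)).
  rewrite /zs; case: excluded_middle_informative => kx; first by left.
  by rewrite fM (homV fM) => e; right; split=> //; apply: (@gmul_injl _ (ginv (f (xx j)))); rewrite e gmulV.
pose z j := proj1_sig (constructive_indefinite_description _ (Z_ex j)).
have zP j := proj2_sig (constructive_indefinite_description _ (Z_ex j)).
exists (flat_map (fun j => List.map (iota j) (z j)) (enum 'I_l) ++
  List.map (fun ax => comm (xi ax.1) (ev xi (M ax.2))) (enum {: 'I_4 * (J + 'I_4 * 'I_3)}) ++
  List.map (fun b => ginv (ev xi (td b)) ** xi b) (enum 'I_4))%list.
have enumP (I : finType) (i : I) : In i (enum I).
  by elim: (enum I) (mem_enum I i) => // k r IH; rewrite inE => /orP[/eqP->|/IH]; [left | right].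
split=> [r|S nS Sr p Np].
  move=> hr; case: (in_app_or _ _ _ hr) => [h1|{}hr]; last case: (in_app_or _ _ _ hr).
  - have [j [_ /in_map_iff[x [<- xz]]]] := proj1 (in_flat_map _ _ _) h1.
    by apply: N_rel; left; exists j, x; split=> //; apply: (proj1 (zP j)).
  - by move=> /in_map_iff[[a x] [<- _]]; apply: N_rel; right; left; exists a, x.
  - by move=> /in_map_iff[b [<- _]]; apply: N_rel; right; right; exists b.
apply: Np => // r [[j [x [kx ->]]]|[[a [x ->]]|[b ->]]].
- have [Q [q [qM [qS qK]]]] := quotient_exists nS.
  apply/qK; apply: (proj2 (zP j) Q (fun x => q (iota j x))) kx.
    by move=> u v; rewrite iotaM qM.
  move=> y yz; apply/qK/Sr/in_or_app; left; apply/in_flat_map; exists j.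
  by split; [apply: enumP | apply: in_map].
- apply/Sr/in_or_app; right; apply/in_or_app; left.
  by apply/in_map_iff; exists (a, x); split=> //; apply: enumP.
- apply/Sr/in_or_app; right; apply/in_or_app; right.
  by apply/in_map_iff; exists b; split=> //; apply: enumP.
Qed.

Variables (X : Grp) (q : P -> X).
Hypothesis qX : is_quotient N q.
Let qM : is_hom q. Proof. by have [] := qX. Qed.
Let qS : surjective_fun q. Proof. by have [] := qX. Qed.
Let qK p : q p = gone <-> N p. Proof. by have [_ _ e] := qX; apply: e. Qed.
Let ze b := q (xi b).

Let q_rel r : rel r -> q r = gone. Proof. by move=> rr; exact (proj2 (qK r) (N_rel rr)). Qed.

Let ev_ze t : q (ev xi t) = ev ze t. Proof. exact: ev_hom. Qed.

Let ze_generates : generates ze.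
Proof.
apply: generates_of_subgroup => S SS Sz x; have [p <-] := qS x; move: p.
apply: (free_product_gen fpP (S := fun p => S (q p))); first exact: (preimage_subgroup qM).
have S1 : S gone by case: SS.
move=> j x'; have [kx|kx] := classic (K j x'); first by rewrite q_rel //; left; exists j, x'.
case: (Kall j) => [ej|]; last by move=> /(_ x').
have [_ [_ KV]] := KS j.
have nKx : ~ K j (xx j) by have := @Kx (lab j); rewrite ej.
have Nx : q (iota j (ginv (xx j) ** x')) = gone.
  apply: q_rel; left; exists j, (ginv (xx j) ** x'); split=> //.
  by apply: K2 => // /KV; rewrite ginvK.
have -> : q (iota j x') = ze (lab j).
  apply: (@gmul_injl _ (ginv (q (iota j (xx j))))).
  rewrite -(homV qM) -(homV (@iotaM j)) -qM -(@iotaM j) Nx.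
  rewrite /ze /xi ej (homV (@iotaM j)) (homV qM) gmulV //.
exact: Sz.
Qed.

Let ze_comm a x : comm (ze a) (ev ze (M x)) = gone.
Proof. by rewrite -ev_ze -(hom_comm qM); apply: q_rel; right; left; exists a, x. Qed.

Let ze_central x : central (ev ze (M x)).
Proof. by apply: commute_generates ze_generates _ => a; symmetry; apply/comm1P. Qed.

Let ze_td b : ev ze (td b) = ze b.
Proof.
apply: (@gmul_injl _ (ginv (ev ze (td b)))); rewrite gmulV -ev_ze -(homV qM) -qM.
by symmetry; apply: q_rel; right; right; exists b.
Qed.

Let universal (Y : Grp) (s : 'I_4 -> Y) : (forall b, s b ** s b = gone) ->
  (forall a x, comm (s a) (ev s (M x)) = gone) -> (forall b, ev s (td b) = s b) ->
  exists f : X -> Y, is_hom f /\ forall b, f (ze b) = s b.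
Proof.
move=> s2 sc sd; have [f [fM fx fK]] := hom_of_involutions s2.
have fe t : f (ev xi t) = ev s t by rewrite (ev_hom _ _ fM); apply: eq_ev.
have [|g [gM gE']] := hom_factor qM qS fM.
  move=> p /qK Np; apply: (Np (fun p => f p = gone)).
    exact: (preimage_normal fM (trivial_normal Y)).
  move=> r [[j [x [kx ->]]]|[[a [x ->]]|[b ->]]]; first exact: fK.
    by rewrite (hom_comm fM) fx fe.
  by rewrite fM (homV fM) fe fx sd gmulV.
by exists g; split=> // b; rewrite gE' fx.
Qed.

Let doubled_involution (Y : Grp) (s : 'I_4 -> Y) : generates s ->
  (forall a x, comm (s a) (ev s (M x)) = gone) -> (forall b, ev s (td b) = s b) ->
  forall b, s b ** s b = gone.
Proof.
move=> sG sc sd b; rewrite -!sd.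
have cM x : central (ev s (M x)).
  by apply: commute_generates sG _ => a; symmetry; apply/comm1P.
apply: doubled_square.
- exact: (cM (inr (b, @Ordinal 3 0 isT))).
- exact: (cM (inr (b, @Ordinal 3 1 isT))).
- exact: (cM (inr (b, @Ordinal 3 2 isT))).
Qed.

Let tauM x : ev (tau n) (M x) = gone.
Proof.
case: x => [j|[b c]]; first exact: tauR.
by rewrite /M; case: (nat_of_ord c) => [|[|_]]; [apply: tau1 | apply: tau2 | apply: tau3].
Qed.

(** In [X] modulo its centre the relators [R] hold exactly, so words trivial in the power of [V] are
    central there. *)
Lemma X_cover : hypercentral_cover n X.
Proof.
have tc a x : comm (tau n a) (ev (tau n) (M x)) = gone by rewrite tauM /comm ?gE.
have [p [pM pz]] := universal (doubled_involution (@tau_generates n) tc tauD) tc tauD.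
have pe t : p (ev ze t) = ev (tau n) t by rewrite (ev_hom _ _ pM); apply: eq_ev.
exists p; split=> // [v|x px y].
  by have [t <-] := tau_generates v; exists (ev ze t).
have [Y [r [rM [rS rK]]]] := quotient_exists (@central_normal X).
have [|c _] := RP (generates_image rM rS ze_generates).
  move=> j; rewrite -(ev_hom ze _ rM); apply/rK; exact: (ze_central (inl j)).
have [t et] := ze_generates x.
apply/rK; rewrite (hom_comm rM) comm1P -et (ev_hom ze _ rM).
by apply: c; rewrite -pe et.
Qed.

(** The image of [P] modulo its centre is finite and satisfies the relators, hence is trivial; so
    the image is abelian, while its generators are commutators. *)
Lemma X_no_finite_quotient : no_finite_quotient N.
Proof.
move=> F f finF fM fN p.
have [|g [gM gq]] := hom_factor qM qS fM; first by move=> p' /qK; apply: fN.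
pose r b := g (ze b); pose Y0 := gen_grp r.
have re t : ev r t = g (ev ze t) by rewrite (ev_hom ze _ gM).
have cY x : central (ev (gen_gen r) (M x)).
  apply: commute_generates (@generates_gen _ _ _) _ => a; apply: sval_grp_inj.
  rewrite -[LHS]/(sval_grp (ev (gen_gen r) (M x)) ** r a).
  rewrite -[RHS]/(r a ** sval_grp (ev (gen_gen r) (M x))) sval_ev re /r -!gM.
  by rewrite ze_central.
have [Y [u [uM [uS uK]]]] := quotient_exists (@central_normal Y0).
have [|_ Yfin] := RP (generates_image uM uS (@generates_gen _ _ r)).
  move=> j; rewrite -(ev_hom _ _ uM); apply/uK; exact: (cY (inl j)).
have {}Yfin := Yfin (fin_surj uS (fin_sub _ finF)).
have Y0c (y : Y0) : central y by apply/uK.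
have r1 b : r b = gone.
  rewrite /r -ze_td -re -(@sval_ev _ _ r).
  have -> : ev (gen_gen r) (td b) = gone by apply/comm1P; apply: Y0c.
  by [].
rewrite -gq; have [t <-] := ze_generates (q p); rewrite -re.
by apply: ev_subgroup (proj1 (trivial_normal F)) r1.
Qed.

Let ev_mod_central (Y : Grp) (s s' : 'I_4 -> Y) : (forall b, exists z, central z /\ s' b = z ** s b) ->
  forall t, exists z, central z /\ ev s' t = z ** ev s t.
Proof.
move=> ss'; elim=> [b||t1 [z1 [c1 e1]] t2 [z2 [c2 e2]]|t1 [z1 [c1 e1]]] /=; first exact: ss'.
- by exists gone; rewrite gmul1; split=> //; apply: central1.
- exists (z1 ** z2); split; first exact: centralM.
  by rewrite e1 e2 -!gmulA (gmulA (ev s t1)) -c2 -!gmulA.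
- exists (ginv z1); split; first exact: centralV.
  by rewrite e1 ginvM; symmetry; apply: (centralV c1).
Qed.

(** The lifts [T b] are commutator words in arbitrary lifts [T0 b]. They do not depend on that
    choice, so they equal the same words in themselves, and the other relations of [X] follow. *)
Lemma X_split : central_ext_split X.
Proof.
move=> E f fM fS fC.
have [T0 T0f] := choice _ (fun b => fS (ze b)).
pose T b := ev T0 (td b).
have fT0 t : f (ev T0 t) = ev ze t by rewrite (ev_hom _ _ fM); apply: eq_ev.
have fTb b : f (T b) = ze b by rewrite fT0 ze_td.
have fT t : f (ev T t) = ev ze t by rewrite (ev_hom _ _ fM); apply: eq_ev.
have TT0 b : exists z, central z /\ T b = z ** T0 b.
  exists (T b ** ginv (T0 b)); split; last by rewrite -gmulA gmulV gmulr1.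
  by apply: fC; rewrite fM (homV fM) fTb T0f gmulrV.
have Tt := ev_mod_central TT0.
have Ttd b : ev T (td b) = T b.
  have [z [cz ez]] := Tt (tu b); have [w [cw ew]] := Tt (h b).
  rewrite -[LHS]/(comm (ev T (tu b)) (ev T (h b))) ez ew comm_centrall // comm_centralr //.
have Tc a x : comm (T a) (ev T (M x)) = gone.
  set m := ev T (M x).
  have cm e : central (comm e m).
    by apply: fC; rewrite (hom_comm fM) fT comm1P ze_central.
  (* Bracketing with [m] has central values, so it is a homomorphism and kills the commutator
     [T a]. *)
  have kM e e' : comm (e ** e') m = comm e m ** comm e' m.
    have -> : comm (e ** e') m = cj e (comm e' m) ** comm e m by rewrite /comm /cj ?gE.
    by rewrite cj_central // cm.
  rewrite -Ttd -[ev T (td a)]/(comm (ev T (tu a)) (ev T (h a))).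
  rewrite (@hom_comm _ _ (fun e => comm e m)) //; apply/comm1P; exact: cm.
(* [doubled_involution] asks for generators, so it is applied in the subgroup generated by the
   [T b]. *)
have T2 b : T b ** T b = gone.
  apply: (f_equal (@sval_grp _ _ _) (y := gone)
    (@doubled_involution (gen_grp T) (gen_gen T) (@generates_gen _ _ T) _ _ b)).
    by move=> a x; apply: sval_grp_inj; rewrite (hom_comm (@sval_hom _ _ _)) sval_ev; apply: Tc.
  by move=> b'; apply: sval_grp_inj; rewrite sval_ev; apply: Ttd.
have [s [sM sz]] := universal T2 Tc Ttd.
exists s; split=> //; apply: generates_subgroup ze_generates _ _.
  exact: (hom_eq_subgroup (hom_comp sM fM)).
by move=> b; rewrite sz fTb.
Qed.

(** Otherwise [P] itself would have no nontrivial finite quotient, yet it maps onto a group of order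
    2. *)
Lemma N_nontrivial : exists p, N p /\ p <> gone.
Proof.
apply: NNPP => nN.
have N1 p : N p -> p = gone by move=> Np; apply: NNPP => p1; apply: nN; exists p.
pose sg : sym_grp bool := MkSym negbK negbK.
have s2 (b : 'I_4) : sg ** sg = gone by apply: symP => x /=; rewrite negbK.
have [f [fM fx _]] := hom_of_involutions s2.
have finB : fin (sym_grp bool).
  by apply: fin_sym; exists (true :: false :: nil)%list => -[]; [left | right; left].
have := X_no_finite_quotient finB fM (fun p Np => etrans (f_equal f (N1 p Np)) (hom1 fM)) (xi ord0).
by rewrite fx => /(congr1 (fun s : sym_grp bool => s true)).
Qed.

End Relators.
Lemma kernel_exists n : exists (N : P -> Prop) (X : Grp) (q : P -> X),
  [/\ is_normal N, normal_fg N & no_finite_quotient N] /\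
  [/\ is_quotient N q, central_ext_split X, hypercentral_cover n X & exists p, N p /\ p <> gone].
Proof.
have [J [R [tauR RP]]] := tau_presented n.
have D b : exists k : term 'I_4 * term 'I_4 * term 'I_4,
    [/\ ev (tau n) (tcomm (tcomm k.1.1 k.1.2) k.2) = tau n b,
        ev (tau n) (tcomm k.1.1 (tcj k.2 (tcomm k.1.1 k.1.2))) = gone,
        ev (tau n) (tcomm k.1.2 (tcj k.2 (tcomm k.1.1 k.1.2))) = gone &
        ev (tau n) (Mul (tcomm k.1.1 k.1.2) (tcomm k.1.1 k.1.2)) = gone].
  have [x [y [z [e0 e1 e2 e3]]]] := doubled_tau n b.
  have [kx ex] := tau_generates x; have [ky ey] := tau_generates y.
  have [kz ez] := tau_generates z; subst x y z.
  by exists (kx, ky, kz); split; [rewrite e0 | exact: e1 | exact: e2 | exact: e3].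
have [k kP] := choice _ D.
pose k1 b := (k b).1.1; pose k2 b := (k b).1.2; pose h b := (k b).2.
have k0 b : ev (tau n) (tcomm (tcomm (k1 b) (k2 b)) (h b)) = tau n b by have [] := kP b.
have e1 b : ev (tau n) (tcomm (k1 b) (tcj (h b) (tcomm (k1 b) (k2 b)))) = gone by have [] := kP b.
have e2 b : ev (tau n) (tcomm (k2 b) (tcj (h b) (tcomm (k1 b) (k2 b)))) = gone by have [] := kP b.
have e3 b : ev (tau n) (Mul (tcomm (k1 b) (k2 b)) (tcomm (k1 b) (k2 b))) = gone by have [] := kP b.
have nN := N_normal R k1 k2 h.
have [X [q [qM [qS qK]]]] := quotient_exists nN.
have qX := And3 qM qS qK.
eexists; exists X, q; split; split; first exact: nN; first 1 last.
- exact: (X_no_finite_quotient RP qX).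
- exact: qX.
- exact: (X_split qX).
- exact: (X_cover tauR RP k0 e1 e2 e3 qX).
- exact: (N_nontrivial RP qX).
- exact: N_fg.
Qed.

End Kernel.

(** * Subgroups of index 2 and the infinite family *)

Lemma index2_mul (G : Grp) (K : G -> Prop) (a : G) : is_subgroup K ->
  (forall x, K x \/ K (ginv a ** x)) -> forall x y, ~ K x -> ~ K y -> K (x ** y).
Proof.
move=> [_ [KM KV]] Ka x y nx ny.
have [/KV|kx] := Ka (ginv x); first by rewrite ginvK => /nx.
have [/ny //|ky] := Ka y.
by have := KM _ _ (KV _ kx) ky; rewrite ?gE -?gmulA ?gE.
Qed.

Lemma grp_iso_sym (G H : Grp) : grp_iso G H -> grp_iso H G.
Proof.
by move=> [f [g [fM [fK gK]]]]; exists g, f; split=> // x y; rewrite -{1}(gK x) -{1}(gK y) -fM fK.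
Qed.

Lemma grp_iso_trans (G H K : Grp) : grp_iso G H -> grp_iso H K -> grp_iso G K.
Proof.
move=> [f [g [fM [fK gK]]]] [f' [g' [f'M [f'K g'K]]]].
exists (fun x => f' (f x)), (fun y => g (g' y)); split; first exact: hom_comp.
by split=> x; rewrite ?f'K ?gK.
Qed.

(** Each listed group is isomorphic to at most one term of the sequence, so late terms avoid the
    list. *)
Lemma genus_infinite_of_seq (G : Grp) (H : nat -> Grp) : (forall n, in_genus G (H n)) ->
  (forall n m, grp_iso (H n) (H m) -> n = m) -> genus_infinite G.
Proof.
move=> HG HI L; suff [M MP] : exists M, forall n, (M <= n)%N -> forall K, In K L -> ~ grp_iso (H n) K.
  by exists (H M); split=> //; apply: MP.
elim: L => [|K L [M MP]]; first by exists 0.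
have [[m mK]|nK] := classic (exists m, grp_iso (H m) K); last first.
  by exists M => n Mn K' [<- nK'|]; [apply: nK; exists n | apply: MP].
exists (maxn M m.+1) => n; rewrite geq_max => /andP[Mn mn] K' [<- nK|]; last exact: MP.
by move: mn; rewrite (HI _ _ (grp_iso_trans nK (grp_iso_sym mK))) ltnn.
Qed.

Lemma free_product_fg l (G : 'I_l -> Grp) (P : Grp) (iota : forall j, G j -> P) :
  is_free_product l G P iota -> (forall j, finitely_generated (G j)) -> finitely_generated P.
Proof.
move=> fpP fgG.
pose s j := proj1_sig (constructive_indefinite_description _ (fgG j)).
have sP j := proj2_sig (constructive_indefinite_description _ (fgG j)).
exists (flat_map (fun j => List.map (@iota j) (s j)) (enum 'I_l)) => S SS Ss.
apply: (free_product_gen fpP) => // j; apply: (sP j) => [|x xs].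
  exact: (preimage_subgroup (proj1 fpP j) SS).
apply/Ss/in_flat_map; exists j; split; last exact: in_map.
by elim: (enum 'I_l) (mem_enum 'I_l j) => // k r IH; rewrite inE => /orP[/eqP->|/IH]; [left | right].
Qed.

Lemma index2_family l (G : 'I_l -> Grp) (s : seq 'I_l) : size s = 4 -> uniq s ->
  (forall j, j \in s -> has_index2_subgroup (G j)) ->
  exists (jj : 'I_4 -> 'I_l) (lab : 'I_l -> 'I_4) (K : forall j, G j -> Prop) (xx : forall j, G j),
    (forall b, lab (jj b) = b) /\
    [/\ forall j, is_subgroup (K j), forall j x y, ~ K j x -> ~ K j y -> K j (x ** y),
      forall b, ~ K (jj b) (xx (jj b)) & forall j, jj (lab j) = j \/ forall x, K j x].
Proof.
move=> s4 us s2; case: s s4 us s2 => // j0 s' s4 us s2; set s := j0 :: s' in s4 us s2.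
have D j : exists Kx : (G j -> Prop) * G j, [/\ is_subgroup Kx.1,
    forall x y, ~ Kx.1 x -> ~ Kx.1 y -> Kx.1 (x ** y), j \in s -> ~ Kx.1 Kx.2 &
    j \in s \/ forall x, Kx.1 x].
  case js : (j \in s); last by exists ((fun=> True), gone); split=> //; right.
  have [K [KS [a [Ka aK]]]] := s2 j js; exists (K, a); split=> //; auto.
  exact: index2_mul aK.
pose Kx j := proj1_sig (constructive_indefinite_description _ (D j)).
have KxP j : [/\ is_subgroup (Kx j).1,
    forall x y, ~ (Kx j).1 x -> ~ (Kx j).1 y -> (Kx j).1 (x ** y), j \in s -> ~ (Kx j).1 (Kx j).2 &
    j \in s \/ forall x, (Kx j).1 x] := proj2_sig (constructive_indefinite_description _ (D j)).
(* Outside [s] the index is out of range and [inord] returns a default label; there [K] is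
   everything. *)
exists (fun b => nth j0 s b), (fun j => inord (index j s)), (fun j => (Kx j).1), (fun j => (Kx j).2).
split; first by move=> b; rewrite index_uniq ?s4 // inord_val.
split=> [j|j|b|j].
- by have [] := KxP j.
- by have [] := KxP j.
- by have [_ _ e _] := KxP (nth j0 s b); apply: e; rewrite mem_nth ?s4.
- have [_ _ _ [js|]] := KxP j; [left | by right].
  by rewrite inordK ?nth_index // -s4 index_mem.
Qed.

Theorem theorem5p6 (l : nat) (G : 'I_l -> Grp) (P : Grp)
  (iota : forall j, G j -> P) (d : nat) :
  4 <= l ->
  (forall j, finitely_generated (G j)) ->
  (forall j, residually_finite (G j)) ->
  (forall j, CSA_trivial_centralizers (G j)) ->
  (exists j1 j2 j3 j4 : 'I_l,
     j1 <> j2 /\ j1 <> j3 /\ j1 <> j4 /\ j2 <> j3 /\ j2 <> j4 /\ j3 <> j4 /\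
     has_index2_subgroup (G j1) /\ has_index2_subgroup (G j2) /\
     has_index2_subgroup (G j3) /\ has_index2_subgroup (G j4)) ->
  is_free_product l G P iota ->
  2 <= d ->
  genus_infinite (power_grp P d).
Proof.
move=> _ fgG rfG _ [j1 [j2 [j3 [j4 [n12 [n13 [n14 [n23 [n24 [n34 [x1 [x2 [x3 x4]]]]]]]]]]]]] fpP d2.
have us : uniq [:: j1; j2; j3; j4].
  by rewrite /= !inE !negb_or; apply/and4P; split; rewrite ?andbT; do ?[apply/andP; split]; apply/eqP.
have s2 j : j \in [:: j1; j2; j3; j4] -> has_index2_subgroup (G j).
  by rewrite !inE => /or4P[] /eqP ->.
have indP : indecomp P.
  apply: (free_product_indecomp fpP us) => j /s2[K [KS [a [Ka _]]]]; exists a => a1.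
  by apply: Ka; rewrite a1; case: KS.
have [jj [lab [K [xx [jjK [KS K2 Kx Kall]]]]]] := index2_family (erefl : size [:: _; _; _; _] = 4) us s2.
have ker n := kernel_exists fpP fgG jjK KS K2 Kx Kall n.
pose N n := proj1_sig (constructive_indefinite_description _ (ker n)).
have NP n : exists (X : Grp) (q : P -> X),
  [/\ is_normal (N n), normal_fg (N n) & no_finite_quotient (N n)] /\
  [/\ is_quotient (N n) q, central_ext_split X, hypercentral_cover n X &
    exists p, N n p /\ p <> gone] := proj2_sig (constructive_indefinite_description _ (ker n)).
have nN n : is_normal (N n) by have [X [q [[]]]] := NP n.
pose i0 : 'I_d := Ordinal (ltnW d2); pose i1 : 'I_d := Ordinal d2.
have i01 : i0 != i1 by [].
apply: (@genus_infinite_of_seq _ (fun n => fibre i0 i1 (nN n))) => [n|n m iso].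
  have [X [q [[_ fgN nfq] [qX spl _ _]]]] := NP n; split; [|split].
  - by apply: fibre_fg => //; apply: free_product_fg fpP fgG.
  - exact: (fibre_rf (free_product_rf fpP rfG)).
  - exact: (fibre_same_quotients i01 _ qX).
have [X [q [_ [qX _ cX ntN]]]] := NP n; have [X' [q' [_ [qX' _ cX' ntN']]]] := NP m.
have isoX := fibre_iso i01 indP qX qX' ntN ntN' iso.
by apply/eqP; rewrite eqn_leq (cover_le cX cX' isoX) (cover_le cX' cX (grp_iso_sym isoX)).
Qed.
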